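(* Let $n\ge 1$. The following three facts hold for all partitions $\lambda$ with at most $n$ parts. (a) The operators $D^{(n)}_s(u;q,t)$ for different $u$ commute on the monomials dominated by $m_\lambda$, i.e. on the span of the $s^k m_\mu$ with $(k,\mu)\le(0,\lambda)$; and thus, for each monomial $s^k m_\mu$ dominated by $m_\lambda$, they have a common eigenfunction $s^k\bar{P}^{*(n)}_\mu(;s)$ with leading monomial $s^km_\mu$ (that is, of the form $s^k m_\mu+{}$dominated terms). (b) For any partition $\mu$ with at most $n$ parts, $\bar{P}^{*(n)}_\lambda(\mu;s)=0$ unless $\lambda\subset\mu$. (c) $\bar{P}^{*(n)}_\lambda(\lambda;s)\ne 0$.
   Context: Let $\mathbb F=\mathbb Q(q,t)$, with a fixed square root $\sqrt q$ of $q$ adjoined when needed; $u$ is a parameter (adjoined to the coefficients). $BC_n$ is the group acting on Laurent polynomials in $x_1,\dots,x_n$ by permutations of the variables and inversions $x_i\mapsto x_i^{-1}$. Consider the ring $\mathbb F[s,1/s][x_1^{\pm1},\dots,x_n^{\pm1}]^{BC_n}$ with basis $s^k m_\lambda$ ($k\in\mathbb Z$, $\lambda$ a partition with at most $n$ parts), where $m_\lambda(x)$ is the $BC_n$-orbit sum of $\prod_i x_i^{\lambda_i}$. Dominance order on partitions (possibly of different sizes): $\mu\le\lambda$ iff $\mu_1+\dots+\mu_k\le\lambda_1+\dots+\lambda_k$ for all $k\ge1$. It is extended to pairs by $(k,\lambda)\ge(l,\mu)$ iff $\lambda\ge\mu$ and $|l-k|\le|\lambda|-|\mu|$; a monomial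 $s^l m_\mu$ is dominated by $s^k m_\lambda$ iff $(l,\mu)\le(k,\lambda)$. ''$s^km_\mu+$ dominated terms'' means $s^km_\mu$ plus a linear combination of monomials strictly dominated by it. $\lambda\subset\mu$ means $\lambda_i\le\mu_i$ for all $i$. The difference operator $D^{(n)}(u_1,u_2;q,t)$ acts by $$(D^{(n)}(u_1,u_2;q,t)f)(x_1,\dots,x_n)=\sum_{\sigma\in\{\pm1\}^n}\prod_{1\le i\le n}\frac{(1-u_1x_i^{\sigma_i})(1-u_2x_i^{\sigma_i})}{1-x_i^{2\sigma_i}}\prod_{1\le i<j\le n}\frac{1-t x_i^{\sigma_i}x_j^{\sigma_j}}{1-x_i^{\sigma_i}x_j^{\sigma_j}}\,f(x_1q^{\sigma_1/2},\dots,x_nq^{\sigma_n/2}),$$ and $$(D^{(n)}_s(u;q,t)f)(x_1,\dots,x_n;s)=D^{(n)}(s,u/s;q,t)f(x_1,\dots,x_n;s\sqrt q),$$ i.e. $s$ is also replaced by $s\sqrt q$ in $f$. The operator $D^{(n)}_s(u;q,t)$ maps the ring $\mathbb F[s,1/s][x_1^{\pm1},\dots,x_n^{\pm1}]^{BC_n}$ (with $u$ and $\sqrt q$ adjoined to the coefficients) to itself, triangularly with respect to dominance, with $D^{(n)}_s(u;q,t)s^km_\lambda=q^{k/2}q^{-|\lambda|/2}\prod_{1\le i\le n}(1-q^{\lambda_i}t^{n-i}u)\,s^km_\lambda+{}$dominated terms; hence for generic $u$ the eigenfunction with a given leading monomial is unique. $\bar P^{*(n)}_\lambda(;s)$ denotes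 the common eigenfunction of part (a) with leading monomial $m_\lambda$. For $p\in\mathbb F(s)[x_i^{\pm1}]^{BC_n}$ and a partition $\mu$ with at most $n$ parts, $p(\mu;s)$ denotes the value of $p(x_1,\dots,x_n;s)$ at $x_i=q^{\mu_i}t^{n-i}s$, $1\le i\le n$. *)

(* Defs.v *)
From HB Require Import structures.
From mathcomp Require Import all_boot all_order all_algebra perm.
From mathcomp.finmap Require Import finmap.
(* The notations of monalg for multivariate polynomials mask those of mpoly. *)
From mathcomp.multinomials Require Import -(notations) monalg.
From mathcomp.multinomials Require Import mpoly.
Set Implicit Arguments.
Unset Strict Implicit.
Unset Printing Implicit Defensive.
Import Order.TTheory GRing.Theory Num.Theory.
Local Open Scope ring_scope.
Local Notation "x %:F" := (@FracField.tofrac _ x).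

(* Q(q,t), with its two generators Fq and Ft. *)
Definition Fqt : fieldType := {fraction {mpoly rat[2]}}.
Definition Fq : Fqt := ('X_(ord0 : 'I_2) : {mpoly rat[2]})%:F.
Definition Ft : Fqt := ('X_(ord_max : 'I_2) : {mpoly rat[2]})%:F.

Definition sgb (b : bool) : int := (-1) ^+ b.

(* Partitions with at most n parts, padded with zeros to length n.
   Indices are 0-based: [part_nth lam i] is lambda_{i+1}. *)
Definition part (n : nat) := {l : n.-tuple nat | sorted geq l}.
Definition part_nth n (lam : part n) (i : 'I_n) : nat := tnth (val lam) i.
Definition part_size n (lam : part n) : nat := sumn (val lam).
Definition part_sub n (lam mu : part n) : Prop :=
  forall i, (part_nth lam i <= part_nth mu i)%N.

(* Partitions of different sizes may be comparable: only partial sums matter. *)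
Definition dominated n (mu lam : part n) : Prop :=
  forall k, (sumn (take k (val mu)) <= sumn (take k (val lam)))%N.

(* [(k, lam)] stands for the monomial s^k m_lam. *)
Definition smon_le n (b a : int * part n) : Prop :=
  dominated b.2 a.2 /\
  `|b.1 - a.1| <= (part_size a.2)%:Z - (part_size b.2)%:Z.
Definition smon_lt n (b a : int * part n) : Prop := smon_le b a /\ b <> a.

(* The free R-module on the monomials s^k x^e, i.e. the underlying module of
   R[s,1/s][x_1^{+-1},...,x_n^{+-1}]. It carries no ring structure here
   (monalg excludes invertible exponents); products are taken after [leval]. *)
Definition laurent (R : nzRingType) (n : nat) :=
  monalg.malg (int * {ffun 'I_n -> int})%type R.

(* Value of f at s and x_1,...,x_n, the coefficients being read through phi. *)
Definition leval (R : nzRingType) (L : fieldType) n (phi : R -> L)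
    (s : L) (x : 'I_n -> L) (f : laurent R n) : L :=
  monalg.mmap phi
    (fun m : int * {ffun 'I_n -> int} => s ^ m.1 * \prod_(i < n) x i ^ m.2 i) f.

Definition mul_spow (R : nzRingType) n (k : int) (f : laurent R n) : laurent R n :=
  \sum_(m <- monalg.msupp f) monalg.mkmalgU (k + m.1, m.2) (monalg.mcoeff m f).

(* The exponents in the BC_n-orbit of lam, each listed once. *)
Definition bc_orbit n (lam : part n) : seq {ffun 'I_n -> int} :=
  undup (codom (fun g : {ffun 'I_n -> bool} * 'S_n =>
    [ffun i => sgb (g.1 i) * (part_nth lam (g.2 i))%:Z])).

Definition smon (R : nzRingType) n (a : int * part n) : laurent R n :=
  \sum_(e <- bc_orbit a.2) monalg.mkmalgU (a.1, e) 1.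

Definition smon_span (R : nzRingType) n (A : int * part n -> Prop)
    (f : laurent R n) : Prop :=
  exists (S : seq (int * part n)) (c : int * part n -> R),
    (forall b, b \in S -> A b) /\ f = \sum_(b <- S) c b *: smon R b.

(* f = s^k m_mu + dominated terms, where a = (k, mu). *)
Definition has_leading (R : nzRingType) n (a : int * part n)
    (f : laurent R n) : Prop :=
  smon_span (fun b => smon_lt b a) (f - smon R a).

(* The field K(s, x_1,...,x_n): variable 0 is s, variable [lift ord0 i] is x_i. *)
Definition ratfun (K : fieldType) (n : nat) : fieldType :=
  {fraction {mpoly K[n.+1]}}.

Section Ratfun.
Variables (K : fieldType) (n : nat).
Implicit Types f : ratfun K n.

Definition rC (c : K) : ratfun K n := (c%:MP_[n.+1])%:F.
Definition rS : ratfun K n := ('X_(ord0 : 'I_n.+1) : {mpoly K[n.+1]})%:F.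
Definition rX (i : 'I_n) : ratfun K n :=
  ('X_(lift ord0 i) : {mpoly K[n.+1]})%:F.

(* The substitution (s, x_i) |-> (a s, c_i x_i). For nonzero a and c_i it is an
   automorphism of the polynomial ring, so the quotient below does not depend
   on the representative and its denominator is nonzero. *)
Definition rescale (a : K) (c : 'I_n -> K) f : ratfun K n :=
  let y := [tuple (if unlift ord0 j is Some i then c i else a) *: 'X_j
             | j < n.+1] : n.+1.-tuple {mpoly K[n.+1]} in
  (comp_mpoly y \n_(repr f))%:F / (comp_mpoly y \d_(repr f))%:F.

(* D^(n)(u1,u2;q,t), where r is the chosen square root of q. *)
Definition Dop (r t : K) (u1 u2 : ratfun K n) f : ratfun K n :=
  \sum_(sg : {ffun 'I_n -> bool})
    (let y i := rX i ^ sgb (sg i) in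
     (\prod_(i < n) ((1 - u1 * y i) * (1 - u2 * y i) / (1 - y i ^+ 2))) *
     (\prod_(i < n) \prod_(j < n | (i < j)%N)
        ((1 - rC t * y i * y j) / (1 - y i * y j))) *
     rescale 1 (fun i => r ^ sgb (sg i)) f).

(* D^(n)_s(u;q,t): u1 = s and u2 = u/s, with s also replaced by r s in f. *)
Definition Dsop (r t u : K) f : ratfun K n :=
  Dop r t rS (rC u / rS) (rescale r (fun=> 1) f).

End Ratfun.

(* A Laurent polynomial viewed in K(s, x_1,...,x_n). *)
Definition to_ratfun (R : nzRingType) (K : fieldType) n (phi : R -> K)
    (f : laurent R n) : ratfun K n :=
  leval (fun c => rC n (phi c)) (rS K n) (@rX K n) f.

(* Common eigenfunction, with leading monomial s^k m_mu for a = (k, mu), of the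
   operators D^(n)_s(u;q,t): u ranges over all extensions K of Q(q,t) that
   contain a square root r of q, in particular over indeterminates. *)
Definition common_eigenfunction n (a : int * part n) (P : laurent Fqt n) : Prop :=
  has_leading a P /\
  forall (K : fieldType) (iota : {rmorphism Fqt -> K}) (r u : K),
    r ^+ 2 = iota Fq ->
    exists e : K,
      Dsop r (iota Ft) u (to_ratfun iota P) = rC n e * to_ratfun iota P.

(* P is \bar P^{*(n)}_mu(;s). *)
Definition is_Pbar n (mu : part n) (P : laurent Fqt n) : Prop :=
  common_eigenfunction (0, mu) P.

(* x_i = q^{mu_i} t^{n-i} s; the 0-based index turns n - i into n - i.+1. *)
Definition eval_part n (p : laurent Fqt n) (mu : part n) : {fraction {poly Fqt}} :=
  let s := ('X : {poly Fqt})%:F in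
  leval (fun c => (c%:P)%:F) s
    (fun i => ((Fq ^+ part_nth mu i * Ft ^+ (n - i.+1))%:P)%:F * s) p.

(* Main.v *)
From HB Require Import structures.
Require Import Defs.
From mathcomp Require Import all_boot all_order all_algebra perm.
From mathcomp Require Import ring zify.
From mathcomp Require Import vector fieldext polydiv.
From mathcomp.finmap Require Import finmap.
From mathcomp.multinomials Require Import -(notations) monalg.
From mathcomp.multinomials Require Import mpoly.
Set Implicit Arguments.
Unset Strict Implicit.
Unset Printing Implicit Defensive.
Import Order.TTheory GRing.Theory Num.Theory.
Local Open Scope ring_scope.
Local Notation "x %:F" := (@FracField.tofrac _ x).

(**
Write q = r^2 and let D_u be the operator of parameter u. Three facts about D_u
carry the whole proof.

Triangularity ([D_le]). Let Delta be the Weyl denominator of type C_n. Every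
denominator occurring in D_u divides Delta, so Delta * D_u f is a Laurent
polynomial; it is antisymmetric under BC_n because D_u f is invariant. An
antisymmetric Laurent polynomial has strictly dominant leading exponents
mu + rho, and subtracting multiples of Delta * m_mu removes them one at a time:
this divides it by Delta ([antisym_div]). The dominance order is a family of
bounds on linear functionals of the exponents, and such bounds pass from f to
D_u f factor by factor. The leading coefficient, computed for the functional
rho, is the eigenvalue, a product over i with factors 1 - u q^(lam_i) t^(n-i).

Values ([eval_D]). At the point x_i = q^(mu_i) t^(n-i) s, the summand of D_u f
attached to a sign vector involves the value of f at mu minus a vertical strip,
and its coefficient vanishes when the result is not a partition: so D_u acts on
the values at partitions by a matrix triangular for inclusion. Its diagonal entry
at mu vanishes when u q^(mu_i) t^(n-i) = 1 for some i.

Choice of u. If mu differs from lam, some such u makes the diagonal entry at mu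
vanish but not the eigenvalue at lam. Hence a common eigenfunction with leading
monomial m_lam vanishes at mu as soon as it vanishes at all smaller partitions.
By induction it vanishes at every mu that does not contain lam ([eigen_vanish]);
if it also vanished at lam it would vanish at all partitions, which is impossible
since the multiples of rho already detect the leading coefficient
([eigen_nonvanish]).

For existence, apply to m_lam these well chosen D_u, one for each mu <> lam with
|mu| <= |lam|, in order of increasing size. Every step kills the value at one
more mu and keeps the values already killed, while the leading coefficient stays
nonzero ([good_exists]). The result P is characterised by these vanishing
conditions and its leading term: a combination of dominated terms satisfying them
expands in the eigenfunctions s^k P_nu of lower leading monomial, and evaluating
at the smallest nu that occurs shows that it is zero ([expands_uniq]). Now
D_u P - E_u P, with E_u the eigenvalue at lam, is such a combination, for every u;
so P is a common eigenfunction, the s^k P_nu diagonalise all the D_u at once, and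
the D_u commute ([D_commute]).

All this takes place over a field containing a square root of q, but the vanishing
conditions are linear with coefficients in Q(q,t): a Q(q,t)-linear projection
Q(q,t)(sqrt q) -> Q(q,t) with 1 |-> 1 maps P to a solution over Q(q,t)
([interpF_exists]), which then serves over every extension.
*)

(** * Fractions and their specialisations *)

Lemma frac_repr (R : idomainType) (z : {fraction R}) :
  z * (\d_(repr z))%:F = (\n_(repr z))%:F.
Proof.
elim/quotW: z => x; have := FracField.equivf_r x.
set n := \n_(repr _); set d := \d_(repr _) => e.
have d0 : d != 0 by apply: denom_ratioP.
unlock FracField.tofrac; rewrite -[LHS]FracField.pi_mul.
apply/eqmodP; rewrite /= FracField.equivfE /FracField.mulf.
by rewrite !numden_Ratio ?mulf_neq0 ?oner_neq0 ?denom_ratioP // !mulr1 e.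
Qed.

Section FracMap.
Variables (R : idomainType) (L : fieldType) (phi : {rmorphism R -> L}).

(** Specialisation of a fraction along phi, which may have a kernel. It is a
    relation because the chosen representative of a fraction may have a denominator
    killed by phi although the fraction itself is regular. *)
Definition frac_at (z : {fraction R}) (v : L) : Prop :=
  exists N D, [/\ phi D != 0, z * D%:F = N%:F & v * phi D = phi N].

Lemma frac_at_uniq z v v' : frac_at z v -> frac_at z v' -> v = v'.
Proof.
move=> [N [D [D0 zD vD]]] [N' [D' [D'0 zD' vD']]].
apply: (mulIf (mulf_neq0 D0 D'0)).
rewrite mulrA vD mulrCA vD' -!rmorphM; congr (phi _).
apply/eqP; rewrite -tofrac_eq !tofracM -zD -zD'; apply/eqP; ring.
Qed.

Lemma frac_at_tofrac p : frac_at p%:F (phi p).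
Proof. by exists p, 1; rewrite !rmorph1 oner_neq0 !mulr1. Qed.

Lemma frac_at1 : frac_at 1 1.
Proof. by have := frac_at_tofrac 1; rewrite !rmorph1. Qed.

Lemma frac_at0 : frac_at 0 0.
Proof. by have := frac_at_tofrac 0; rewrite !rmorph0. Qed.

Lemma frac_atD z v z' v' : frac_at z v -> frac_at z' v' -> frac_at (z + z') (v + v').
Proof.
move=> [N [D [D0 zD vD]]] [N' [D' [D'0 zD' vD']]].
exists (N * D' + N' * D), (D * D'); split; first by rewrite rmorphM mulf_neq0.
  rewrite !(tofracD, tofracM) -zD -zD'; ring.
rewrite !(rmorphD, rmorphM) /= -vD -vD'; ring.
Qed.

Lemma frac_atN z v : frac_at z v -> frac_at (- z) (- v).
Proof.
by move=> [N [D [D0 zD vD]]]; exists (- N), D; rewrite !rmorphN /= !mulNr zD vD.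
Qed.

Lemma frac_atB z v z' v' : frac_at z v -> frac_at z' v' -> frac_at (z - z') (v - v').
Proof. by move=> h h'; apply: frac_atD => //; apply: frac_atN. Qed.

Lemma frac_atM z v z' v' : frac_at z v -> frac_at z' v' -> frac_at (z * z') (v * v').
Proof.
move=> [N [D [D0 zD vD]]] [N' [D' [D'0 zD' vD']]].
exists (N * N'), (D * D'); split; first by rewrite rmorphM mulf_neq0.
  rewrite !tofracM -zD -zD'; ring.
rewrite !rmorphM /= -vD -vD'; ring.
Qed.

Lemma frac_atV z v : v != 0 -> frac_at z v -> frac_at z^-1 v^-1.
Proof.
move=> v0 [N [D [D0 zD vD]]]; exists D, N.
have N0 : phi N != 0 by rewrite -vD mulf_neq0.
have z0 : z != 0.
  apply/eqP => z0; move: zD; rewrite z0 mul0r => /esym/eqP; rewrite tofrac_eq0.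
  by move=> /eqP N0'; rewrite N0' rmorph0 eqxx in N0.
split=> //; first by rewrite -zD mulKf.
by rewrite -vD mulKf.
Qed.

Lemma frac_at_div z v z' v' : v' != 0 ->
  frac_at z v -> frac_at z' v' -> frac_at (z / z') (v / v').
Proof. by move=> v0 h h'; apply: frac_atM => //; apply: frac_atV. Qed.

Lemma frac_atXn z v k : frac_at z v -> frac_at (z ^+ k) (v ^+ k).
Proof.
move=> h; elim: k => [|k IH]; first by rewrite !expr0; apply: frac_at1.
by rewrite !exprS; apply: frac_atM.
Qed.

Lemma frac_atXz z v (k : int) : v != 0 -> frac_at z v -> frac_at (z ^ k) (v ^ k).
Proof.
move=> v0 h; case: k => k; first exact: frac_atXn.
by rewrite !NegzE -!exprnN; apply: frac_atV; [rewrite expf_neq0|apply: frac_atXn].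
Qed.

Lemma frac_at_sum I (s : seq I) (P : pred I) (F : I -> {fraction R}) (G : I -> L) :
  (forall i, P i -> frac_at (F i) (G i)) ->
  frac_at (\sum_(i <- s | P i) F i) (\sum_(i <- s | P i) G i).
Proof.
by move=> h; apply: (big_rec2 (fun x y => frac_at y x) frac_at0) => i x y Pi xy; apply: frac_atD (h i Pi) _.
Qed.

Lemma frac_at_prod I (s : seq I) (P : pred I) (F : I -> {fraction R}) (G : I -> L) :
  (forall i, P i -> frac_at (F i) (G i)) ->
  frac_at (\prod_(i <- s | P i) F i) (\prod_(i <- s | P i) G i).
Proof.
by move=> h; apply: (big_rec2 (fun x y => frac_at y x) frac_at1) => i x y Pi xy; apply: frac_atM (h i Pi) _.
Qed.

(** For phi injective this is the extension of phi to fractions; [rescale] is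
    defined by the same formula. *)
Definition frac_lift (z : {fraction R}) : L := phi \n_(repr z) / phi \d_(repr z).

Hypothesis phi_inj : injective phi.

Lemma frac_liftP z : frac_at z (frac_lift z).
Proof.
have d0 : phi \d_(repr z) != 0.
  by rewrite -(rmorph0 phi) inj_eq // denom_ratioP.
by exists \n_(repr z), \d_(repr z); rewrite frac_repr /frac_lift divfK.
Qed.

Lemma frac_liftE z v : frac_at z v -> frac_lift z = v.
Proof. exact: (frac_at_uniq (frac_liftP z)). Qed.

Lemma frac_lift_zmod : zmod_morphism frac_lift.
Proof. by move=> x y; apply: frac_liftE; apply: frac_atB; apply: frac_liftP. Qed.

Lemma frac_lift_monoid : monoid_morphism frac_lift.
Proof.
split; first exact/frac_liftE/frac_at1.
by move=> x y; apply: frac_liftE; apply: frac_atM; apply: frac_liftP.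
Qed.

Lemma frac_lift_rmorphism : exists psi : {rmorphism {fraction R} -> L},
  psi =1 frac_lift.
Proof.
pose A := GRing.isZmodMorphism.Build _ _ frac_lift frac_lift_zmod.
pose B := GRing.isMonoidMorphism.Build _ _ frac_lift frac_lift_monoid.
pose psi : {rmorphism {fraction R} -> L} := HB.pack frac_lift A B.
by exists psi.
Qed.

Lemma frac_lift_tofrac p : frac_lift p%:F = phi p.
Proof. exact/frac_liftE/frac_at_tofrac. Qed.

End FracMap.

(** * Laurent polynomials inside the field of rational functions *)

Notation cf m f := (monalg.mcoeff m f).
Notation lsupp f := (monalg.msupp f).
Notation lmon m c := (monalg.mkmalgU m c).

Notation expo n := (int * {ffun 'I_n -> int})%type.

HB.instance Definition _ (K : fieldType) n :=
  GRing.RMorphism.copy (@rC K n) (@FracField.tofrac _ \o @mpolyC n.+1 K).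

(** Several operations on Laurent polynomials relabel the monomials injectively
    while modifying the coefficients; this reads off the new coefficients. *)
Lemma cf_sum_lmon (R : nzRingType) n (U : seq (expo n)) (h : expo n -> expo n)
    (c : expo n -> R) m :
  uniq U -> injective h -> (m \notin U -> c m = 0) ->
  cf (h m) (\sum_(k <- U) lmon (h k) (c k)) = c m.
Proof.
move=> U_uniq h_inj c0; rewrite raddf_sum /=; have [mU|mU] := boolP (m \in U).
  rewrite (big_rem m) //= monalg.mcoeffUU big_seq big1 ?addr0 // => k.
  rewrite mem_rem_uniq // inE monalg.mcoeffU => /andP[km _].
  by case: eqP => // /h_inj e; rewrite e eqxx in km.
rewrite big_seq big1 ?c0 // => k kU.
by rewrite monalg.mcoeffU; case: eqP => // /h_inj e; rewrite -e kU in mU.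
Qed.

Section Laurent.
Variables (K : fieldType) (n : nat).
Local Notation L := (ratfun K n).
Local Notation lp := (@to_ratfun K K n id).
Implicit Types (m : expo n) (f g : laurent K n).

Definition mon m : L := rS K n ^ m.1 * \prod_(i < n) rX K i ^ m.2 i.

Lemma mpolyX_neq0 k : 'X_[k] != 0 :> {mpoly K[n.+1]}.
Proof. by rewrite -msupp_eq0 msuppX. Qed.

Lemma rS_neq0 : rS K n != 0.
Proof. by rewrite /rS tofrac_eq0 mpolyX_neq0. Qed.

Lemma rX_neq0 i : rX K (n := n) i != 0.
Proof. by rewrite /rX tofrac_eq0 mpolyX_neq0. Qed.

Lemma rCM : {morph @rC K n : x y / x * y}. Proof. exact: rmorphM. Qed.
Lemma rCD : {morph @rC K n : x y / x + y}. Proof. exact: rmorphD. Qed.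
Lemma rC1 : rC n 1 = 1 :> L. Proof. exact: rmorph1. Qed.
Lemma rC0 : rC n 0 = 0 :> L. Proof. exact: rmorph0. Qed.

Lemma monD m1 m2 : mon (m1 + m2) = mon m1 * mon m2.
Proof.
rewrite /mon /= expfzDr ?rS_neq0 // mulrACA -big_split; congr (_ * _).
by apply: eq_bigr => i _; rewrite ffunE expfzDr ?rX_neq0.
Qed.

Lemma mon0 : mon 0 = 1.
Proof. by rewrite /mon expr0z mul1r big1 // => i _; rewrite ffunE expr0z. Qed.

Lemma mon_neq0 m : mon m != 0.
Proof.
rewrite mulf_neq0 ?expfz_neq0 ?rS_neq0 //; apply/prodf_neq0 => i _.
by rewrite expfz_neq0 ?rX_neq0.
Qed.

Lemma lpE f : lp f = \sum_(m <- lsupp f) rC n (cf m f) * mon m.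
Proof. by []. Qed.

Lemma lpU m c : lp (lmon m c) = rC n c * mon m.
Proof. exact: (@monalg.mmapU _ _ _ (@rC K n)). Qed.

Lemma lp_is_zmod : zmod_morphism lp.
Proof. exact: (@monalg.mmapB _ _ _ (@rC K n)). Qed.

HB.instance Definition _ := GRing.isZmodMorphism.Build (laurent K n) L lp lp_is_zmod.

Lemma lpZ c f : lp (c *: f) = rC n c * lp f.
Proof.
rewrite [lp f]lpE mulr_sumr; under eq_bigr do rewrite mulrA -rCM -monalg.mcoeffZ.
exact: (@monalg.mmapEw _ _ _ (@rC K n) _ _ _ (monalg.msuppZ_le c f)).
Qed.

Definition expo_mnm (k : 'X_{1..n.+1}) : expo n :=
  (Posz (k ord0), [ffun i => Posz (k (lift ord0 i))]).

Lemma expo_mnm_inj : injective expo_mnm.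
Proof.
move=> k k' [k0 /ffunP ks]; apply/mnmP => i.
by case: (unliftP ord0 i) => [j|] ->; [have := ks j; rewrite !ffunE => -[] | exact: k0].
Qed.

Lemma tofracX k : ('X_[k] : {mpoly K[n.+1]})%:F = mon (expo_mnm k).
Proof.
rewrite mpolyXE_id rmorph_prod big_ord_recl rmorphXn; congr (_ * _).
by apply: eq_bigr => i _; rewrite rmorphXn ffunE.
Qed.

(** A large power of the product of all variables turns finitely many Laurent
    monomials into distinct monomials of the polynomial ring. *)
Lemma lp_inj : injective lp.
Proof.
apply: raddf_inj => f f0.
pose b m : nat := (absz m.1 + \sum_i absz (m.2 i))%N.
(* M bounds the exponents of f. *)
pose M := (\sum_(m <- lsupp f) b m)%N.
have bM m : m \in lsupp f -> (b m <= M)%N.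
  by move=> mf; rewrite /M (big_rem m) //= leq_addr.
pose top : expo n := (Posz M, [ffun => Posz M]).
pose sh m : 'X_{1..n.+1} := [multinom (if unlift ord0 j is Some i
   then absz (m.2 i + M%:Z)%R else absz (m.1 + M%:Z)%R) | j < n.+1].
have shE m : m \in lsupp f -> expo_mnm (sh m) = m + top.
  move=> /bM; rewrite /b => le; case: m le => l e /= le.
  have le1 : `|l|%N%:Z <= M by lia.
  have le2 i : `|e i|%N%:Z <= M.
    suff : (absz (e i) <= M)%N by lia.
    by apply: leq_trans le; rewrite (bigD1 i) //= addnA addnAC leq_addl.
  congr pair; first by rewrite /= mnmE unlift_none /=; lia.
  apply/ffunP => i; rewrite !ffunE mnmE liftK /=; have := le2 i; lia.
apply/monalg.malgP => m0; rewrite monalg.mcoeff0.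
have [m0f|] := boolP (m0 \in lsupp f); last by move/monalg.mcoeff_outdom.
have : (\sum_(m <- lsupp f) cf m f *: 'X_[sh m] : {mpoly K[n.+1]}) = 0.
  apply/eqP; rewrite -tofrac_eq0 rmorph_sum big_seq /=.
  under eq_bigr => m mf do
    rewrite -mul_mpolyC tofracM tofracX shE // monD mulrA.
  rewrite -big_seq -mulr_suml; apply/eqP/(etrans _ (mul0r (mon top))).
  by congr (_ * _); exact: f0.
move=> /(congr1 (mcoeff (sh m0))); rewrite mcoeff0 raddf_sum /=.
rewrite (big_rem m0) //= big_seq big1 ?addr0.
  by rewrite mcoeffZ mcoeffX eqxx mulr1.
move=> m; rewrite mem_rem_uniq ?finmap.fset_uniq // inE => /andP[m0m mf].
rewrite mcoeffZ mcoeffX; case: eqP => [e|_]; last by rewrite mulr0.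
have := shE m mf; rewrite e shE // => /addIr e'.
by rewrite e' eqxx in m0m.
Qed.

Lemma lp_eq0 f : (lp f == 0) = (f == 0).
Proof. by rewrite -(raddf0 lp) (inj_eq lp_inj). Qed.

(** The type [laurent] carries no product, so Laurent polynomials are multiplied
    as elements of the field, with this control on their exponents. *)
Definition supported (S : expo n -> Prop) (z : L) : Prop :=
  exists2 f, z = lp f & forall m, cf m f != 0 -> S m.

Lemma supported_sub (S S' : expo n -> Prop) z :
  (forall m, S m -> S' m) -> supported S z -> supported S' z.
Proof. by move=> SS' [f -> h]; exists f => // m /h/SS'. Qed.

Lemma supported0 S : supported S 0.
Proof. by exists 0; rewrite ?raddf0 // => m; rewrite monalg.mcoeff0 eqxx. Qed.

Lemma supportedD S z z' : supported S z -> supported S z' -> supported S (z + z').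
Proof.
move=> [f -> h] [f' -> h']; exists (f + f'); first by rewrite raddfD.
move=> m; rewrite monalg.mcoeffD.
have [e|/h //] := eqVneq (cf m f) 0.
by rewrite e add0r => /h'.
Qed.

Lemma supportedN S z : supported S z -> supported S (- z).
Proof.
move=> [f -> h]; exists (- f); first by rewrite raddfN.
by move=> m; rewrite monalg.mcoeffN oppr_eq0 => /h.
Qed.

Lemma supportedB S z z' : supported S z -> supported S z' -> supported S (z - z').
Proof. by move=> h h'; apply: supportedD => //; apply: supportedN. Qed.

Lemma supported_sum S I (s : seq I) (P : pred I) (F : I -> L) :
  (forall i, P i -> supported S (F i)) -> supported S (\sum_(i <- s | P i) F i).
Proof. by move=> h; apply: big_ind h; [exact: supported0 | exact: supportedD]. Qed.

Lemma supported_mon (S : expo n -> Prop) m c : S m -> supported S (rC n c * mon m).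
Proof.
move=> Sm; exists (lmon m c); first by rewrite lpU.
move=> m'; rewrite monalg.mcoeffU; case: (eqVneq m m') => [<- //|_].
by rewrite mulr0n eqxx.
Qed.

Lemma supportedZ S c z : supported S z -> supported S (rC n c * z).
Proof.
move=> [f -> h]; exists (c *: f); first by rewrite lpZ.
by move=> m; rewrite monalg.mcoeffZ mulf_eq0 negb_or => /andP[_ /h].
Qed.

Lemma supported_lp (S : expo n -> Prop) f :
  supported S (lp f) <-> forall m, cf m f != 0 -> S m.
Proof. by split=> [[g /lp_inj ->]//|h]; exists f. Qed.

Lemma supported_mul (S1 S2 S3 : expo n -> Prop) z1 z2 :
  (forall m1 m2, S1 m1 -> S2 m2 -> S3 (m1 + m2)) ->
  supported S1 z1 -> supported S2 z2 -> supported S3 (z1 * z2).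
Proof.
move=> h [f -> hf] [g -> hg]; rewrite !lpE mulr_suml big_seq.
apply: supported_sum => m mf; rewrite mulr_sumr big_seq; apply: supported_sum => m' mg.
rewrite mulrACA -rCM -monD; apply: supported_mon; apply: h.
  by apply: hf; rewrite monalg.mcoeff_neq0.
by apply: hg; rewrite monalg.mcoeff_neq0.
Qed.

End Laurent.

(** * Degrees, leading terms and monomial substitutions *)

Section Degree.
Variables (K : fieldType) (n : nat).
Local Notation L := (ratfun K n).
Local Notation lp := (@to_ratfun K K n id).
Implicit Types (m w : expo n) (f g : laurent K n) (z : L).

Definition dot w m : int := w.1 * m.1 + \sum_i w.2 i * m.2 i.

Lemma dotD w m1 m2 : dot w (m1 + m2) = dot w m1 + dot w m2.
Proof.
rewrite /dot mulrDr addrACA -big_split; congr (_ + _).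
by apply: eq_bigr => i _; rewrite ffunE mulrDr.
Qed.

Lemma dot0 w : dot w 0 = 0.
Proof. by rewrite /dot mulr0 add0r big1 // => i _; rewrite ffunE mulr0. Qed.

Definition degle w (d : int) z := supported (fun m => dot w m <= d) z.
Definition deglt w (d : int) z := supported (fun m => dot w m < d) z.
Definition lead w m (c : K) z := deglt w (dot w m) (z - rC n c * mon K m).

Lemma degle1 w : degle w 0 1.
Proof. by rewrite -(mon0 K n) -[mon K 0]mul1r -(rC1 K n); apply: supported_mon; rewrite dot0. Qed.

Lemma degle_mul w d1 d2 z1 z2 :
  degle w d1 z1 -> degle w d2 z2 -> degle w (d1 + d2) (z1 * z2).
Proof. by apply: supported_mul => m1 m2; rewrite dotD; apply: lerD. Qed.

Lemma degle_prod w I (s : seq I) (P : pred I) (F : I -> L) (d : I -> int) :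
  (forall i, P i -> degle w (d i) (F i)) ->
  degle w (\sum_(i <- s | P i) d i) (\prod_(i <- s | P i) F i).
Proof.
by move=> h; apply: (big_rec2 (fun x z => degle w x z) (degle1 w)) => i x y Pi xy; apply: degle_mul (h i Pi) _.
Qed.

Lemma lead_degle w m c z : lead w m c z -> degle w (dot w m) z.
Proof.
move=> h; rewrite -[z](subrK (rC n c * mon K m)).
by apply: supportedD; [apply: supported_sub h => m' /ltW | apply: supported_mon].
Qed.

Lemma lead1 w : lead w 0 1 1.
Proof. by rewrite /lead mon0 rC1 mulr1 subrr; apply: supported0. Qed.

Lemma lead_mon w m c : lead w m c (rC n c * mon K m).
Proof. by rewrite /lead subrr; apply: supported0. Qed.

Lemma lead_add w m c z z' : lead w m c z -> deglt w (dot w m) z' ->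
  lead w m c (z + z').
Proof. by move=> h h'; rewrite /lead addrAC; apply: supportedD. Qed.

Lemma lead_lin w m c c' z z' : lead w m c z -> lead w m c' z' ->
  lead w m (c + c') (z + z').
Proof.
move=> h h'; have := supportedD h h'; rewrite /lead /deglt.
by congr (supported _ _); rewrite rCD; ring.
Qed.

Lemma lead0 w m : lead w m 0 0.
Proof. by rewrite /lead rC0 mul0r subrr; apply: supported0. Qed.

Lemma lead_sum w m I (s : seq I) (P : pred I) (F : I -> L) (c : I -> K) :
  (forall i, P i -> lead w m (c i) (F i)) ->
  lead w m (\sum_(i <- s | P i) c i) (\sum_(i <- s | P i) F i).
Proof.
by move=> h; apply: (big_rec2 (lead w m) (lead0 w m)) => i x y Pi xy; apply: lead_lin (h i Pi) _.
Qed.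

Lemma lead_mul w m1 c1 z1 m2 c2 z2 :
  lead w m1 c1 z1 -> lead w m2 c2 z2 -> lead w (m1 + m2) (c1 * c2) (z1 * z2).
Proof.
move=> h1 h2; rewrite /lead dotD.
have -> : z1 * z2 - rC n (c1 * c2) * mon K (m1 + m2) =
  (z1 - rC n c1 * mon K m1) * z2 + (rC n c1 * mon K m1) * (z2 - rC n c2 * mon K m2).
  by rewrite rCM monD; ring.
apply: supportedD.
  by apply: supported_mul h1 (lead_degle h2) => m m'; rewrite dotD; apply: ltr_leD.
apply: supported_mul (lead_degle (lead_mon w m1 c1)) h2 => m m'.
by rewrite dotD; apply: ler_ltD.
Qed.

Lemma lead_prod w I (s : seq I) (P : pred I) (F : I -> L) (m : I -> expo n) (c : I -> K) :
  (forall i, P i -> lead w (m i) (c i) (F i)) ->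
  lead w (\sum_(i <- s | P i) m i) (\prod_(i <- s | P i) c i)
    (\prod_(i <- s | P i) F i).
Proof.
move=> h; elim/big_ind3: _ (lead1 w) => //.
  by move=> m1 c1 z1 m2 c2 z2 h1 h2 _; apply: lead_mul; [apply: h1|apply: h2]; exact: lead1.
by move=> i Pi _; apply: h.
Qed.

Lemma lead_cf w m c f : lead w m c (lp f) -> cf m f = c.
Proof.
rewrite /lead -lpU -raddfB => /supported_lp/(_ m).
rewrite monalg.mcoeffB monalg.mcoeffUU ltxx => h.
by apply/eqP; rewrite -subr_eq0; apply/negPn/negP => /h.
Qed.

Lemma lead_lp w m f : (forall m', cf m' f != 0 -> m' <> m -> dot w m' < dot w m) ->
  lead w m (cf m f) (lp f).
Proof.
move=> h; rewrite /lead -lpU -raddfB; apply/supported_lp => m'.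
rewrite monalg.mcoeffB monalg.mcoeffU.
case: (eqVneq m m') => [-> |mm']; first by rewrite subrr eqxx.
by rewrite mulr0n subr0 => /h; apply=> e; rewrite e eqxx in mm'.
Qed.

End Degree.

Section Subst.
Variables (K : fieldType) (n : nat).
Local Notation L := (ratfun K n).
Local Notation lp := (@to_ratfun K K n id).
Local Notation expon := (expo n).

(** A substitution which sends distinct monomials to nonzero multiples of
    distinct Laurent monomials is injective, hence extends to the field. The rescalings
    and the elements of BC_n are both of this kind. *)
Lemma mono_subst_inj (phi : {rmorphism {mpoly K[n.+1]} -> L})
  (kap : expo n -> K) (A : expo n -> expo n) :
  (forall m, kap m != 0) -> injective A ->
  (forall c, phi c%:MP = rC n c) ->
  (forall k, phi 'X_[k] = rC n (kap (expo_mnm k)) * mon K (A (expo_mnm k))) ->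
  injective phi.
Proof.
move=> kap0 Ainj phiC phiX; apply: raddf_inj => p p0; apply/mpolyP => k0.
rewrite mcoeff0; have [k0p|] := boolP (k0 \in msupp p); last exact: memN_msupp_eq0.
pose g : laurent K n := \sum_(k <- msupp p)
   lmon (A (expo_mnm k)) (p@_k * kap (expo_mnm k)).
have : lp g = 0.
  have <- : phi p = 0 by [].
  rewrite /g raddf_sum /= [in RHS](mpolyE p) rmorph_sum /=.
  apply: eq_bigr => k _.
  by rewrite lpU rCM -mulrA -phiX -phiC -mul_mpolyC rmorphM.
rewrite -(raddf0 lp) => /lp_inj /(congr1 (monalg.mcoeff (A (expo_mnm k0)))).
rewrite monalg.mcoeff0 /g raddf_sum /= (big_rem k0) //= big_seq big1 ?addr0.
  by rewrite monalg.mcoeffUU => /eqP; rewrite mulf_eq0 (negPf (kap0 _)) orbF => /eqP.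
move=> k; rewrite mem_rem_uniq ?msupp_uniq // inE => /andP[k0k kp].
rewrite monalg.mcoeffU; case: eqP => // /Ainj/expo_mnm_inj e.
by rewrite e eqxx in k0k.
Qed.

Definition scale_fac (a : K) (c : 'I_n -> K) (m : expo n) : K :=
  a ^ m.1 * \prod_i c i ^ m.2 i.

Lemma rescale_rmorphism a c : a != 0 -> (forall i, c i != 0) ->
  exists psi : {rmorphism L -> L}, psi =1 rescale a c /\
   forall m x, psi (rC n x * mon K m) = rC n (x * scale_fac a c m) * mon K m.
Proof.
move=> a0 c0; pose y := [tuple (if unlift ord0 j is Some i then c i else a) *: 'X_j
             | j < n.+1] : n.+1.-tuple {mpoly K[n.+1]}.
have y0 : tnth y ord0 = a *: 'X_ord0 by rewrite tnth_mktuple unlift_none.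
have yS i : tnth y (lift ord0 i) = c i *: 'X_(lift ord0 i).
  by rewrite tnth_mktuple liftK.
pose phi : {rmorphism {mpoly K[n.+1]} -> L} := @FracField.tofrac _ \o comp_mpoly y.
have phiC x : phi x%:MP = rC n x by rewrite /phi /= comp_mpolyC.
have phi0 : phi 'X_ord0 = rC n a * rS K n.
  by rewrite /phi /= comp_mpolyXU -tnth_nth y0 -mul_mpolyC tofracM.
have phiS i : phi 'X_(lift ord0 i) = rC n (c i) * rX K i.
  by rewrite /phi /= comp_mpolyXU -tnth_nth yS -mul_mpolyC tofracM.
have phiE : frac_lift phi =1 rescale a c by [].
clearbody phi.
have phiX k : phi 'X_[k] = rC n (scale_fac a c (expo_mnm k)) * mon K (expo_mnm k).
  rewrite mpolyXE_id rmorph_prod big_ord_recl rmorphXn /= phi0.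
  rewrite rCM mulrACA /= fmorphXz -exprMn; congr (_ * _).
  rewrite [X in _ = X * _](rmorph_prod (@rC K n)) -big_split; apply: eq_bigr => i _.
  by rewrite rmorphXn ffunE /= phiS exprMn fmorphXz.
have kap0 m : scale_fac a c m != 0.
  rewrite mulf_neq0 ?expfz_neq0 //; apply/prodf_neq0 => i _.
  by rewrite expfz_neq0.
have phi_inj := mono_subst_inj kap0 (@inj_id _) phiC phiX.
have [psi psiE] := frac_lift_rmorphism phi_inj.
have psiT p : psi p%:F = phi p by rewrite psiE frac_lift_tofrac.
exists psi; split; first by move=> z; rewrite psiE phiE.
have psiS : psi (rS K n) = rC n a * rS K n by rewrite psiT.
have psiX i : psi (rX K i) = rC n (c i) * rX K i by rewrite psiT.
move=> m x; rewrite rmorphM; rewrite psiT phiC rCM -!mulrA; congr (_ * _).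
rewrite rCM mulrACA rmorphM rmorph_prod fmorphXz psiS fmorphXz -expfzMl; congr (_ * _).
rewrite [X in _ = X * _](rmorph_prod (@rC K n)) -big_split; apply: eq_bigr => i _.
by rewrite !fmorphXz psiX /= expfzMl.
Qed.

(** The convention is that of [bc_orbit]. *)
Definition wexp (g : {ffun 'I_n -> bool} * 'S_n) (e : {ffun 'I_n -> int}) :
  {ffun 'I_n -> int} := [ffun i => sgb (g.1 i) * e (g.2 i)].
Definition wact g (m : expo n) : expo n := (m.1, wexp g m.2).

Lemma sgbK b (x : int) : sgb b * (sgb b * x) = x.
Proof. by rewrite mulrA -expr2 sqrr_sign mul1r. Qed.

Lemma wexp_inj g : injective (wexp g).
Proof.
move=> e e' /ffunP h; apply/ffunP => i; have := h (g.2^-1 i)%g.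
by rewrite !ffunE permKV => /(congr1 (fun x => sgb (g.1 (g.2^-1 i)%g) * x)); rewrite !sgbK.
Qed.

Lemma wact_inj g : injective (wact g).
Proof. by move=> [l e] [l' e'] [-> /wexp_inj ->]. Qed.

Definition winv (g : {ffun 'I_n -> bool} * 'S_n) (i : 'I_n) : 'I_n := (g.2^-1)%g i.

Lemma winvK (g : {ffun 'I_n -> bool} * 'S_n) : cancel g.2 (winv g).
Proof. exact: permK. Qed.

Lemma winvVK (g : {ffun 'I_n -> bool} * 'S_n) : cancel (winv g) g.2.
Proof. exact: permKV. Qed.

(** An inversion of variables is not an endomorphism of the polynomial ring: g acts
    through the field of fractions. *)
Lemma wsubst_ex g : exists psi : {rmorphism L -> L},
  [/\ forall c, psi (rC n c) = rC n c, psi (rS K n) = rS K n,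
   forall i, psi (rX K i) = rX K (winv g i) ^ sgb (g.1 (winv g i)) &
   forall m, psi (mon K m) = mon K (wact g m)].
Proof.
pose y (j : 'I_n.+1) : L := if unlift ord0 j is Some i then
   rX K (winv g i) ^ sgb (g.1 (winv g i)) else rS K n.
pose phi : {rmorphism {mpoly K[n.+1]} -> L} := mmap (@rC K n) y.
have phiC x : phi x%:MP = rC n x by rewrite /phi /= mmapC.
have phi0 : phi 'X_ord0 = rS K n by rewrite /phi /= mmapX mmap1U /y unlift_none.
have phiS i : phi 'X_(lift ord0 i) = rX K (winv g i) ^ sgb (g.1 (winv g i)).
  by rewrite /phi /= mmapX mmap1U /y liftK.
clearbody phi.
have key (m : expo n) : \prod_i (rX K (winv g i) ^ sgb (g.1 (winv g i))) ^ m.2 i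
   = \prod_i rX K i ^ (wexp g m.2) i.
  rewrite (reindex_inj (@perm_inj _ g.2)) /=; apply: eq_bigr => i _.
  by rewrite winvK ffunE exprz_exp.
have phiX k : phi 'X_[k] = rC n 1 * mon K (wact g (expo_mnm k)).
  rewrite mpolyXE_id rmorph_prod big_ord_recl rmorphXn /= phi0 rC1 mul1r.
  congr (_ * _); rewrite -key; apply: eq_bigr => i _.
  by rewrite rmorphXn ffunE /= phiS.
have phi_inj := @mono_subst_inj phi (fun=> 1) _ (fun=> oner_neq0 K) (@wact_inj g) phiC phiX.
have [psi psiE] := frac_lift_rmorphism phi_inj.
have psiT p : psi p%:F = phi p by rewrite psiE frac_lift_tofrac.
exists psi; split; try by move=> *; rewrite psiT.
move=> m; rewrite rmorphM rmorph_prod fmorphXz psiT phi0; congr (_ * _).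
by rewrite -key; apply: eq_bigr => i _; rewrite fmorphXz psiT phiS.
Qed.

End Subst.

(** * Partitions, orbits and dominance *)

Section Partitions.
Variable n : nat.
Implicit Types (lam mu : part n) (e : {ffun 'I_n -> int}) (a b : int * part n).

Lemma part_nth_le lam (i j : 'I_n) : (i <= j)%N -> (part_nth lam j <= part_nth lam i)%N.
Proof.
move=> ij; rewrite /part_nth !(tnth_nth 0%N).
have geq_tr : transitive geq by move=> x y z h h'; apply: leq_trans h' h.
have := sorted_leq_nth geq_tr leqnn 0%N (valP lam) => /(_ i j).
by rewrite !inE size_tuple !ltn_ord => /(_ isT isT ij).
Qed.

Definition pexpo lam : {ffun 'I_n -> int} := [ffun i => (part_nth lam i)%:Z].

Lemma pexpo_inj : injective pexpo.
Proof.
move=> lam mu /ffunP h; apply/val_inj/eq_from_tnth => i.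
by have := h i; rewrite !ffunE => -[].
Qed.

Definition prefix e (k : nat) : int := \sum_(i < n | (i < k)%N) e i.

Lemma sum_nth_take (s : seq nat) k :
  (\sum_(i < size s | (i < k)%N) nth 0%N s i = sumn (take k s))%N.
Proof.
elim: s k => [|x s IH] [|k]; rewrite ?big_ord0 //=; first exact: big_pred0.
by rewrite big_mkcond big_ord_recl /= -big_mkcond -IH.
Qed.

Lemma prefix_pexpo lam k : prefix (pexpo lam) k = (sumn (take k (val lam)))%:Z.
Proof.
rewrite -sum_nth_take -(big_mkord (fun i => (i < k)%N) (fun i => nth 0%N (val lam) i)).
rewrite size_tuple big_mkord -[RHS]natz natr_sum /prefix.
by apply: eq_bigr => i _; rewrite ffunE /part_nth natz (tnth_nth 0%N).
Qed.

Lemma dominatedP mu lam :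
  dominated mu lam <-> forall k, prefix (pexpo mu) k <= prefix (pexpo lam) k.
Proof. by split=> h k; have := h k; rewrite !prefix_pexpo lez_nat. Qed.

Lemma part_sizeE lam : (part_size lam)%:Z = prefix (pexpo lam) n.
Proof. by rewrite prefix_pexpo take_oversize // size_tuple. Qed.

Lemma prefix_all e k : (n <= k)%N -> prefix e k = \sum_i e i.
Proof. by move=> nk; apply: eq_bigl => i; rewrite (leq_trans (ltn_ord i)). Qed.

Lemma part_sizeE_sum lam : (part_size lam)%:Z = \sum_i (part_nth lam i)%:Z.
Proof. by rewrite part_sizeE prefix_all //; apply: eq_bigr => i _; rewrite ffunE. Qed.

Lemma prefixS e (i : 'I_n) : prefix e i.+1 = prefix e i + e i.
Proof.
rewrite /prefix (bigD1 i) //= addrC; congr (_ + _); apply: eq_bigl => j.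
by rewrite ltnS -(inj_eq val_inj) /=; lia.
Qed.

Lemma prefix_inj e e' : (forall k, prefix e k = prefix e' k) -> e = e'.
Proof.
move=> h; apply/ffunP => i; have := h i.+1; rewrite !prefixS h.
exact: addrI.
Qed.

Lemma card_ltn (k : nat) : (k <= n)%N -> #|[set i : 'I_n | (i < k)%N]| = k.
Proof.
move=> kn; rewrite -sum1_card (eq_bigl (fun i : 'I_n => (i < k)%N)) => [|i]; last by rewrite inE.
by rewrite -(big_ord_widen n (fun=> 1%N)) // sum1_card card_ord.
Qed.

(** Compare with a threshold c lying between the #|I| largest parts and the
    others: passing from I to the first #|I| indices can only increase the sum of the
    (lam_i - c). *)
Lemma sum_ind_le lam (I : {set 'I_n}) :
  \sum_(i in I) (part_nth lam i)%:Z <= prefix (pexpo lam) #|I|.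
Proof.
pose c : int := if insub #|I| : option 'I_n is Some j then part_nth lam j else 0.
have kn : (#|I| <= n)%N by rewrite -[n in (_ <= n)%N]card_ord max_card.
have hlt (i : 'I_n) : (i < #|I|)%N -> c <= part_nth lam i.
  rewrite /c; case: insubP => [j _ <- ij|//].
  by rewrite lez_nat part_nth_le // ltnW.
have hge (i : 'I_n) : ~~ (i < #|I|)%N -> (part_nth lam i)%:Z <= c.
  rewrite -leqNgt /c; case: insubP => [j _ <- ij|].
    by rewrite lez_nat part_nth_le.
  by have := ltn_ord i; lia.
have e1 : \sum_(i in I) c = \sum_(i < n | (i < #|I|)%N) c.
  by rewrite sumr_const -(big_ord_widen n (fun=> c)) // sumr_const card_ord.
suff : \sum_(i in I) ((part_nth lam i)%:Z - c) <=
       \sum_(i < n | (i < #|I|)%N) (pexpo lam i - c).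
  by rewrite !sumrB e1 lerD2r.
rewrite [leLHS]big_mkcond [leRHS]big_mkcond; apply: ler_sum => i _.
rewrite ffunE; case: (boolP (i < #|I|)%N) => [/hlt|/hge] h; case: (i \in I); lia.
Qed.

(** The functional e |-> sum of (n - i) e_i (i counted from 0). It is regular dominant, so
    that it attains its maximum on a BC_n-orbit only at the dominant element. *)
Definition wrho : expo n := (0, [ffun i : 'I_n => (n - i)%:Z]).

(** Abel summation; this makes the functional strictly increasing for dominance. *)
Lemma dot_wrho l e : dot wrho (l, e) = \sum_(k < n) prefix e k.+1.
Proof.
rewrite /dot mul0r add0r /=; under [RHS]eq_bigr do rewrite /prefix big_mkcond.
rewrite exchange_big; apply: eq_bigr => i _ /=.
rewrite -big_mkcond (eq_bigl (mem (~: [set k : 'I_n | (k < i)%N]))); last first.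
  by move=> k; rewrite !inE -leqNgt.
rewrite sumr_const ffunE -mulr_natl natz; congr (Posz _ * _).
by rewrite cardsCs setCK card_ord card_ltn // ltnW.
Qed.

Lemma dot_wrho_le l l' e e' : (forall k, prefix e k <= prefix e' k) ->
  e != e' -> dot wrho (l, e) < dot wrho (l', e').
Proof.
move=> h ee'; rewrite !dot_wrho lt_neqAle; apply/andP; split; last by apply: ler_sum => i _; apply: h.
 apply: contra ee' => /eqP ee; apply/eqP/prefix_inj => k.
have le : forall i : 'I_n, prefix e i.+1 = prefix e' i.+1.
  move=> i; apply/eqP.
  have : \sum_(k < n) (prefix e' k.+1 - prefix e k.+1) == 0 by rewrite sumrB ee subrr.
  rewrite psumr_eq0 => [/allP/(_ i)|j _]; last by rewrite subr_ge0.
  by move=> /(_ (mem_index_enum _)); rewrite /= subr_eq0 eq_sym.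
case: k => [|k]; first by rewrite /prefix !big_pred0.
case: (ltnP k n) => kn; first exact: (le (Ordinal kn)).
have [n0|n0] := posnP n.
  by rewrite /prefix !big1 // => i; have := ltn_ord i; rewrite [X in (_ < X)%N]n0.
have lastP : (n.-1 < n)%N by rewrite ltn_predL.
have := le (Ordinal lastP); rewrite /= prednK //.
by rewrite !(@prefix_all _ k.+1) ?(leqW kn) // !(@prefix_all _ n).
Qed.

Implicit Types (g : {ffun 'I_n -> bool} * 'S_n).

Lemma bc_orbitP lam e :
  reflect (exists g, e = wexp g (pexpo lam)) (e \in bc_orbit lam).
Proof.
have E g : wexp g (pexpo lam) = [ffun i => sgb (g.1 i) * (part_nth lam (g.2 i))%:Z].
  by apply/ffunP => i; rewrite !ffunE.
rewrite mem_undup; apply: (iffP codomP) => -[g ->]; exists g; first by rewrite E.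
by rewrite E.
Qed.

Lemma sgb_abs (c : bool) : `|sgb c| = 1.
Proof. by case: c. Qed.

(** A functional with slopes in {-1,0,1} is at most the sum of the largest parts,
    as many as there are nonzero slopes. *)
Lemma wdot_bound (w : {ffun 'I_n -> int}) g lam : (forall i, `|w i| <= 1) ->
  \sum_i w i * wexp g (pexpo lam) i <= prefix (pexpo lam) #|[set i | w i != 0]|.
Proof.
move=> w1; pose I := [set i | w i != 0].
rewrite -(card_imset (mem I) (@perm_inj _ g.2)).
apply: le_trans (sum_ind_le lam _).
rewrite big_imset /=; last by move=> i j _ _; apply: perm_inj.
rewrite [leRHS]big_mkcond; apply: ler_sum => i _; rewrite inE !ffunE.
case: eqP => [->|_]; first by rewrite mul0r.
apply: le_trans (ler_norm _) _; rewrite !normrM sgb_abs mul1r [X in _ * X]ger0_norm //.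
by rewrite -[leRHS]mul1r ler_wpM2r.
Qed.

Lemma prefix_wexp g lam k : prefix (wexp g (pexpo lam)) k <= prefix (pexpo lam) k.
Proof.
have := @wdot_bound [ffun i : 'I_n => (i < minn k n)%N%:Z] g lam.
have -> : #|[set i : 'I_n | [ffun i : 'I_n => (i < minn k n)%N%:Z] i != 0]| = minn k n.
  rewrite -[RHS](@card_ltn (minn k n)) ?geq_minr //; apply: eq_card => i.
  by rewrite !inE ffunE; case: (_ < _)%N.
have -> : prefix (pexpo lam) (minn k n) = prefix (pexpo lam) k.
  by apply: eq_bigl => i; have := ltn_ord i; lia.
move=> h; apply: le_trans (h _); last by move=> i; rewrite ffunE; case: (_ < _)%N.
rewrite /prefix big_mkcond; apply: ler_sum => i _; rewrite [X in _ <= X * _]ffunE.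
have -> : (i < minn k n)%N = (i < k)%N by have := ltn_ord i; lia.
by case: (i < k)%N; rewrite ?mul1r ?mul0r.
Qed.

Lemma dot_wrho_orbit l l' lam e : e \in bc_orbit lam -> e != pexpo lam ->
  dot wrho (l, e) < dot wrho (l', pexpo lam).
Proof. by case/bc_orbitP => g ->; apply: dot_wrho_le => k; apply: prefix_wexp. Qed.

Lemma pexpo_orbit lam : pexpo lam \in bc_orbit lam.
Proof.
apply/bc_orbitP; exists ([ffun=> false], 1%g); apply/ffunP => i.
by rewrite !ffunE perm1 mul1r.
Qed.

Lemma smon_le_refl a : smon_le a a.
Proof. by split; [move=> k | rewrite !subrr normr0]. Qed.

Lemma smon_le_trans a b c : smon_le a b -> smon_le b c -> smon_le a c.
Proof.
move=> [h1 h2] [h3 h4]; split; first by move=> k; apply: leq_trans (h1 k) (h3 k).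
by lia.
Qed.

Lemma smon_le_size b a : smon_le b a -> (part_size b.2 <= part_size a.2)%N.
Proof. by move=> [_]; lia. Qed.

Lemma smon_lt_neq b a : smon_lt b a -> b.2 <> a.2.
Proof.
move=> [[_ h] ne] e; apply: ne; case: b a h e => [l mu] [k lam] /= h e.
by rewrite e in h *; congr pair; lia.
Qed.

(** Strict dominance is thus well founded, through an integer. *)
Lemma smon_lt_wrho b a : smon_lt b a -> dot wrho (b.1, pexpo b.2) < dot wrho (a.1, pexpo a.2).
Proof.
move=> ba; apply: dot_wrho_le; first by apply/dominatedP; case: ba => -[].
by apply/eqP => /pexpo_inj; apply: smon_lt_neq ba.
Qed.

Lemma smon_lt_le_trans a b c : smon_lt a b -> smon_le b c -> smon_lt a c.
Proof.
move=> ab bc; split; first by apply: smon_le_trans bc; case: ab.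
move=> e; have := smon_lt_wrho ab; rewrite e => h.
have [e'|/eqP ne] := eqVneq b c; first by rewrite e' ltxx in h.
by have := smon_lt_wrho (conj bc ne); rewrite ltNge (ltW h).
Qed.

(** The functionals of the exponent of s and of those of the x_i whose maxima
    on the monomials of s^k m_lam, given by [hull_bound], characterise [smon_le]: the partial
    sums of the parts for slope 0 in s, and the bound on |l - k| for slopes 1 and -1 in s and
    full support in x. *)
Definition hull_weight (w : expo n) : Prop :=
  (w.1 = 0 /\ forall i, `|w.2 i| <= 1) \/ (`|w.1| = 1 /\ forall i, `|w.2 i| = 1).
Definition wsupp (w : expo n) := #|[set i | w.2 i != 0]|.
Definition hull_bound a (w : expo n) : int := w.1 * a.1 + prefix (pexpo a.2) (wsupp w).

Lemma hull_weight_full (w : expo n) : `|w.1| = 1 -> (forall i, `|w.2 i| = 1) -> wsupp w = n.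
Proof.
move=> _ h; rewrite /wsupp -[RHS]card_ord -cardsT; apply: eq_card => i; rewrite !inE.
by have := h i; case: eqP => // ->.
Qed.

Lemma orbit_hull_bound w a e : hull_weight w -> e \in bc_orbit a.2 ->
  dot w (a.1, e) <= hull_bound a w.
Proof.
move=> ok /bc_orbitP [g ->]; rewrite lerD2l; apply: wdot_bound => i.
by case: ok => -[_ ->].
Qed.

Lemma hull_bound_mono w a b : hull_weight w -> smon_le b a -> hull_bound b w <= hull_bound a w.
Proof.
move=> ok [/dominatedP h h']; rewrite /hull_bound.
case: ok => [[-> _]|[w1 w2]]; first by rewrite !mul0r lerD2l.
rewrite hull_weight_full // -!part_sizeE.
have [e|e] : w.1 = 1 \/ w.1 = -1 by lia.
  rewrite e. lia.
rewrite e; lia.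
Qed.

End Partitions.

(** * Orbit sums and the Weyl denominator *)

Section Span.
Variables (R : nzRingType) (n : nat).
Implicit Types (A B : int * part n -> Prop) (f g : laurent R n).

Lemma cf_smon (a : int * part n) (m : expo n) : cf m (smon R a) = ((m.1 == a.1) && (m.2 \in bc_orbit a.2))%:R.
Proof.
case: m => l e0; rewrite /smon raddf_sum /=; under eq_bigr do rewrite monalg.mcoeffU.
have [mo|/negP mo] := boolP (e0 \in bc_orbit a.2); last first.
  rewrite andbF big_seq big1 // => e eo; case: eqP => // -[_ E].
  by case: mo; rewrite -E.
rewrite (big_rem _ mo) /= big_seq big1 ?addr0.
  by rewrite xpair_eqE eqxx !andbT eq_sym.
move=> e; rewrite mem_rem_uniq ?undup_uniq // inE xpair_eqE => /andP[/negPf -> _].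
by rewrite andbF.
Qed.

Lemma span_smon A a : A a -> smon_span A (smon R a).
Proof.
move=> Aa; exists [:: a], (fun=> 1); rewrite big_seq1 scale1r; split=> // b.
by rewrite inE => /eqP ->.
Qed.

Lemma span0 A : smon_span A (0 : laurent R n).
Proof. by exists [::], (fun=> 0); rewrite big_nil. Qed.

Lemma spanZ A c f : smon_span A f -> smon_span A (c *: f).
Proof.
move=> [S [x [h ->]]]; exists S, (fun b => c * x b); split=> //.
by rewrite scaler_sumr; apply: eq_bigr => b _; rewrite scalerA.
Qed.

(** The two families of coefficients are merged along the common list of indices. *)
Lemma spanD A f g : smon_span A f -> smon_span A g -> smon_span A (f + g).
Proof.
move=> [S [c [h ->]]] [T [d [k ->]]].
exists (undup (S ++ T)), (fun b => \sum_(x <- S | x == b) c x + \sum_(x <- T | x == b) d x).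
split=> [b|]; first by rewrite mem_undup mem_cat => /orP[/h|/k].
have E U (x : int * part n -> R) : {subset U <= undup (S ++ T)} ->
  \sum_(b <- U) x b *: smon R b =
  \sum_(b <- undup (S ++ T)) (\sum_(y <- U | y == b) x y) *: smon R b.
  move=> sub; under [RHS]eq_bigr do rewrite scaler_suml.
  rewrite (exchange_big_dep xpredT) //= big_seq [RHS]big_seq; apply: eq_bigr => b bU.
  rewrite (big_rem b) ?sub //= eqxx big_seq_cond big1 ?addr0 //.
  move=> y; rewrite mem_rem_uniq ?undup_uniq // inE => /andP[/andP[yb _]].
  by rewrite eq_sym (negPf yb).
rewrite (E S) ?(E T) -?big_split /=.
- by apply: eq_bigr => b _; rewrite scalerDl.
- by move=> b bT; rewrite mem_undup mem_cat bT orbT.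
- by move=> b bS; rewrite mem_undup mem_cat bS.
Qed.

Lemma spanB A f g : smon_span A f -> smon_span A g -> smon_span A (f - g).
Proof. by move=> hf hg; rewrite -scaleN1r; apply: spanD => //; apply: spanZ. Qed.

Lemma span_sum A I (s : seq I) (P : pred I) (F : I -> laurent R n) :
  (forall i, P i -> smon_span A (F i)) -> smon_span A (\sum_(i <- s | P i) F i).
Proof. by move=> h; apply: big_ind h; [exact: span0 | exact: spanD]. Qed.

Lemma span_sum_seq A (I : eqType) (s : seq I) (F : I -> laurent R n) :
  (forall i, i \in s -> smon_span A (F i)) -> smon_span A (\sum_(i <- s) F i).
Proof. by move=> h; rewrite big_seq; apply: span_sum. Qed.

Lemma span_sub A B f : (forall b, A b -> B b) -> smon_span A f -> smon_span B f.
Proof. by move=> AB [S [c [h ->]]]; exists S, c; split=> // b /h/AB. Qed.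

Lemma span_ind A (P : laurent R n -> Prop) :
  P 0 -> (forall f g, P f -> P g -> P (f + g)) -> (forall c f, P f -> P (c *: f)) ->
  (forall b, A b -> P (smon R b)) -> forall f, smon_span A f -> P f.
Proof.
move=> P0 PD PZ Ps f [S [c [h ->]]]; rewrite big_seq.
by apply: big_ind => // b /h Ab; apply/PZ/Ps.
Qed.

End Span.

Section Delta.
Variables (K : fieldType) (n : nat).
Local Notation L := (ratfun K n).
Local Notation lp := (@to_ratfun K K n id).
Implicit Types (g : {ffun 'I_n -> bool} * 'S_n) (a b : int * part n).

Lemma sgb_addb (c d : bool) : sgb (c (+) d) = sgb c * sgb d.
Proof. exact: signr_addb. Qed.

Lemma wexp_comp g h e : exists k, wexp g (wexp h e) = wexp k e.
Proof.
exists ([ffun i => g.1 i (+) h.1 (g.2 i)], (g.2 * h.2)%g).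
by apply/ffunP => i; rewrite !ffunE permM sgb_addb mulrA.
Qed.

Lemma wexp_orbit g lam e : e \in bc_orbit lam -> wexp g e \in bc_orbit lam.
Proof.
case/bc_orbitP => h ->; have [k ->] := wexp_comp g h (pexpo lam).
by apply/bc_orbitP; exists k.
Qed.

Lemma wexp_inv g : exists h, cancel (wexp g) (wexp h) /\ cancel (wexp h) (wexp g).
Proof.
exists ([ffun i => g.1 (winv g i)], g.2^-1%g); split=> e; apply/ffunP => i.
  by rewrite !ffunE /= -/(winv g i) winvVK sgbK.
by rewrite !ffunE /= -/(winv g _) winvK sgbK.
Qed.

Lemma wact_smon g m a : cf (wact g m) (smon K a) = cf m (smon K a).
Proof.
rewrite !cf_smon /=; congr ((_ && _)%:R); apply/idP/idP; last exact: wexp_orbit.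
by have [h [hK _]] := wexp_inv g => /(wexp_orbit h); rewrite hK.
Qed.

(** A is an eigenvector of every g in BC_n, with eigenvalue chi g. *)
Definition wchar (chi : {ffun 'I_n -> bool} * 'S_n -> K) (A : laurent K n) :=
  forall g m, cf (wact g m) A = chi g * cf m A.

Definition push g (A : laurent K n) : laurent K n :=
  \sum_(m <- lsupp A) lmon (wact g m) (cf m A).

Lemma cf_push g A m : cf (wact g m) (push g A) = cf m A.
Proof.
apply: (@cf_sum_lmon _ _ _ (wact g)); [exact: finmap.fset_uniq|exact: wact_inj|].
exact: monalg.mcoeff_outdom.
Qed.

(** psi is the field automorphism through which g acts. *)
Definition wmorph g (psi : {rmorphism L -> L}) :=
  [/\ forall c, psi (rC n c) = rC n c, psi (rS K n) = rS K n,
   forall i, psi (rX K i) = rX K (winv g i) ^ sgb (g.1 (winv g i)) &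
   forall m, psi (mon K m) = mon K (wact g m)].

Lemma lp_push g psi A : wmorph g psi -> psi (lp A) = lp (push g A).
Proof.
move=> [pC _ _ pM]; rewrite lpE rmorph_sum /push raddf_sum /=.
by apply: eq_bigr => k _; rewrite lpU rmorphM pC pM.
Qed.

Lemma wcharP chi A : (forall g, chi g ^+ 2 = 1) ->
  wchar chi A <-> forall g psi, wmorph g psi -> psi (lp A) = rC n (chi g) * lp A.
Proof.
move=> c2; split=> [hA g psi hpsi|h g m].
  rewrite (lp_push _ hpsi) -lpZ; congr (lp _); apply/monalg.malgP => -[l e].
  have [h [_ hK]] := wexp_inv g; have -> : (l, e) = wact g (l, wexp h e).
    by rewrite /wact /= hK.
  by rewrite cf_push monalg.mcoeffZ hA mulrA -expr2 c2 mul1r.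
have [psi hpsi] := wsubst_ex K g; have := h g psi hpsi.
rewrite (lp_push _ hpsi) -lpZ => /lp_inj /(congr1 (monalg.mcoeff (wact g m))).
by rewrite cf_push monalg.mcoeffZ => ->; rewrite mulrA -expr2 c2 mul1r.
Qed.

Definition wsgn g : K := (\prod_i sgb (g.1 i))%:~R * (-1) ^+ g.2.

Lemma wsgn2 g : wsgn g ^+ 2 = 1.
Proof.
rewrite /wsgn exprMn sqrr_sign mulr1 -rmorphXn -prodrXl big1 ?rmorph1 // => i _.
by rewrite sqrr_sign.
Qed.

Definition xsym (i : 'I_n) : L := rX K i + (rX K i)^-1.

(** The Weyl denominator of type C_n in product form, which is suited to cancelling the
    denominators of the difference operator. *)
Definition Delta : L :=
  (\prod_i (rX K i - (rX K i)^-1)) * \prod_(i < n) \prod_(j < n | (i < j)%N) (xsym i - xsym j).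

(** Both sides are Vandermonde determinants, up to a permutation of columns. *)
Lemma vander_perm (R : comPzRingType) (z : 'I_n -> R) (s : 'S_n) :
  \prod_(i < n) \prod_(j < n | (i < j)%N) (z (s i) - z (s j)) =
  (-1) ^+ s * \prod_(i < n) \prod_(j < n | (i < j)%N) (z i - z j).
Proof.
have E (y : 'I_n -> R) : \prod_(i < n) \prod_(j < n | (i < j)%N) (y i - y j) =
    \det (Vandermonde n (\row_i - y i)).
  rewrite det_Vandermonde; apply: eq_bigr => i _; apply: eq_bigr => j _.
  by rewrite !mxE opprK addrC.
have := E (fun i => z (s i)); rewrite /= => ->; rewrite (E z).
have -> : Vandermonde n (\row_i - z (s i)) = col_perm s (Vandermonde n (\row_i - z i)).
  by apply/matrixP => i j; rewrite !mxE.
rewrite -det_tr tr_col_perm row_permE det_mulmx det_perm det_tr.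
by [].
Qed.

Lemma wmorph_xsym g psi i : wmorph g psi -> psi (xsym i) = xsym (winv g i).
Proof.
move=> [_ _ pX _]; rewrite rmorphD fmorphV pX /xsym.
by case: (g.1 _) => /=; rewrite ?expr1z // /sgb expr1 exprN1 invrK addrC.
Qed.

Lemma wmorph_Delta g psi : wmorph g psi -> psi Delta = rC n (wsgn g) * Delta.
Proof.
move=> hpsi; have [pC _ pX _] := hpsi.
rewrite /Delta rmorphM rCM mulrACA; congr (_ * _).
  rewrite rmorph_prod.
  have -> : rC n (\prod_(i < n) sgb (g.1 i))%:~R = \prod_(i < n) (sgb (g.1 i))%:~R :> L.
    by rewrite (rmorph_int (@rC K n)) rmorph_prod.
  rewrite (reindex_inj (@perm_inj _ g.2)) /= -big_split; apply: eq_bigr => i _.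
  rewrite rmorphB fmorphV pX winvK.
  by case: (g.1 i); rewrite /= /sgb ?expr0 ?expr1 ?expr1z ?mul1r // exprN1 invrK mulN1r opprB.
have -> : @rC K n ((-1) ^+ g.2) = (-1) ^+ (g.2^-1)%g.
  by rewrite odd_permV; exact: rmorph_sign.
rewrite -vander_perm rmorph_prod; apply: eq_bigr => i _.
rewrite rmorph_prod; apply: eq_bigr => j _.
by rewrite rmorphB !(wmorph_xsym _ hpsi).
Qed.

End Delta.

(** * Dividing antisymmetric Laurent polynomials by the Weyl denominator *)

Section Pairs.
Variable n : nat.

Definition rho : {ffun 'I_n -> int} := [ffun i : 'I_n => (n - i)%:Z].

Lemma sum_pairs (s : 'I_n -> 'I_n -> int) : (forall i j, s i j = s j i) ->
  2 * \sum_(i < n) \sum_(j < n | (i < j)%N) s i j =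
  \sum_i \sum_j s i j - \sum_i s i i.
Proof.
move=> sC; have -> : \sum_i \sum_j s i j = \sum_(i < n) \sum_(j < n | (i < j)%N) s i j +
   \sum_i s i i + \sum_(i < n) \sum_(j < n | (j < i)%N) s i j.
  rewrite -!big_split; apply: eq_bigr => i _ /=.
  rewrite (bigID (fun j : 'I_n => (i < j)%N)) /= -addrA; congr (_ + _).
  rewrite (bigD1 i) ?ltnn //=; congr (_ + _); apply: eq_bigl => j.
  by rewrite -(inj_eq val_inj) /=; lia.
have -> : \sum_(i < n) \sum_(j < n | (j < i)%N) s i j =
  \sum_(i < n) \sum_(j < n | (i < j)%N) s i j.
  rewrite [LHS](exchange_big_dep xpredT) //=.
  by apply: eq_bigr => i _; apply: eq_bigr => j _; apply: sC.
ring.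
Qed.

Lemma prefix_rho k : (k <= n)%N -> 2 * prefix rho k = k%:Z * (2 * n%:Z - k%:Z + 1).
Proof.
elim: k => [|k IH] kn; first by rewrite /prefix big_pred0 // mul0r mulr0.
rewrite (prefixS rho (Ordinal kn)) mulrDr /= IH; last exact: ltnW.
rewrite ffunE /= -subzn; last exact: ltnW.
by rewrite intS; ring.
Qed.

(** Counts the indices and pairs of indices that meet I. The answer depends on
    #|I| only, hence equals the count for the first #|I| indices, a partial sum of rho. *)
Lemma rho_pairs (I : {set 'I_n}) (a := fun i => (i \in I)%:Z) :
  \sum_i a i + \sum_(i < n) \sum_(j < n | (i < j)%N) (a i + a j - a i * a j) =
  prefix rho #|I|.
Proof.
have sa : \sum_i a i = #|I|%:Z.
  rewrite -sum1_card -[RHS]natz natr_sum [RHS]big_mkcond.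
  by apply: eq_bigr => i _; rewrite /a; case: (i \in I).
(* Twice the sum over i < j is the sum over all i, j minus the diagonal. *)
apply: (@mulfI _ (2 : int)) => //; rewrite mulrDr sum_pairs; last by move=> i j; ring.
rewrite prefix_rho; last by rewrite -[n in (_ <= n)%N]card_ord max_card.
have -> : \sum_i (a i + a i - a i * a i) = \sum_i a i.
  by apply: eq_bigr => i _; rewrite /a; case: (i \in I).
have -> : \sum_i \sum_j (a i + a j - a i * a j) =
   n%:Z * #|I|%:Z + n%:Z * #|I|%:Z - #|I|%:Z * #|I|%:Z.
  under eq_bigr => i _.
    rewrite sumrB big_split /= -mulr_sumr sa sumr_const card_ord -mulr_natl natz.
    over.
  rewrite sumrB big_split /= -mulr_sumr -mulr_suml sa sumr_const card_ord.
  by rewrite -mulr_natl natz.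
rewrite sa; ring.
Qed.

Lemma rho_pairs_wgt (w : expo n) : hull_weight w ->
  \sum_i `|w.2 i| + \sum_(i < n) \sum_(j < n | (i < j)%N) Num.max `|w.2 i| `|w.2 j|
   = prefix rho (wsupp w).
Proof.
move=> ok; rewrite -rho_pairs.
have E i : `|w.2 i| = (i \in [set i | w.2 i != 0])%:Z.
  have : `|w.2 i| <= 1 by case: ok => -[_ ->].
  by rewrite inE; lia.
congr (_ + _); first by apply: eq_bigr => i _; rewrite E.
apply: eq_bigr => i _; apply: eq_bigr => j _; rewrite !E.
by case: (i \in _); case: (j \in _).
Qed.

End Pairs.

Lemma seq_max (T : eqType) (F : T -> int) (s : seq T) x0 : x0 \in s ->
  exists2 x, x \in s & forall y, y \in s -> F y <= F x.
Proof.
elim: s x0 => // y s IH x0 _; case: s IH => [_|z s IH].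
  by exists y => [|y']; rewrite inE // => /eqP ->.
have [x xs hx] := IH z (mem_head _ _).
have [yx|/ltW xy] := leP (F y) (F x).
  by exists x => [|y']; rewrite inE ?xs ?orbT // => /orP[/eqP -> //|/hx].
exists y => [|y']; first exact: mem_head.
by rewrite inE => /orP[/eqP -> //|/hx h]; apply: le_trans h xy.
Qed.

Section Division.
Variables (K : fieldType) (n : nat).
Local Notation L := (ratfun K n).
Local Notation lp := (@to_ratfun K K n id).
Implicit Types (g : {ffun 'I_n -> bool} * 'S_n) (a b : int * part n) (w m : expo n).

Definition unit_expo (i : 'I_n) (c : int) : expo n := (0, [ffun j => if j == i then c else 0]).

Lemma dot_unit_expo w i c : dot w (unit_expo i c) = w.2 i * c.
Proof.
rewrite /dot mulr0 add0r (bigD1 i) //= ffunE eqxx big1 ?addr0 // => j /negPf ji.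
by rewrite ffunE ji mulr0.
Qed.

Lemma mon_unit_expo i c : mon K (unit_expo i c) = rX K i ^ c.
Proof.
rewrite /mon expr0z mul1r (bigD1 i) //= ffunE eqxx big1 ?mulr1 // => j /negPf ji.
by rewrite ffunE ji expr0z.
Qed.

Lemma supported_rX (S : expo n -> Prop) i c : S (unit_expo i c) -> supported S (rX K i ^ c).
Proof.
move=> h; rewrite -mon_unit_expo -[mon _ _]mul1r -rC1; exact: supported_mon.
Qed.

Lemma expo_sum1 I (s : seq I) (P : pred I) (F : I -> expo n) :
  (\sum_(i <- s | P i) F i).1 = \sum_(i <- s | P i) (F i).1.
Proof. exact: (big_morph fst). Qed.

Lemma expo_sum2 I (s : seq I) (P : pred I) (F : I -> expo n) j :
  (\sum_(i <- s | P i) F i).2 j = \sum_(i <- s | P i) (F i).2 j.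
Proof. by apply: (big_morph (fun m : expo n => m.2 j)) => [x y|]; rewrite ffunE. Qed.

Lemma sum_unit_expo (e : {ffun 'I_n -> int}) : \sum_i unit_expo i (e i) = (0, e).
Proof.
rewrite [LHS]surjective_pairing expo_sum1 big1 //; congr pair; apply/ffunP => j.
rewrite expo_sum2 (bigD1 j) //= ffunE eqxx big1 ?addr0 // => i ij.
by rewrite ffunE eq_sym (negPf ij).
Qed.

(** Both [Delta] and its products with the coefficients of the difference operator
    have this shape; [lead_pairs] computes their leading terms. *)
Lemma degle_pairs w (F : 'I_n -> L) (G : 'I_n -> 'I_n -> L) : hull_weight w ->
  (forall i, degle w `|w.2 i| (F i)) ->
  (forall i j : 'I_n, (i < j)%N -> degle w (Num.max `|w.2 i| `|w.2 j|) (G i j)) ->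
  degle w (prefix (rho n) (wsupp w))
   (\prod_i F i * \prod_(i < n) \prod_(j < n | (i < j)%N) G i j).
Proof.
move=> ok hF hG; rewrite -rho_pairs_wgt //; apply: degle_mul.
  exact: degle_prod.
by apply: degle_prod => i _; apply: degle_prod => j; apply: hG.
Qed.

Lemma lead_pairs (F : 'I_n -> L) (G : 'I_n -> 'I_n -> L) (c d : 'I_n -> K) :
  (forall i, lead (wrho n) (unit_expo i 1) (c i) (F i)) ->
  (forall i j : 'I_n, (i < j)%N -> lead (wrho n) (unit_expo i 1) (d i) (G i j)) ->
  lead (wrho n) (0, rho n) (\prod_i c i * \prod_i d i ^+ (n - i.+1))
   (\prod_i F i * \prod_(i < n) \prod_(j < n | (i < j)%N) G i j).
Proof.
move=> hF hG.
have h1 : lead (wrho n) (\sum_i unit_expo i 1) (\prod_i c i) (\prod_i F i) by apply: lead_prod.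
have h2 : lead (wrho n) (\sum_(i < n) \sum_(j < n | (i < j)%N) unit_expo i 1)
   (\prod_(i < n) \prod_(j < n | (i < j)%N) d i)
   (\prod_(i < n) \prod_(j < n | (i < j)%N) G i j).
  by apply: lead_prod => i _; apply: lead_prod => j; apply: hG.
have cnt (i : 'I_n) : #|[set j : 'I_n | (i < j)%N]| = (n - i.+1)%N.
  have -> : [set j : 'I_n | (i < j)%N] = ~: [set j : 'I_n | (j < i.+1)%N].
    by apply/setP => j; rewrite !inE -leqNgt.
  by rewrite cardsCs setCK card_ord card_ltn.
have unit_expo_nat i k : unit_expo i 1 *+ k = unit_expo i k%:Z.
  elim: k => [|k IH]; [rewrite mulr0n|rewrite mulrS IH]; congr pair.
    by apply/ffunP => j; rewrite !ffunE; case: eqP.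
  by apply/ffunP => j; rewrite !ffunE; case: eqP => // _; lia.
have const_pair (T : zmodType) (x : 'I_n -> T) (i : 'I_n) :
    \sum_(j < n | (i < j)%N) x i = x i *+ (n - i.+1).
  by rewrite -cnt -sumr_const; apply: eq_bigl => j; rewrite inE.
have -> : (0, rho n) = \sum_i unit_expo i 1 + \sum_(i < n) \sum_(j < n | (i < j)%N) unit_expo i 1.
  rewrite -big_split /= -[LHS]sum_unit_expo; apply: eq_bigr => i _.
  rewrite (const_pair _ (fun i => unit_expo i 1)) unit_expo_nat; congr pair; apply/ffunP => j; rewrite !ffunE.
  by case: eqP => // _; have := ltn_ord i; lia.
have -> : \prod_i d i ^+ (n - i.+1) = \prod_(i < n) \prod_(j < n | (i < j)%N) d i.
  apply: eq_bigr => i _; rewrite -cnt -prodr_const; apply: eq_bigl => j.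
  by rewrite inE.
exact: lead_mul h1 h2.
Qed.

Lemma degle_xsym w i : degle w `|w.2 i| (xsym K i).
Proof.
apply: supportedD; [rewrite -[rX K i]expr1z|rewrite -exprN1]; apply: supported_rX.
  by rewrite dot_unit_expo mulr1 ler_norm.
by rewrite dot_unit_expo mulrN1 -normrN ler_norm.
Qed.

Lemma degle_mono w d d' (z : L) : d <= d' -> degle w d z -> degle w d' z.
Proof. by move=> dd; apply: supported_sub => m h; apply: le_trans h dd. Qed.

Lemma degle_Delta w : hull_weight w -> degle w (prefix (rho n) (wsupp w)) (Delta K n).
Proof.
move=> ok; apply: degle_pairs => // [i|i j ij].
  apply: supportedB; [rewrite -[rX K i]expr1z|rewrite -exprN1]; apply: supported_rX.
    by rewrite dot_unit_expo mulr1 ler_norm.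
  by rewrite dot_unit_expo mulrN1 -normrN ler_norm.
apply: supportedB; [apply: degle_mono (degle_xsym w i)|apply: degle_mono (degle_xsym w j)].
  by rewrite le_max lexx.
by rewrite le_max lexx orbT.
Qed.

Lemma lead_rX (i : 'I_n) (z : L) c : deglt (wrho n) (n - i)%:Z z ->
  lead (wrho n) (unit_expo i 1) c (rC n c * rX K i + z).
Proof.
move=> h; apply: lead_add; first by rewrite -[rX K i]expr1z -mon_unit_expo; apply: lead_mon.
by rewrite dot_unit_expo mulr1 ffunE.
Qed.

Lemma deglt_rX (d : int) (i : 'I_n) c : (n - i)%:Z * c < d -> deglt (wrho n) d (rX K i ^ c).
Proof. by move=> h; apply: supported_rX; rewrite dot_unit_expo ffunE. Qed.

Lemma deglt_rXV d (i : 'I_n) : 0 <= d -> deglt (wrho n) d (rX K i)^-1.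
Proof.
move=> d0; rewrite -exprN1; apply: deglt_rX; have := ltn_ord i; lia.
Qed.

Lemma deglt_rX1 (d : int) (i : 'I_n) : (n - i)%:Z < d -> deglt (wrho n) d (rX K i).
Proof. by move=> h; rewrite -[rX K i]expr1z; apply: deglt_rX; rewrite mulr1. Qed.

Lemma lead_Delta : lead (wrho n) (0, rho n) 1 (Delta K n).
Proof.
have -> : 1 = \prod_(i < n) 1 * \prod_(i < n) 1 ^+ (n - i.+1) :> K.
  rewrite big1 // mul1r big1 // => i _; exact: expr1n.
apply: lead_pairs => [i|i j ij].
  rewrite -[rX K i]mul1r -rC1; apply: lead_rX; rewrite rC1 mul1r.
  by apply: supportedN; apply: deglt_rXV.
rewrite /xsym -addrA -[rX K i]mul1r -rC1; apply: lead_rX; rewrite rC1 mul1r.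
have := ltn_ord j => jn; apply: supportedB; first by apply: deglt_rXV.
apply: supportedD; last by apply: deglt_rXV.
by apply: deglt_rX1; lia.
Qed.

Definition antisym := wchar (wsgn K (n := n)).

(** The exponents allowed in Delta times a combination of monomials below a. *)
Definition in_hull_rho a m := forall w, hull_weight w ->
  dot w m <= hull_bound a w + prefix (rho n) (wsupp w).

Definition flip_elt (i : 'I_n) : {ffun 'I_n -> bool} * 'S_n := ([ffun j => j == i], 1%g).
Definition swap_elt (i j : 'I_n) : {ffun 'I_n -> bool} * 'S_n := ([ffun=> false], tperm i j).

Lemma wsgn_flip i : wsgn K (flip_elt i) = -1.
Proof.
rewrite /wsgn (bigD1 i) //= big1 => [|j /negPf ji]; last by rewrite ffunE ji.
by rewrite ffunE eqxx odd_perm1 /= /sgb expr1 !mulr1.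
Qed.

Lemma wsgn_swap i j : i != j -> wsgn K (swap_elt i j) = -1.
Proof.
move=> ij; rewrite /wsgn big1 => [|k _]; last by rewrite ffunE.
by rewrite odd_tperm ij expr1 mul1r.
Qed.

Lemma dot_wrho_flip l e i :
  dot (wrho n) (wact (flip_elt i) (l, e)) = dot (wrho n) (l, e) - 2 * (n - i)%:Z * e i.
Proof.
rewrite /dot !mul0r !add0r /= (bigD1 i) //= [in RHS](bigD1 i) //= !ffunE eqxx perm1 /sgb expr1.
rewrite (eq_bigr (fun j => (wrho n).2 j * e j)); last first.
  by move=> j /negPf ji; rewrite !ffunE ji perm1 mul1r.
by ring.
Qed.

Lemma dot_wrho_swap l e (i j : 'I_n) : (i < j)%N ->
  dot (wrho n) (wact (swap_elt i j) (l, e)) =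
  dot (wrho n) (l, e) + (j%:Z - i%:Z) * (e j - e i).
Proof.
move=> ij; have ji : j != i by rewrite -(inj_eq val_inj) /=; lia.
rewrite /dot !mul0r !add0r /= (bigD1 i) //= [in RHS](bigD1 i) //=.
rewrite (bigD1 j) //= [in RHS](bigD1 j) //= !ffunE tpermL tpermR !mul1r.
rewrite (eq_bigr (fun k => (wrho n).2 k * e k)); last first.
  move=> k /andP[ki kj]; rewrite !ffunE tpermD 1?eq_sym // mul1r //.
rewrite -!subzn; try exact/ltnW/ltn_ord.
by ring.
Qed.

(** The partition mu such that m.2 = mu + rho when there is one; the argument d is a
    default value. *)
Definition sub_rho (d : part n) (m : expo n) : int * part n :=
  (m.1, insubd d [tuple absz (m.2 i - (n - i)%:Z)%R | i < n]).

Definition add_rho (a : int * part n) : expo n := (a.1, pexpo a.2 + rho n).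

Hypothesis two_neq0 : (2 : K) != 0.

Lemma opp_eq0 (x : K) : x = - x -> x = 0.
Proof.
move=> /eqP; rewrite -addr_eq0 -mulr2n -mulr_natl mulf_eq0 (negPf two_neq0) /=.
by move/eqP.
Qed.

(** The exponents of maximal weight in an antisymmetric function are strictly
    dominant: a reflection would otherwise raise them, or fix them and so force the coefficient
    to be its own opposite. *)
Lemma sub_rho_max (d : part n) (A : laurent K n) m : antisym A -> cf m A != 0 ->
  (forall m', cf m' A != 0 -> dot (wrho n) m' <= dot (wrho n) m) ->
  add_rho (sub_rho d m) = m.
Proof.
case: m => l e hA em hmax.
(* Transpositions show that e is strictly decreasing, inversions that it is positive. *)
have dec (i j : 'I_n) : (i < j)%N -> e j < e i.
  move=> ij; have nij : i != j by rewrite -(inj_eq val_inj) /=; lia.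
  have hs := hA (swap_elt i j) (l, e); rewrite wsgn_swap // mulN1r in hs.
  rewrite ltNge; apply/negP; rewrite le_eqVlt => /orP[/eqP eij|lt].
    suff E : wact (swap_elt i j) (l, e) = (l, e).
      by move: hs; rewrite E => /opp_eq0/eqP; rewrite (negPf em).
    congr pair; apply/ffunP => k; rewrite !ffunE mul1r.
    by case: tpermP => // ->.
  have : cf (wact (swap_elt i j) (l, e)) A != 0 by rewrite hs oppr_eq0.
  move=> /hmax; rewrite dot_wrho_swap // gerDl leNgt mulr_gt0 // subr_gt0 //.
have pos (i : 'I_n) : 0 < e i.
  have hs := hA (flip_elt i) (l, e); rewrite wsgn_flip // mulN1r in hs.
  rewrite ltNge; apply/negP; rewrite le_eqVlt => /orP[/eqP eij|lt].
    suff E : wact (flip_elt i) (l, e) = (l, e).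
      by move: hs; rewrite E => /opp_eq0/eqP; rewrite (negPf em).
    congr pair; apply/ffunP => k; rewrite !ffunE perm1.
    by case: eqP => [->|_]; rewrite ?eij ?mulr0 ?mul1r.
  have : cf (wact (flip_elt i) (l, e)) A != 0 by rewrite hs oppr_eq0.
  have ni : (0 < n - i)%N by rewrite subn_gt0.
  move=> /hmax; rewrite dot_wrho_flip // gerDl oppr_le0 leNgt.
  by rewrite nmulr_llt0 ?ltr_wpM2r // ?mulr_gt0.
have gap k (i j : 'I_n) : j = (i + k)%N :> nat -> e j + k%:Z <= e i.
  elim: k j => [|k IH] j E; first by rewrite addr0 (_ : j = i) //; apply/val_inj; rewrite /= E addn0.
  have ikn : (i + k < n)%N by have := ltn_ord j; lia.
  have := IH (Ordinal ikn) erefl; have := dec (Ordinal ikn) j.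
  by rewrite /= E => /(_ ltac:(lia)); lia.
have low (i : 'I_n) : (n - i)%:Z <= e i.
  have n0 : (n.-1 < n)%N by have := ltn_ord i; lia.
  have := gap (n.-1 - i)%N i (Ordinal n0); have := pos (Ordinal n0).
  by have := ltn_ord i => ? ? /(_ ltac:(rewrite /=; lia)); lia.
rewrite /add_rho /sub_rho; congr pair; rewrite /=.
have srt : sorted geq [tuple absz (e i - (n - i)%:Z)%R | i < n].
  apply/(sortedP 0%N) => i; rewrite size_tuple => iN.
  have i'N : (i < n)%N by apply: ltnW.
  rewrite -[i]/(val (Ordinal i'N)) -[_.+1]/(val (Ordinal iN)) -!tnth_nth !tnth_mktuple /=.
  have := dec (Ordinal i'N) (Ordinal iN) (ltnSn i).
  have := low (Ordinal iN); have := low (Ordinal i'N) => /=.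
  lia.
apply/ffunP => i; rewrite !ffunE /part_nth insubdK // tnth_mktuple.
by rewrite gez0_abs ?subr_ge0 ?low // subrK.
Qed.

Lemma in_hull_rho_add a b : in_hull_rho a (add_rho b) -> smon_le b a.
Proof.
case: b => l mu hm; split.
  apply/dominatedP => k; wlog kn : k / (k <= n)%N => [h|].
    case: (leqP k n) => [/h //|kn]; have := h n (leqnn n).
    by rewrite !(@prefix_all _ _ k) ?(ltnW kn) // !prefix_all.
  pose w : expo n := (0, [ffun i : 'I_n => (i < k)%N%:Z]).
  have ok : hull_weight w by left; split=> // i; rewrite ffunE; case: (_ < _)%N.
  have ws : wsupp w = k.
    rewrite -[RHS](@card_ltn n k) //; apply: eq_card => i.
    by rewrite !inE ffunE; case: (_ < _)%N.
  have := hm w ok; rewrite /hull_bound ws mul0r add0r /dot mul0r add0r /=.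
  have -> : \sum_(i < n) w.2 i * (pexpo mu + rho n) i = prefix (pexpo mu + rho n) k.
    rewrite /prefix [RHS]big_mkcond; apply: eq_bigr => i _; rewrite [w.2 i]ffunE.
    by case: (_ < _)%N; rewrite ?mul1r ?mul0r.
  rewrite [X in X <= _](_ : _ = prefix (pexpo mu) k + prefix (rho n) k) ?lerD2r //.
  by rewrite /prefix -big_split; apply: eq_bigr => i _; rewrite ffunE.
have key (s : int) : `|s| = 1 -> s * (l - a.1) <= (part_size a.2)%:Z - (part_size mu)%:Z.
  move=> s1; pose w : expo n := (s, [ffun=> 1]).
  have ok : hull_weight w by right; split=> // i; rewrite ffunE.
  have := hm w ok; rewrite /hull_bound (@hull_weight_full n w) // => [|i]; last by rewrite ffunE.
  rewrite -part_sizeE /dot /=.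
  have -> : \sum_(i < n) [ffun=> 1] i * (pexpo mu + rho n) i =
     (part_size mu)%:Z + prefix (rho n) n.
    rewrite part_sizeE /prefix -big_split /=; apply: eq_big => i; first by rewrite ltn_ord.
    by move=> _; rewrite !ffunE mul1r.
  by rewrite mulrBr; lia.
by have := key 1 erefl; have := key (-1) erefl; rewrite /=; lia.
Qed.

Lemma degle_smon_Delta w b : hull_weight w ->
  degle w (hull_bound b w + prefix (rho n) (wsupp w)) (Delta K n * lp (smon K b)).
Proof.
move=> ok; rewrite addrC; apply: degle_mul; first exact: degle_Delta.
apply/supported_lp => -[l e]; rewrite cf_smon /=.
case: andP => [[/eqP -> eo] _|_]; last by rewrite eqxx.
exact: orbit_hull_bound.
Qed.

Lemma lead_smon b : lead (wrho n) (b.1, pexpo b.2) 1 (lp (smon K b)).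
Proof.
have := @lead_lp K n (wrho n) (b.1, pexpo b.2) (smon K b).
rewrite cf_smon eqxx pexpo_orbit; apply=> -[l e]; rewrite cf_smon /=.
case: andP => [[/eqP -> eo] _ ne|_]; last by rewrite eqxx.
by apply: dot_wrho_orbit => //; apply/eqP => E; rewrite E in ne.
Qed.

Lemma lead_smon_Delta b : lead (wrho n) (add_rho b) 1 (Delta K n * lp (smon K b)).
Proof.
have := lead_mul lead_Delta (lead_smon b); rewrite mulr1; congr lead.
by congr pair; [exact: add0r | exact: addrC].
Qed.

Lemma wmorph_span A f g psi : smon_span A f -> wmorph g psi -> psi (lp f) = lp f.
Proof.
move=> hf hpsi; have inv : wchar (fun=> 1) f.
  move=> h m; rewrite mul1r; move: f hf; apply: span_ind.
  - by rewrite !monalg.mcoeff0.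
  - by move=> f1 f2; rewrite !monalg.mcoeffD => -> ->.
  - by move=> c f1; rewrite !monalg.mcoeffZ => ->.
  - by move=> b _; apply: wact_smon.
have [] := @wcharP K n (fun=> 1) f => [h|/(_ inv _ _ hpsi) -> _]; first by rewrite expr1n.
by rewrite rC1 mul1r.
Qed.

(** Induction on the degree d in the weight rho. The terms of top degree have exponents
    mu + rho, and Delta * m_mu has the leading term x^(mu + rho), so subtracting multiples of
    these lowers the degree, while the bounds of [in_hull_rho] are kept. *)
Lemma antisym_div a (d : nat) (A : laurent K n) : antisym A ->
  (forall m, cf m A != 0 -> dot (wrho n) m < d%:Z) ->
  (forall m, cf m A != 0 -> in_hull_rho a m) ->
  exists2 f, smon_span (fun b => smon_le b a) f & lp A = Delta K n * lp f.
Proof.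
elim: d A => [|d IH] A hA hN hH.
  exists 0; first exact: span0.
  rewrite raddf0 mulr0; apply/eqP; rewrite lp_eq0; apply/eqP.
  apply/monalg.malgP => m0; rewrite monalg.mcoeff0.
  apply/eqP/negPn/negP => m0A.
  have : exists2 m, cf m A != 0 & forall m', cf m' A != 0 -> dot (wrho n) m' <= dot (wrho n) m.
    have m0S : m0 \in (lsupp A : seq (expo n)) by rewrite -monalg.mcoeff_neq0.
    have [m mS hm] := seq_max (dot (wrho n)) m0S.
    exists m; first by rewrite monalg.mcoeff_neq0.
    by move=> m'; rewrite monalg.mcoeff_neq0; apply: hm.
  move=> [m mA hmax]; have := hN m mA; rewrite -(sub_rho_max a.2 hA mA hmax).
  rewrite ltNge; apply/negP/negPn; rewrite /dot mul0r add0r.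
  by apply: sumr_ge0 => i _; rewrite !ffunE.
pose T := [seq m <- lsupp A | dot (wrho n) m == d%:Z].
have Tmax m : m \in T -> cf m A != 0 /\ dot (wrho n) m = d.
  by rewrite mem_filter -monalg.mcoeff_neq0 => /andP[/eqP -> ->].
have TS m : m \in T -> add_rho (sub_rho a.2 m) = m.
  move=> /Tmax [mA mN]; apply: (sub_rho_max _ hA mA) => m' /hN; rewrite mN.
  by rewrite -addn1 PoszD ltzD1.
pose f0 : laurent K n := \sum_(m <- T) cf m A *: smon K (sub_rho a.2 m).
have f0S : smon_span (fun b => smon_le b a) f0.
  apply: span_sum_seq => m mT; apply/spanZ/span_smon/in_hull_rho_add; rewrite TS //.
  by apply: hH; case: (Tmax m mT).
have Df0 : supported (fun=> True) (Delta K n * lp f0).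
  apply: (@supported_mul _ _ (fun=> True) (fun=> True)) => //; last by apply/supported_lp.
  by apply: supported_sub (lead_degle lead_Delta).
have [B hB _] := Df0.
have [f1 f1S hf1] : exists2 f, smon_span (fun b => smon_le b a) f &
    lp (A - B) = Delta K n * lp f.
  apply: IH.
  - apply/wcharP => [g|g psi hpsi]; first exact: wsgn2.
    rewrite !raddfB mulrBr /= -hB rmorphM (wmorph_Delta hpsi) (wmorph_span f0S hpsi).
    have /(wcharP A (@wsgn2 K n)) hA' := hA; by rewrite (hA' g) // [in RHS]mulrA.
  - move=> m; move: m; apply/supported_lp; rewrite raddfB /= -hB /f0 raddf_sum mulr_sumr /=.
    rewrite lpE (bigID (fun m => dot (wrho n) m == d%:Z)) /= -big_filter -/T addrAC.
    apply: supportedD; last first.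
      rewrite big_seq_cond; apply: supported_sum => m /andP[mA mN]; apply: supported_mon.
      have := hN m; rewrite monalg.mcoeff_neq0 => /(_ mA); lia.
    rewrite -sumrB big_seq; apply: supported_sum => m mT.
    have [mA mN] := Tmax m mT; rewrite lpZ (mulrCA (Delta K n)) -mulrBr; apply: supportedZ.
    rewrite -opprB; apply: supportedN; have := lead_smon_Delta (sub_rho a.2 m).
    by rewrite TS // /lead rC1 mul1r mN.
  - move=> m hm w ok; move: m hm; apply/supported_lp; rewrite raddfB /= -hB.
    apply: supportedB; first by apply/supported_lp => m /hH; apply.
    rewrite /f0 raddf_sum mulr_sumr /= big_seq; apply: supported_sum => m mT.
    rewrite lpZ (mulrCA (Delta K n)); apply: supportedZ; apply: degle_mono (degle_smon_Delta _ ok).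
    rewrite lerD2r; apply: hull_bound_mono => //; apply: in_hull_rho_add; rewrite TS //.
    by apply: hH; case: (Tmax m mT).
exists (f0 + f1); first exact: spanD.
by rewrite raddfD mulrDr -hf1 raddfB /= hB addrC subrK.
Qed.

End Division.

(** * The difference operator *)

(** The permutation s acts on the pairs i < j once the images are sorted again. *)
Lemma prod_pairs_sym (R : comPzRingType) n (h : 'I_n -> 'I_n -> R) (s : 'S_n) :
  (forall i j, h i j = h j i) ->
  \prod_(i < n) \prod_(j < n | (i < j)%N) h (s i) (s j) =
  \prod_(i < n) \prod_(j < n | (i < j)%N) h i j.
Proof.
move=> hC; rewrite !pair_big_dep /=.
pose F (s : 'S_n) (p : 'I_n * 'I_n) : 'I_n * 'I_n :=
  if (s p.1 < s p.2)%N then (s p.1, s p.2) else (s p.2, s p.1).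
have FK (q : 'S_n) (p : 'I_n * 'I_n) : (p.1 < p.2)%N -> F q^-1%g (F q p) = p.
  case: p => i j /= ij; rewrite /F /=; case: (q i < q j)%N => /=; rewrite !permK ?ij //.
  by rewrite ltnNge (ltnW ij).
have FV (q : 'S_n) (p : 'I_n * 'I_n) : (p.1 < p.2)%N -> F q (F q^-1%g p) = p.
  by move=> pl; rewrite -{1}[q]invgK FK.
have F_lt (q : 'S_n) (p : 'I_n * 'I_n) : ((F q p).1 < (F q p).2)%N = (p.1 != p.2).
  rewrite -(inj_eq (@perm_inj _ q)) -(inj_eq val_inj) /F.
  by case: ifP => //=; lia.
rewrite [RHS](reindex_onto (F s) (F s^-1%g)) /=; last by move=> p; apply: FV.
apply: eq_big => [p|p pl].
  rewrite F_lt; apply/idP/andP => [pl|[pl /eqP E]].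
    by rewrite FK // eqxx; split=> //; rewrite -(inj_eq val_inj) /= neq_ltn pl.
  by rewrite -E F_lt /F; case: ifP => _ /=; rewrite (inj_eq (@perm_inj _ s)) // eq_sym.
by rewrite /F; case: ifP => //= _.
Qed.

Lemma cancel_factor (F : fieldType) (y s u : F) : y != 0 -> s != 0 -> 1 - y ^+ 2 != 0 ->
  (y^-1 - y) * ((1 - s * y) * (1 - u / s * y) / (1 - y ^+ 2)) =
  y^-1 - (s + u / s) + u * y.
Proof. by move=> y0 s0 y1; field; rewrite y0 s0 y1. Qed.

Lemma cancel_pair (F : fieldType) (y y' t : F) : y != 0 -> y' != 0 -> 1 - y * y' != 0 ->
  (y + y^-1 - (y' + y'^-1)) * ((1 - t * y * y') / (1 - y * y')) =
  y^-1 - y'^-1 + t * y - t * y'.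
Proof. by move=> y0 y0' y1; field; rewrite y0 y0' y1. Qed.

Section Operator.
Variables (K : fieldType) (n : nat) (r t : K).
Local Notation L := (ratfun K n).
Local Notation lp := (@to_ratfun K K n id).
Implicit Types (g : {ffun 'I_n -> bool} * 'S_n) (a b : int * part n) (w m : expo n).
Implicit Types (sg : {ffun 'I_n -> bool}) (f : laurent K n).
Hypothesis r0 : r != 0.

Definition twist_factor sg m : K := r ^ m.1 * \prod_i (r ^ sgb (sg i)) ^ m.2 i.

(** The effect on Laurent polynomials of the substitutions x_i |-> x_i q^(+-1/2) and
    s |-> s q^(1/2) made by the summand of signs sg. *)
Definition twist sg f : laurent K n := \sum_(m <- lsupp f) lmon m (cf m f * twist_factor sg m).

Lemma cf_twist sg f m : cf m (twist sg f) = cf m f * twist_factor sg m.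
Proof.
apply: (@cf_sum_lmon _ _ _ id _ m); [exact: finmap.fset_uniq|by []|].
by move/monalg.mcoeff_outdom ->; rewrite mul0r.
Qed.

Lemma rescale_lp sg f :
  rescale 1 (fun i => r ^ sgb (sg i)) (rescale r (fun=> 1) (lp f)) = lp (twist sg f).
Proof.
have rs (i : 'I_n) : r ^ sgb (sg i) != 0 by rewrite expfz_neq0.
have [p1 [E1 M1]] := @rescale_rmorphism K n r (fun=> 1) r0 (fun=> oner_neq0 K).
have [p2 [E2 M2]] := @rescale_rmorphism K n 1 _ (oner_neq0 K) rs.
rewrite -E1 -E2 lpE /twist !rmorph_sum raddf_sum /=; apply: eq_bigr => m _.
rewrite M1 M2 lpU; congr (rC n _ * _); rewrite -mulrA; congr (_ * _).
rewrite /scale_fac exp1rz mul1r; congr (_ * _).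
by rewrite big1 ?mulr1 // => i _; rewrite exp1rz.
Qed.

Definition Y sg (i : 'I_n) : L := rX K i ^ sgb (sg i).

Definition Dcoef u sg : L :=
  (\prod_(i < n) ((1 - rS K n * Y sg i) * (1 - rC n u / rS K n * Y sg i) / (1 - Y sg i ^+ 2))) *
     (\prod_(i < n) \prod_(j < n | (i < j)%N)
        ((1 - rC n t * Y sg i * Y sg j) / (1 - Y sg i * Y sg j))).

Lemma DsopE u f : Dsop r t u (lp f) = \sum_sg Dcoef u sg * lp (twist sg f).
Proof. by apply: eq_bigr => sg _; rewrite rescale_lp. Qed.

Lemma DsopD u (z z' : L) : Dsop r t u (z + z') = Dsop r t u z + Dsop r t u z'.
Proof.
have [p1 [E1 _]] := @rescale_rmorphism K n r (fun=> 1) r0 (fun=> oner_neq0 K).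
rewrite /Dsop /Dop -big_split; apply: eq_bigr => sg _ /=; rewrite -mulrDr; congr (_ * _).
have rs (i : 'I_n) : r ^ sgb (sg i) != 0 by rewrite expfz_neq0.
have [p2 [E2 _]] := @rescale_rmorphism K n 1 _ (oner_neq0 K) rs.
by rewrite -!E1 -!E2 !rmorphD.
Qed.

Lemma DsopZ u c (z : L) : Dsop r t u (rC n c * z) = rC n c * Dsop r t u z.
Proof.
have [p1 [E1 M1]] := @rescale_rmorphism K n r (fun=> 1) r0 (fun=> oner_neq0 K).
rewrite /Dsop /Dop mulr_sumr; apply: eq_bigr => sg _ /=; rewrite [RHS]mulrCA; congr (_ * _).
have rs (i : 'I_n) : r ^ sgb (sg i) != 0 by rewrite expfz_neq0.
have [p2 [E2 M2]] := @rescale_rmorphism K n 1 _ (oner_neq0 K) rs.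
have s0 (x : K) (y : 'I_n -> K) : scale_fac x y 0 = 1.
  by rewrite /scale_fac expr0z mul1r big1 // => i _; rewrite ffunE expr0z.
have C1 : p1 (rC n c) = rC n c.
  by have := M1 0 c; rewrite mon0 s0 !mulr1.
have C2 : p2 (rC n c) = rC n c.
  by have := M2 0 c; rewrite mon0 s0 !mulr1.
by rewrite -!E1 -!E2 !rmorphM /= C1 C2.
Qed.

Lemma mon_eq1 m : (mon K m == 1) = (m == 0).
Proof.
apply/eqP/eqP => [|->]; last exact: mon0.
rewrite -(mon0 K n) -[mon K m]mul1r -[mon K 0]mul1r -rC1 -!lpU => /lp_inj.
move=> /(congr1 (monalg.mcoeff m)); rewrite monalg.mcoeffUU monalg.mcoeffU.
by case: eqP => // _ /eqP; rewrite oner_eq0.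
Qed.

Lemma YM sg i : Y sg i = mon K (unit_expo i (sgb (sg i))).
Proof. by rewrite mon_unit_expo. Qed.

Lemma Y_neq0 sg i : Y sg i != 0.
Proof. by rewrite YM mon_neq0. Qed.

Lemma Y2_neq1 sg i : 1 - Y sg i ^+ 2 != 0.
Proof.
rewrite subr_eq0 eq_sym YM expr2 -monD mon_eq1; apply/eqP => /(congr1 (dot (0, [ffun => sgb (sg i)]))).
rewrite dotD !dot_unit_expo dot0 ffunE; by case: (sg i).
Qed.

Lemma YY_neq1 sg (i j : 'I_n) : i != j -> 1 - Y sg i * Y sg j != 0.
Proof.
move=> ij; rewrite subr_eq0 eq_sym !YM -monD mon_eq1; apply/eqP.
move=> /(congr1 (fun m : expo n => m.2 i)); rewrite !ffunE eqxx (negPf ij) addr0.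
by case: (sg i).
Qed.

(** Coefficient of the operator in one variable, after multiplication by x_i - 1/x_i. *)
Definition unary_term u sg i : L := rC n (- (-1) ^+ sg i) *
  ((Y sg i)^-1 - (rS K n + rC n u / rS K n) + rC n u * Y sg i).
(** Coefficient of the operator in two variables, after multiplication by the factor
    x_i + 1/x_i - x_j - 1/x_j of [Delta]; this factor is symmetric under inversions. *)
Definition pair_term sg i j : L :=
  (Y sg i)^-1 - (Y sg j)^-1 + rC n t * Y sg i - rC n t * Y sg j.

(** The denominators 1 - y_i^2 and 1 - y_i y_j divide the factors of [Delta] whatever
    the signs. *)
Lemma Delta_Dcoef u sg : Delta K n * Dcoef u sg =
  (\prod_i unary_term u sg i) * \prod_(i < n) \prod_(j < n | (i < j)%N) pair_term sg i j.
Proof.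
rewrite /Delta /Dcoef mulrACA -[X in X * _]big_split -[X in _ * X]big_split.
congr (_ * _); apply: eq_bigr => i _.
  rewrite /= /unary_term -cancel_factor ?Y_neq0 ?rS_neq0 ?Y2_neq1 // [RHS]mulrA.
  congr (_ * _); rewrite (rmorphN (@rC K n)) (rmorph_sign (@rC K n)) /Y.
  case: (sg i); rewrite /sgb /= ?expr1 ?expr0 ?expr1z ?exprN1 ?invrK.
    by rewrite opprK mul1r.
  by rewrite mulN1r opprB.
rewrite -big_split; apply: eq_bigr => j ij /=.
have ij' : i != j by rewrite -(inj_eq val_inj) /=; lia.
rewrite /pair_term -cancel_pair ?Y_neq0 ?YY_neq1 //.
have zY k : xsym K k = Y sg k + (Y sg k)^-1.
  rewrite /xsym /Y; case: (sg k); rewrite /sgb /= ?expr1 ?expr0 ?expr1z ?exprN1 //.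
  by rewrite invrK addrC.
by rewrite !zY.
Qed.

End Operator.

(** * Triangularity of the operator *)

Lemma pair_factor_sym (F : fieldType) (t y y' : F) :
  (1 - t * y * y') / (1 - y * y') = (1 - t * y' * y) / (1 - y' * y).
Proof. by rewrite mulrAC (mulrC y). Qed.

Section Triangular.
Variables (K : fieldType) (n : nat) (r t : K).
Local Notation L := (ratfun K n).
Local Notation lp := (@to_ratfun K K n id).
Implicit Types (g : {ffun 'I_n -> bool} * 'S_n) (a b : int * part n) (w m : expo n).
Implicit Types (sg : {ffun 'I_n -> bool}) (f : laurent K n).
Hypothesis r0 : r != 0.

Local Notation D := (Dsop (n := n) r t).

Lemma lpD : {morph lp : f g / f + g}. Proof. exact: raddfD. Qed.
Lemma lpB : {morph lp : f g / f - g}. Proof. exact: raddfB. Qed.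
Lemma lp0 : lp 0 = 0. Proof. exact: raddf0. Qed.

Definition wtrans g sg : {ffun 'I_n -> bool} := [ffun i => g.1 i (+) sg (g.2 i)].

Lemma wtrans_inj g : injective (wtrans g).
Proof.
move=> s s' /ffunP h; apply/ffunP => i; have := h (winv g i).
by rewrite !ffunE winvVK; apply: addbI.
Qed.

Lemma wmorph_Y g psi sg i : wmorph g psi -> psi (Y K sg i) = Y K (wtrans g sg) (winv g i).
Proof.
move=> [_ _ pX _]; rewrite /Y fmorphXz pX exprz_exp ffunE winvVK sgb_addb.
by [].
Qed.

Lemma wmorph_Dcoef g psi u sg : wmorph g psi ->
  psi (Dcoef t u sg) = Dcoef t u (wtrans g sg).
Proof.
move=> hpsi; have [pC pS _ _] := hpsi.
rewrite /Dcoef rmorphM !rmorph_prod; congr (_ * _).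
  rewrite [RHS](reindex_inj (@perm_inj _ (g.2)^-1%g)) /=; apply: eq_bigr => i _.
  rewrite -/(winv g i) -(wmorph_Y _ _ hpsi).
  by rewrite !(rmorphM, rmorphB, fmorphV, rmorphXn, rmorph1) /= pC pS.
rewrite -[RHS](@prod_pairs_sym _ n (fun i j => (1 - rC n t * Y K (wtrans g sg) i *
   Y K (wtrans g sg) j) / (1 - Y K (wtrans g sg) i * Y K (wtrans g sg) j)) (g.2)^-1%g); last first.
  by move=> i j; apply: pair_factor_sym.
apply: eq_bigr => i _; rewrite rmorph_prod; apply: eq_bigr => j _.
rewrite -!/(winv g _) -!(wmorph_Y _ _ hpsi).
by rewrite !(rmorphM, rmorphB, fmorphV, rmorph1) /= pC.
Qed.

Lemma span_inv A f : smon_span A f -> forall g m, cf (wact g m) f = cf m f.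
Proof.
move=> hf h m; move: f hf; apply: span_ind.
- by rewrite !monalg.mcoeff0.
- by move=> f1 f2; rewrite !monalg.mcoeffD => -> ->.
- by move=> c f1; rewrite !monalg.mcoeffZ => ->.
- by move=> b _; apply: wact_smon.
Qed.

Lemma twist_factor_wact g sg m : twist_factor r (wtrans g sg) (wact g m) = twist_factor r sg m.
Proof.
rewrite /twist_factor /=; congr (_ * _).
rewrite [RHS](reindex_inj (@perm_inj _ g.2)) /=; apply: eq_bigr => i _.
rewrite !ffunE !exprz_exp; congr (_ ^ _); rewrite sgb_addb.
by rewrite mulrACA -expr2 sqrr_sign mul1r.
Qed.

Lemma push_twist A f g sg : smon_span A f ->
  push g (twist r sg f) = twist r (wtrans g sg) f.
Proof.
move=> hf; apply/monalg.malgP => -[l e].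
have [h [_ hK]] := wexp_inv g; have -> : (l, e) = wact g (l, wexp h e).
  by rewrite /wact /= hK.
by rewrite cf_push !cf_twist twist_factor_wact (span_inv hf).
Qed.

(** An element of BC_n permutes the summands of the operator. *)
Lemma wmorph_D A g psi u f : smon_span A f -> wmorph g psi ->
  psi (D u (lp f)) = D u (lp f).
Proof.
move=> hf hpsi; rewrite DsopE // rmorph_sum [RHS](reindex_inj (@wtrans_inj g)) /=.
apply: eq_bigr => sg _.
by rewrite rmorphM (wmorph_Dcoef _ _ hpsi) (lp_push _ hpsi) (push_twist _ _ hf).
Qed.

Lemma Delta_neq0 : Delta K n != 0.
Proof.
apply/eqP => D0; have := lead_Delta K n; rewrite D0 /lead sub0r => -[f E h].
have := h (0, rho n); rewrite ltxx.
have -> : f = - lmon (0, rho n) 1.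
  by apply: lp_inj; rewrite raddfN /= lpU E.
by rewrite monalg.mcoeffN monalg.mcoeffUU oppr_eq0 oner_neq0 => /(_ isT).
Qed.

Lemma Delta_D u f : Delta K n * D u (lp f) =
  \sum_sg ((\prod_i unary_term u sg i) * \prod_(i < n) \prod_(j < n | (i < j)%N) pair_term t sg i j)
     * lp (twist r sg f).
Proof.
rewrite DsopE // mulr_sumr; apply: eq_bigr => sg _.
by rewrite mulrA (Delta_Dcoef t r0).
Qed.

Lemma rS_mon c : rC n c * rS K n = rC n c * mon K (1, 0).
Proof. by rewrite /mon expr1z big1 ?mulr1 // => i _; rewrite ffunE expr0z. Qed.

Lemma rSV_mon c : rC n c / rS K n = rC n c * mon K (-1, 0).
Proof. by rewrite /mon exprN1 big1 ?mulr1 // => i _; rewrite ffunE expr0z. Qed.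

Lemma supported_YX (S : expo n -> Prop) sg i : S (unit_expo i (sgb (sg i))) -> supported S (Y K sg i).
Proof. exact: supported_rX. Qed.

Lemma supported_YV (S : expo n -> Prop) sg i : S (unit_expo i (- sgb (sg i))) -> supported S (Y K sg i)^-1.
Proof. by rewrite /Y invr_expz; apply: supported_rX. Qed.

Lemma degle_unary w u sg i : hull_weight w -> degle w `|w.2 i| (unary_term (u : K) sg i).
Proof.
move=> ok; have bnd (s : int) : `|s| = 1 -> w.2 i * s <= `|w.2 i|.
  by move=> s1; rewrite (le_trans (ler_norm _)) // normrM s1 mulr1.
have w1 (s : int) : `|s| = 1 -> dot w (s, 0) <= `|w.2 i|.
  move=> s1; rewrite /dot /= big1 ?addr0; last by move=> j _; rewrite ffunE mulr0.
  case: ok => -[h h']; first by rewrite h mul0r.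
  by rewrite (le_trans (ler_norm _)) // normrM s1 mulr1 h h'.
apply: supportedZ; apply: supportedD; first apply: supportedB.
- by apply: supported_YV; rewrite dot_unit_expo bnd // normrN sgb_abs.
- apply: supportedD; last by rewrite rSV_mon; apply: supported_mon; apply: w1.
  by rewrite -[rS K n]mul1r -rC1 rS_mon; apply: supported_mon; apply: w1.
- by apply: supportedZ; apply: supported_YX; rewrite dot_unit_expo bnd // sgb_abs.
Qed.

Lemma degle_pair w sg i j : degle w (Num.max `|w.2 i| `|w.2 j|) (pair_term t sg i j).
Proof.
have bnd (k : 'I_n) (s : int) : `|s| = 1 -> w.2 k * s <= `|w.2 k|.
  by move=> s1; rewrite (le_trans (ler_norm _)) // normrM s1 mulr1.
have hi := le_max _ `|w.2 i| `|w.2 j|.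
apply: supportedB; first apply: supportedD; first apply: supportedB.
- by apply: supported_YV; rewrite dot_unit_expo le_max bnd // normrN sgb_abs.
- by apply: supported_YV; rewrite dot_unit_expo le_max (bnd j) ?orbT // normrN sgb_abs.
- by apply: supportedZ; apply: supported_YX; rewrite dot_unit_expo le_max bnd // sgb_abs.
- by apply: supportedZ; apply: supported_YX; rewrite dot_unit_expo le_max (bnd j) ?orbT // sgb_abs.
Qed.

(** For sign + the term u y_i dominates, for sign - the term 1/y_i does. *)
Lemma lead_unary u sg i : lead (wrho n) (unit_expo i 1) (if sg i then 1 else - u) (unary_term (u : K) sg i).
Proof.
have ni := ltn_ord i; rewrite /unary_term /Y.
have sdeg (s : int) : dot (wrho n) (s, 0) < (n - i)%:Z.
  rewrite /dot mul0r add0r big1; first lia.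
  by move=> j _; rewrite [X in _ * X]ffunE mulr0.
have hS : deglt (wrho n) (n - i)%:Z (rS K n + rC n u / rS K n).
  apply: supportedD; last by rewrite rSV_mon; apply: supported_mon; apply: sdeg.
  by rewrite -[rS K n]mul1r -rC1 rS_mon; apply: supported_mon; apply: sdeg.
have hV : deglt (wrho n) (n - i)%:Z (rX K i)^-1 by apply: deglt_rXV.
case: (sg i); rewrite /sgb /= ?(expr1, expr0) ?(expr1, expr0) ?expr1z ?exprN1 ?invrK ?opprK.
  rewrite rC1 mul1r -addrA -[X in lead _ _ _ (X + _)]mul1r -rC1; apply: lead_rX.
  apply: supportedD; first by exact: supportedN.
  exact: supportedZ.
rewrite (rmorphN (@rC K n)) /= rC1 mulN1r opprD addrC -mulNr -(rmorphN (@rC K n)) /=.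
by apply: lead_rX; apply: supportedN; apply: supportedB.
Qed.

Lemma lead_pair sg (i j : 'I_n) : (i < j)%N ->
  lead (wrho n) (unit_expo i 1) (if sg i then 1 else t) (pair_term t sg i j).
Proof.
move=> ij; have jn := ltn_ord j.
have hj : deglt (wrho n) (n - i)%:Z (Y K sg j).
  rewrite /Y; apply: deglt_rX; case: (sg j); rewrite /sgb ?expr1 ?expr0; lia.
have hj' : deglt (wrho n) (n - i)%:Z (Y K sg j)^-1.
  rewrite /Y invr_expz; apply: deglt_rX; case: (sg j); rewrite /sgb ?expr1 ?expr0; lia.
have hV : deglt (wrho n) (n - i)%:Z (rX K i)^-1 by apply: deglt_rXV.
rewrite /pair_term; set y := Y K sg j in hj hj' *; rewrite /Y.
case: (sg i); rewrite /sgb /= ?expr1 ?expr0 ?expr1z ?exprN1 ?invrK.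
  rewrite -!addrA -[X in lead _ _ _ (X + _)]mul1r -rC1; apply: lead_rX.
  apply: supportedD; first exact: supportedN.
  by apply: supportedD; [apply: supportedZ|apply/supportedN/supportedZ].
rewrite [X in lead _ _ _ (X - _)]addrC -addrA; apply: lead_rX.
by apply: supportedB; [apply: supportedB|apply: supportedZ].
Qed.

(** The eigenvalue q^(k/2) q^(-|lam|/2) * product of (1 - q^(lam_i) t^(n-i) u), with the power
    of q distributed over the factors; see [eigval_factor]. *)
Definition eigval b u : K :=
  r ^ b.1 * \prod_(i < n) (r ^ (- (part_nth b.2 i)%:Z) - u * t ^+ (n - i.+1) * r ^ (part_nth b.2 i)%:Z).

Lemma degle_twist A w d sg f : smon_span A f -> degle w d (lp f) ->
  degle w d (lp (twist r sg f)).
Proof.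
move=> _ /supported_lp h; apply/supported_lp => m; rewrite cf_twist mulf_eq0 negb_or.
by case/andP => /h.
Qed.

Lemma lead_twist w m sg c f : lead w m c (lp f) ->
  lead w m (c * twist_factor r sg m) (lp (twist r sg f)).
Proof.
rewrite /lead -lpU -raddfB => /supported_lp h; rewrite -lpU -raddfB; apply/supported_lp => m'.
have h' := h m'; rewrite monalg.mcoeffB monalg.mcoeffU in h'.
rewrite monalg.mcoeffB monalg.mcoeffU cf_twist => nz; apply: h'; move: nz.
 case: (eqVneq m m') => [->|_].
  by rewrite !mulr1n -mulrBl; apply: contraNneq => ->; rewrite mul0r.
by rewrite !mulr0n !subr0; apply: contraNneq => ->; rewrite mul0r.
Qed.

Lemma twist_factor_pexpo sg b : twist_factor r sg (b.1, pexpo b.2) =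
  r ^ b.1 * \prod_i r ^ (sgb (sg i) * (part_nth b.2 i)%:Z).
Proof.
by rewrite /twist_factor /=; congr (_ * _); apply: eq_bigr => i _; rewrite ffunE exprz_exp.
Qed.

(** The leading coefficients of the 2^n summands add up to the expansion of the
    product of binomials [eigval]. *)
Lemma lead_Delta_D u b :
  lead (wrho n) (add_rho b) (eigval b u) (Delta K n * D u (lp (smon K b))).
Proof.
have -> : eigval b u = \sum_(sg : {ffun 'I_n -> bool}) ((\prod_i (if sg i then 1 else - u)) *
    (\prod_i (if sg i then 1 else t) ^+ (n - i.+1))) * (1 * twist_factor r sg (b.1, pexpo b.2)).
  rewrite /eigval; pose h (i : 'I_n) (c : bool) := (if c then 1 else - u) *
    ((if c then 1 else t) ^+ (n - i.+1) * r ^ (sgb c * (part_nth b.2 i)%:Z)).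
  rewrite (eq_bigr (fun i => \sum_(c : bool) h i c)); last first.
    move=> i _; rewrite big_bool /h /= expr1n /sgb ?expr1 ?expr0 mulN1r !mul1r.
    by rewrite mulNr mulrA.
  rewrite bigA_distr_bigA mulr_sumr; apply: eq_bigr => sg _ /=.
  by rewrite twist_factor_pexpo mul1r mulrCA /h !big_split /= mulrA.
rewrite Delta_D; apply: lead_sum => sg _.
have -> : add_rho b = (0, rho n) + (b.1, pexpo b.2).
  by congr pair; [rewrite add0r | exact: addrC].
apply: lead_mul; last exact/lead_twist/lead_smon.
by apply: lead_pairs => [i|i j ij]; [apply: lead_unary|apply: lead_pair].
Qed.

Lemma span_lt_deglt b f : smon_span (fun c => smon_lt c b) f ->
  deglt (wrho n) (dot (wrho n) (add_rho b)) (Delta K n * lp f).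
Proof.
move: f; apply: span_ind.
- by rewrite raddf0 mulr0; apply: supported0.
- by move=> f g hf hg; rewrite raddfD mulrDr; apply: supportedD.
- by move=> c f hf; rewrite lpZ (mulrCA (Delta K n)); apply: supportedZ.
move=> c lt_c; apply: supported_sub (lead_degle (lead_smon_Delta K c)) => m h.
apply: le_lt_trans h _; have := smon_lt_wrho lt_c.
have E x : add_rho x = (x.1, pexpo x.2) + (0, rho n) by congr pair; rewrite addr0.
by rewrite !E !dotD ltrD2r.
Qed.

Lemma span_le_split b f : smon_span (fun c => smon_le c b) f ->
  exists c, smon_span (fun c => smon_lt c b) (f - c *: smon K b).
Proof.
move: f; apply: span_ind.
- by exists 0; rewrite scale0r subrr; apply: span0.
- move=> f g [c hf] [d hg]; exists (c + d); rewrite scalerDl opprD addrACA.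
  exact: spanD hf hg.
- by move=> c f [d hf]; exists (c * d); rewrite -scalerA -scalerBr; apply: spanZ.
move=> c lt_c; have [->|ne] := eqVneq c b.
  by exists 1; rewrite scale1r subrr; apply: span0.
exists 0; rewrite scale0r subr0; apply: span_smon; split=> //; exact/eqP.
Qed.

Hypothesis two_neq0 : (2 : K) != 0.

(** Delta * D m is antisymmetric with exponents bounded by those of Delta * m; dividing by
    Delta gives dominated monomials only, and comparing leading terms gives the eigenvalue. *)
Lemma D_smon u b : exists2 f, D u (lp (smon K b)) = lp f &
  smon_span (fun c => smon_lt c b) (f - eigval b u *: smon K b).
Proof.
have sb : smon_span (fun c => smon_le c b) (smon K b) by apply/span_smon/smon_le_refl.
have hdeg w : hull_weight w -> degle w (hull_bound b w + prefix (rho n) (wsupp w))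
   (Delta K n * D u (lp (smon K b))).
  move=> ok; rewrite Delta_D; apply: supported_sum => sg _; rewrite addrC.
  apply: degle_mul.
    by apply: degle_pairs => // [i|i j _]; [apply: degle_unary|apply: degle_pair].
  apply: (degle_twist _ sb); apply/supported_lp => -[l e]; rewrite cf_smon /=.
  case: andP => [[/eqP -> eo] _|_]; last by rewrite eqxx.
  exact: orbit_hull_bound.
have hlead := lead_Delta_D u b.
have [A EA _] := lead_degle hlead.
have hA : antisym A.
  apply/wcharP => [g|g psi hpsi]; first exact: wsgn2.
  by rewrite -EA rmorphM (wmorph_Delta hpsi) (wmorph_D _ sb hpsi) mulrA.
have [d hd] : exists d : nat, forall m, cf m A != 0 -> dot (wrho n) m < d%:Z.
  exists (absz (dot (wrho n) (add_rho b))).+1.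
  have := lead_degle hlead; rewrite EA => /supported_lp h m /h; lia.
have hH m : cf m A != 0 -> in_hull_rho b m.
  by move=> mA w ok; move: m mA; apply/supported_lp; rewrite -EA; apply: hdeg.
have [f fS Ef] := antisym_div two_neq0 hA hd hH.
exists f; first by apply: (mulfI Delta_neq0); rewrite EA Ef.
have [c lt_c] := span_le_split fS.
suff -> : eigval b u = c by [].
have h1 : lead (wrho n) (add_rho b) c (Delta K n * lp f).
  have -> : lp f = lp (c *: smon K b) + lp (f - c *: smon K b).
    by rewrite -raddfD addrC subrK.
  rewrite mulrDr.
  apply: lead_add; last exact: span_lt_deglt.
  rewrite lpZ (mulrCA (Delta K n)); have := lead_mul (lead_mon (wrho n) 0 c) (lead_smon_Delta K b).
  by rewrite mon0 !mulr1 add0r.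
by move: hlead h1; rewrite EA Ef -Ef => /lead_cf <- /lead_cf.
Qed.

Lemma smon_le_lt_trans a b c : smon_le a b -> smon_lt b c -> smon_lt a c.
Proof.
move=> ab bc; have [-> //|/eqP ne] := eqVneq a b.
by apply: smon_lt_le_trans (conj ab ne) _; case: bc.
Qed.

Lemma D_le u a f : smon_span (fun c => smon_le c a) f ->
  exists2 f', D u (lp f) = lp f' & smon_span (fun c => smon_lt c a) (f' - eigval a u *: f).
Proof.
move: f; apply: span_ind.
- exists 0; last by rewrite scaler0 subrr; apply: span0.
  by rewrite raddf0; have := DsopZ t r0 u 0 (0 : L); rewrite mulr0 (rC0 K n) mul0r.
- move=> f g [f' Ef hf] [g' Eg hg]; exists (f' + g').
    by rewrite !lpD -Ef -Eg; apply: DsopD.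
  rewrite scalerDr opprD addrACA; exact: spanD hf hg.
- move=> c f [f' Ef hf]; exists (c *: f').
    by rewrite [in LHS]lpZ (DsopZ t r0 u c) Ef [in RHS]lpZ.
  by rewrite scalerA mulrC -scalerA -scalerBr; apply: spanZ.
move=> b hb; have [f' E hf'] := D_smon u b; exists f'; first exact: E.
have [e|ne] := eqVneq b a; first by rewrite -e; exact: hf'.
have lt : smon_lt b a by split; [exact: hb | exact/eqP].
apply: spanB; last by apply/spanZ/span_smon.
rewrite -[f'](subrK (eigval b u *: smon K b)); apply: spanD.
  apply: span_sub hf' => c [lt_c _]; exact: smon_le_lt_trans lt_c lt.
by apply/spanZ/span_smon.
Qed.

End Triangular.

(** * Values at the points attached to partitions *)

Section Values.
Variables (K : fieldType) (n : nat).
Local Notation M := {fraction {poly K}}.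
Implicit Types (f : laurent K n) (m : expo n) (p : 'I_n -> K).

Definition sdeg m : int := m.1 + \sum_i m.2 i.
Definition pval p m : K := \prod_i p i ^ m.2 i.

(** Coefficient of s^d in the value of f at the point x_i = p_i s. *)
Definition hom_coef (d : int) p f : K :=
  monalg.mmap (@idfun K) (fun m => if sdeg m == d then pval p m else 0) f.
(** The vanishing of f at x_i = p_i s, as a family of conditions on the coefficients of f
    that are linear over the field of the p_i: in this form it passes to other coefficient
    fields. *)
Definition vanish p f := forall d, hom_coef d p f = 0.

Lemma hom_coefE d p f : hom_coef d p f =
  \sum_(m <- lsupp f) cf m f * (if sdeg m == d then pval p m else 0).
Proof. by []. Qed.

Lemma hom_coefB d p : {morph hom_coef d p : f g / f - g}.
Proof. exact: (@monalg.mmapB _ _ _ (@idfun K)). Qed.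

Lemma hom_coefD d p : {morph hom_coef d p : f g / f + g}.
Proof. exact: (@monalg.mmapD _ _ _ (@idfun K)). Qed.

Lemma hom_coef0 d p : hom_coef d p 0 = 0.
Proof. exact: (@monalg.mmap0 _ _ _ (@idfun K)). Qed.

Lemma hom_coefZ d p c f : hom_coef d p (c *: f) = c * hom_coef d p f.
Proof.
rewrite [hom_coef d p f]hom_coefE mulr_sumr; under eq_bigr do rewrite mulrA -monalg.mcoeffZ.
exact: (@monalg.mmapEw _ _ _ (@idfun K) _ _ _ (monalg.msuppZ_le c f)).
Qed.

Lemma vanishZ p c f : vanish p f -> vanish p (c *: f).
Proof. by move=> hf d; rewrite hom_coefZ hf mulr0. Qed.

Lemma vanishB p f g : vanish p f -> vanish p g -> vanish p (f - g).
Proof. by move=> hf hg d; rewrite hom_coefB hf hg subr0. Qed.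

Lemma eq_vanish p p' f : p =1 p' -> vanish p f -> vanish p' f.
Proof.
move=> pp h d; rewrite -(h d) !hom_coefE; apply: eq_bigr => m _.
by rewrite /pval; case: eqP => // _; congr (_ * _); apply: eq_bigr => i _; rewrite pp.
Qed.

Definition konst (c : K) : M := (c%:P)%:F.
HB.instance Definition _ := GRing.RMorphism.copy konst (@FracField.tofrac _ \o @polyC K).

Definition sX : M := ('X : {poly K})%:F.

Lemma sX_neq0 : sX != 0.
Proof. by rewrite tofrac_eq0 polyX_eq0. Qed.

Lemma konst_eq0 c : (konst c == 0) = (c == 0).
Proof. exact: fmorph_eq0. Qed.

Lemma konstM : {morph konst : x y / x * y}. Proof. exact: rmorphM. Qed.
Lemma konst1 : konst 1 = 1. Proof. exact: rmorph1. Qed.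

Definition value (s : M) p f : M := leval konst s (fun i => konst (p i) * s) f.

Lemma mono_val (s : M) p m c : s != 0 ->
  konst c * (s ^ m.1 * \prod_i (konst (p i) * s) ^ m.2 i) = konst (c * pval p m) * s ^ sdeg m.
Proof.
move=> s0; rewrite konstM -[RHS]mulrA; congr (_ * _).
rewrite /pval (rmorph_prod konst) /sdeg expfzDr // [RHS]mulrCA; congr (_ * _).
have -> : s ^ (\sum_i m.2 i) = \prod_i s ^ m.2 i.
  by apply: (big_morph (fun k => s ^ k)); [move=> a b; exact: expfzDr|rewrite expr0z].
by rewrite -big_split; apply: eq_bigr => i _; rewrite expfzMl (fmorphXz konst).
Qed.

Lemma valueE s p f : s != 0 ->
  value s p f = \sum_(m <- lsupp f) konst (cf m f * pval p m) * s ^ sdeg m.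
Proof. by move=> s0; apply: eq_bigr => m _; apply: mono_val. Qed.

Lemma valueU s p m c : s != 0 -> value s p (lmon m c) = konst (c * pval p m) * s ^ sdeg m.
Proof.
by move=> s0; rewrite -mono_val //; exact: (@monalg.mmapU _ _ _ konst).
Qed.

Lemma valueD s p : {morph value s p : f g / f + g}.
Proof. exact: (@monalg.mmapD _ _ _ konst). Qed.

Lemma value0 s p : value s p 0 = 0.
Proof. exact: (@monalg.mmap0 _ _ _ konst). Qed.

Lemma value_scale (c : int -> M) (U : seq (expo n)) (F : expo n -> M) :
  \sum_(m <- U) F m * c (sdeg m) =
  \sum_(d <- undup (map sdeg U)) (\sum_(m <- U | sdeg m == d) F m) * c d.
Proof.
under [RHS]eq_bigr do rewrite mulr_suml.
rewrite (exchange_big_dep xpredT) //= big_seq [RHS]big_seq; apply: eq_bigr => m mU.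
have mD : sdeg m \in undup (map sdeg U) by rewrite mem_undup map_f.
rewrite (big_rem _ mD) /= eqxx big_seq_cond big1 ?addr0 // => d.
rewrite mem_rem_uniq ?undup_uniq // inE => /andP[/andP[dm _] /eqP e].
by rewrite e eqxx in dm.
Qed.

Lemma vanish_value s p f : s != 0 -> vanish p f -> value s p f = 0.
Proof.
move=> s0 h; rewrite valueE // (@value_scale (fun d => s ^ d)).
rewrite big1 // => d _; suff -> : \sum_(m <- lsupp f | sdeg m == d) konst (cf m f * pval p m) = 0.
  by rewrite mul0r.
rewrite -(rmorph_sum konst) -(rmorph0 konst); congr (konst _); apply: etrans (h d); rewrite hom_coefE big_mkcond.
by apply: eq_bigr => m _; case: eqP; rewrite ?mulr0.
Qed.

(** The powers of s are independent over K; multiplying by a power of s makes all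
    exponents nonnegative. *)
Lemma value_vanish p f : value sX p f = 0 -> vanish p f.
Proof.
rewrite valueE ?sX_neq0 // => h d.
pose B := (absz d + \sum_(m <- lsupp f) absz (sdeg m))%N.
have hB m : m \in lsupp f -> (absz (sdeg m) <= B)%N.
  by move=> mf; rewrite /B (big_rem m) //= addnCA leq_addr.
have hd : (absz d <= B)%N by rewrite leq_addr.
have : (\sum_(m <- lsupp f) (cf m f * pval p m) *: 'X^(absz (sdeg m + B%:Z)) : {poly K}) = 0.
  apply/eqP; rewrite -tofrac_eq0; apply/eqP.
  transitivity (0 * sX ^+ B); last exact: mul0r.
  rewrite -h mulr_suml rmorph_sum big_seq [RHS]big_seq; apply: eq_bigr => m /hB mB /=.
  rewrite -mul_polyC tofracM tofracXn -mulrA; congr (_ * _).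
  rewrite !exprnP -expfzDr ?sX_neq0 //; congr (_ ^ _); lia.
move=> /(congr1 (fun q : {poly K} => q`_(absz (d + B%:Z)))).
rewrite coef0 coef_sum => E; apply: etrans E; rewrite hom_coefE big_seq [RHS]big_seq; apply: eq_bigr => m /hB mB.
rewrite coefZ coefXn; have -> : (absz (d + B%:Z)%R == absz (sdeg m + B%:Z)%R) = (sdeg m == d).
  by lia.
by case: eqP; rewrite ?mulr1 ?mulr0.
Qed.

Lemma konst_sX_eq0 c c' (k : int) : k != 0 -> konst c * sX ^ k = konst c' -> c = 0 /\ c' = 0.
Proof.
have pos d d' (j : nat) : (0 < j)%N -> konst d * sX ^+ j = konst d' -> d = 0 /\ d' = 0.
  move=> j0; rewrite -tofracXn /konst -tofracM => /eqP; rewrite tofrac_eq => /eqP E.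
  have jn0 : (j == 0%N) = false by rewrite eqn0Ngt j0.
  have := congr1 (fun q : {poly K} => q`_j) E; have := congr1 (fun q : {poly K} => q`_0) E.
  by rewrite !coefCM !coefXn !coefC !eqxx [(0 == j)%N]eq_sym jn0 mulr0 mulr1 => <- ->.
case: k => [[//|k] _|k _]; first exact: pos.
rewrite NegzE -exprnN => E; have [] := pos c' c k.+1 isT; last by split.
by rewrite -E divfK // expf_neq0 // sX_neq0.
Qed.

End Values.

Section EvalD.
Variables (K : fieldType) (n : nat) (r t : K).
Local Notation L := (ratfun K n).
Local Notation M := {fraction {poly K}}.
Local Notation lp := (@to_ratfun K K n id).
Local Notation s := (sX K).
Local Notation D := (Dsop (n := n) r t).
Implicit Types (f : laurent K n) (m : expo n) (sg : {ffun 'I_n -> bool}) (mu nu : part n).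
Hypothesis r0 : r != 0.
Hypothesis t0 : t != 0.
Hypothesis indep : forall a b : int, r ^ a * t ^ b = 1 -> a = 0 /\ b = 0.

(** The point x_i = q^(mu_i) t^(n-i) s, divided by s. *)
Definition point mu (i : 'I_n) : K := (r ^+ 2) ^+ part_nth mu i * t ^+ (n - i.+1).

Lemma point_neq0 mu i : point mu i != 0.
Proof. by rewrite mulf_neq0 // !expf_neq0. Qed.

Lemma point_inj mu nu i j : point mu i = point nu j -> i = j /\ part_nth mu i = part_nth nu j.
Proof.
have ptE mu' i' : point mu' i' = r ^ (2 * (part_nth mu' i')%:Z) * t ^ (n - i'.+1)%:Z.
  by rewrite /point -exprM [X in X * _]exprnP [X in _ * X]exprnP PoszM.
move=> E; have : r ^ (2 * (part_nth mu i)%:Z - 2 * (part_nth nu j)%:Z) *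
    t ^ ((n - i.+1)%:Z - (n - j.+1)%:Z) = 1.
  by rewrite !expfzDr // -!invr_expz mulrACA -invfM -!ptE E divff // point_neq0.
case/indep => h1 h2; have := ltn_ord i; have := ltn_ord j => ? ?.
by split; [apply/val_inj; rewrite /=; lia | lia].
Qed.

Section Point.
Variable mu : part n.

Definition coords (j : 'I_n.+1) : M := if unlift ord0 j is Some i then konst (point mu i) * s else s.
Definition ev : {rmorphism {mpoly K[n.+1]} -> M} := mmap (@konst K) coords.

Lemma ev_C c : frac_at ev (rC n c) (konst c).
Proof. by have := frac_at_tofrac ev c%:MP; rewrite /ev /= mmapC. Qed.

Lemma ev_S : frac_at ev (rS K n) s.
Proof. by have := frac_at_tofrac ev 'X_ord0; rewrite /ev /= mmapX mmap1U /coords unlift_none. Qed.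

Lemma ev_X i : frac_at ev (rX K i) (konst (point mu i) * s).
Proof.
by have := frac_at_tofrac ev 'X_(lift ord0 i); rewrite /ev /= mmapX mmap1U /coords liftK.
Qed.

Lemma xv_neq0 i : konst (point mu i) * s != 0.
Proof. by rewrite mulf_neq0 ?konst_eq0 ?point_neq0 ?sX_neq0. Qed.

Lemma ev_lp f : frac_at ev (lp f) (value s (point mu) f).
Proof.
apply: frac_at_sum => m _; apply: frac_atM; first exact: ev_C.
apply: frac_atM; first by apply: frac_atXz; [exact: sX_neq0|exact: ev_S].
by apply: frac_at_prod => i _; apply: frac_atXz; [exact: xv_neq0|exact: ev_X].
Qed.

Definition Yval sg (i : 'I_n) : M := (konst (point mu i) * s) ^ sgb (sg i).

Lemma ev_Y sg i : frac_at ev (Y K sg i) (Yval sg i).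
Proof. by apply: frac_atXz; [exact: xv_neq0|exact: ev_X]. Qed.

Lemma YvalE sg i : Yval sg i = konst (point mu i ^ sgb (sg i)) * s ^ sgb (sg i).
Proof. by rewrite /Yval expfzMl (fmorphXz (@konst K)). Qed.

Lemma Yval2_neq1 sg i : 1 - Yval sg i ^+ 2 != 0.
Proof.
rewrite subr_eq0 eq_sym YvalE expr2 mulrACA -konstM -(expfzDr _ _ (sX_neq0 K)) -(konst1 K).
apply/eqP => /konst_sX_eq0 [|_ /eqP]; last by rewrite oner_eq0.
by case: (sg i).
Qed.

Lemma Yval_pair_neq1 sg i j : i != j -> 1 - Yval sg i * Yval sg j != 0.
Proof.
move=> ij; rewrite subr_eq0 eq_sym !YvalE mulrACA -konstM -(expfzDr _ _ (sX_neq0 K)) -(konst1 K).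
have [e|ne] := eqVneq (sg i) (sg j).
  apply/eqP => /konst_sX_eq0 [|_ /eqP]; last by rewrite oner_eq0.
  by rewrite e; case: (sg j).
have -> : sgb (sg i) + sgb (sg j) = 0 by case: (sg i) (sg j) ne => -[].
rewrite expr0z mulr1 (inj_eq (fmorph_inj (@konst K))); apply/eqP => E.
suff : point mu i = point mu j by case/point_inj => e; rewrite e eqxx in ij.
have hi := point_neq0 mu i; have hj := point_neq0 mu j.
case: (sg i) (sg j) ne E => -[] // _; rewrite /sgb ?expr1 ?expr0 ?expr1z ?exprN1 => E.
  by rewrite -[LHS]mulr1 -E mulVKf.
by rewrite -[RHS]mul1r -E divfK.
Qed.

Definition Dcoef_value u sg : M :=
  (\prod_(i < n) ((1 - s * Yval sg i) * (1 - konst u / s * Yval sg i) / (1 - Yval sg i ^+ 2))) *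
     (\prod_(i < n) \prod_(j < n | (i < j)%N)
        ((1 - konst t * Yval sg i * Yval sg j) / (1 - Yval sg i * Yval sg j))).

Lemma ev_Dcoef u sg : frac_at ev (Dcoef t u sg) (Dcoef_value u sg).
Proof.
have hY := ev_Y sg; have hs := ev_S; have hC := ev_C; have h1 := frac_at1 ev.
apply: frac_atM; apply: frac_at_prod => i _.
  apply: frac_at_div; first exact: Yval2_neq1.
    apply: frac_atM; first by apply: frac_atB => //; apply: frac_atM.
    apply: frac_atB => //; apply: frac_atM => //.
    by apply: frac_at_div => //; apply: sX_neq0.
  by apply: frac_atB => //; apply: frac_atXn.
apply: frac_at_prod => j ij; apply: frac_at_div.
- by apply: Yval_pair_neq1; rewrite -(inj_eq val_inj) /=; lia.
- by apply: frac_atB => //; apply: frac_atM => //; apply: frac_atM.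
- by apply: frac_atB => //; apply: frac_atM.
Qed.

(** The left-hand side is the value of f at the shifted point with s replaced by
    s sqrt q; this replacement multiplies the homogeneous parts by powers of r, so that it
    preserves vanishing. *)
Lemma twist_vanish sg f :
  vanish (fun i => point mu i * r ^ (sgb (sg i) - 1)) f -> value s (point mu) (twist r sg f) = 0.
Proof.
move=> h; have rs0 : konst r * s != 0 by rewrite mulf_neq0 ?konst_eq0 ?sX_neq0.
apply: etrans (vanish_value rs0 h); rewrite (valueE _ _ rs0).
rewrite /twist (big_morph (value s (point mu)) (@valueD K n s (point mu)) (value0 s (point mu))).
apply: eq_bigr => m _; rewrite valueU ?sX_neq0 // (expfzMl (konst r) s) -(fmorphXz (@konst K)) [RHS]mulrA -[in RHS]konstM.
congr (konst _ * _); rewrite -[LHS]mulrA -[RHS]mulrA; congr (_ * _).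
have -> : pval (fun i => point mu i * r ^ (sgb (sg i) - 1)) m =
  pval (point mu) m * \prod_i r ^ ((sgb (sg i) - 1) * m.2 i).
  by rewrite /pval -big_split; apply: eq_bigr => i _; rewrite expfzMl exprz_exp.
rewrite [LHS]mulrC -[RHS]mulrA; congr (_ * _).
rewrite /twist_factor /sdeg expfzDr // mulrCA; congr (_ * _).
have -> : r ^ (\sum_i m.2 i) = \prod_i r ^ m.2 i.
  by apply: (big_morph (fun k => r ^ k)); [move=> a b; exact: expfzDr|rewrite expr0z].
rewrite -big_split; apply: eq_bigr => i _; rewrite /= exprz_exp -expfzDr //.
by congr (_ ^ _); ring.
Qed.

End Point.
End EvalD.

(** * The action of the operator on values *)

Lemma root_cancel (F : fieldType) (a b s : F) : s != 0 -> a / s * (b * s) = a * b.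
Proof. by move=> s0; field. Qed.

Section VerticalStrips.
Variable n : nat.
Implicit Types (sg : {ffun 'I_n -> bool}) (mu nu : part n).

(** nu is mu minus the vertical strip sg. *)
Definition vstrip mu sg nu := forall i, (part_nth nu i + sg i)%N = part_nth mu i.

(** Either removing sg from mu leaves a partition, or sg removes a box from an empty
    last row, or it removes a box from the upper of two consecutive equal rows and not from
    the lower one. *)
Lemma vstripP mu sg :
  [\/ exists nu, vstrip mu sg nu,
      exists i : 'I_n, [/\ i.+1 = n, sg i & part_nth mu i = 0%N] |
      exists i j : 'I_n, [/\ j = i.+1 :> nat, sg i, ~~ sg j & part_nth mu i = part_nth mu j]].
Proof.
case: (boolP [exists i : 'I_n, [&& i.+1 == n, sg i & part_nth mu i == 0%N]]) => [/existsP[i]|].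
  by case/and3P => /eqP h1 h2 /eqP h3; constructor 2; exists i.
rewrite negb_exists => /forallP hA.
case: (boolP [exists i : 'I_n, [exists j : 'I_n, [&& j == i.+1 :> nat, sg i, ~~ sg j
    & part_nth mu i == part_nth mu j]]]) => [/existsP[i /existsP[j]]|].
  by case/and4P => /eqP h1 h2 h3 /eqP h4; constructor 3; exists i, j.
rewrite negb_exists => /forallP hB'.
have hB (i j : 'I_n) : j = i.+1 :> nat -> sg i -> part_nth mu i = part_nth mu j -> sg j.
  move=> ij si e; have := hB' i; rewrite negb_exists => /forallP/(_ j).
  by rewrite ij eqxx si e eqxx andbT /= negbK.
(* A box removed from an empty row forces one to be removed from all rows below. *)
have pos (i : 'I_n) : (sg i <= part_nth mu i)%N.
  move E : (n - i)%N => k; elim: k i E => [|k IH] i E; first by have := ltn_ord i; lia.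
  case si : (sg i) => //; rewrite lt0n; apply/negP => /eqP m0.
  have [iN|iN] := eqVneq i.+1 n; first by have := hA i; rewrite iN eqxx si m0.
  have jN : (i.+1 < n)%N by have := ltn_ord i; lia.
  have m0' : part_nth mu (Ordinal jN) = 0%N.
    by apply/eqP; rewrite -leqn0 -m0; apply: part_nth_le.
  have := IH (Ordinal jN); rewrite m0' (hB i) //= ?m0 ?m0' // => /(_ ltac:(lia)); lia.
constructor 1.
have srt : sorted geq [tuple (part_nth mu i - sg i)%N | i < n].
  apply/(sortedP 0%N) => i; rewrite size_tuple => iN.
  have i'N : (i < n)%N by apply: ltnW.
  rewrite -[i]/(val (Ordinal i'N)) -[_.+1]/(val (Ordinal iN)) -!tnth_nth !tnth_mktuple.
  have := pos (Ordinal iN); have := pos (Ordinal i'N).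
  have := @part_nth_le _ mu (Ordinal i'N) (Ordinal iN) (leqnSn i).
  have := hB (Ordinal i'N) (Ordinal iN) erefl.
  rewrite /geq /=; case: (sg _); case: (sg (Ordinal iN)) => /=; lia.
exists (exist _ [tuple (part_nth mu i - sg i)%N | i < n] srt) => i.
by rewrite /part_nth tnth_mktuple /= subnK // pos.
Qed.

End VerticalStrips.

Section EvalOp.
Variables (K : fieldType) (n : nat) (r t : K).
Local Notation L := (ratfun K n).
Local Notation M := {fraction {poly K}}.
Local Notation lp := (@to_ratfun K K n id).
Local Notation s := (sX K).
Local Notation D := (Dsop (n := n) r t).
Implicit Types (f : laurent K n) (m : expo n) (sg : {ffun 'I_n -> bool}) (mu nu : part n).
Hypothesis r0 : r != 0.
Hypothesis t0 : t != 0.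
Hypothesis indep : forall a b : int, r ^ a * t ^ b = 1 -> a = 0 /\ b = 0.

Lemma frac0l (F : fieldType) (a b c : F) : a = 0 -> a * b / c = 0.
Proof. by move=> ->; rewrite !mul0r. Qed.

Lemma frac0r (F : fieldType) (a b c : F) : b = 0 -> a * b / c = 0.
Proof. by move=> ->; rewrite mulr0 mul0r. Qed.

Lemma frac0 (F : fieldType) (a c : F) : a = 0 -> a / c = 0.
Proof. by move=> ->; rewrite mul0r. Qed.

Lemma prod_mul0l (F : fieldType) (A : F) (f : 'I_n -> F) i :
  f i = 0 -> \prod_j f j * A = 0.
Proof. by move=> fi; rewrite (bigD1 i) //= fi !mul0r. Qed.

Lemma prod_mul0r (F : fieldType) (A : F) (f : 'I_n -> 'I_n -> F) (i j : 'I_n) :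
  (i < j)%N -> f i j = 0 -> A * \prod_(i < n) \prod_(j < n | (i < j)%N) f i j = 0.
Proof.
by move=> ij fij; rewrite (bigD1 i) //= [X in A * (X * _)](bigD1 j) //= fij !mul0r mulr0.
Qed.

(** The factor 1 - s y_i vanishes. *)
Lemma Dcoef_value_strip mu u sg : (exists i : 'I_n, [/\ i.+1 = n, sg i & part_nth mu i = 0%N]) ->
  Dcoef_value r t mu u sg = 0.
Proof.
move=> [i [iN si mi]]; have Vi : Yval r t mu sg i = s^-1.
  by rewrite /Yval si /sgb expr1 exprN1 /point mi iN subnn !expr0 mulr1 konst1 mul1r.
have z : 1 - s * Yval r t mu sg i = 0 by rewrite Vi divff ?sX_neq0 // subrr.
exact/(@prod_mul0l _ _ _ i)/frac0l.
Qed.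

(** The factor 1 - t y_i y_j vanishes. *)
Lemma Dcoef_value_pair mu u sg : (exists i j : 'I_n,
   [/\ j = i.+1 :> nat, sg i, ~~ sg j & part_nth mu i = part_nth mu j]) ->
  Dcoef_value r t mu u sg = 0.
Proof.
move=> [i [j [ij si sj mij]]]; apply: (@prod_mul0r _ _ _ i j); first by rewrite ij.
apply: frac0.
have Vi : Yval r t mu sg i = (konst (point r t mu i) * s)^-1.
  by rewrite /Yval si /sgb expr1 exprN1.
have Vj : Yval r t mu sg j = konst (point r t mu j) * s.
  by rewrite /Yval (negPf sj) /sgb expr0 expr1z.
rewrite Vi Vj.
have E : point r t mu i = t * point r t mu j.
  rewrite /point mij mulrCA -exprS; congr (_ * _ ^+ _).
  by have := ltn_ord j; rewrite ij; lia.
have p0 := point_neq0 r0 t0 mu j; rewrite E konstM.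
have nz : konst t * konst (point r t mu j) * s != 0.
  by rewrite !mulf_neq0 ?konst_eq0 ?sX_neq0.
move: nz; move: (konst t) (konst _) => x y nz; by rewrite mulrAC mulrA divff ?subrr.
Qed.

(** The factor 1 - (u/s) y_i vanishes. *)
Lemma Dcoef_value_root mu u sg : (exists i : 'I_n, ~~ sg i /\ u * point r t mu i = 1) ->
  Dcoef_value r t mu u sg = 0.
Proof.
move=> [i [si ui]]; have Vi : Yval r t mu sg i = konst (point r t mu i) * s.
  by rewrite /Yval (negPf si) /sgb expr0 expr1z.
have z : 1 - konst u / s * Yval r t mu sg i = 0.
  by rewrite Vi root_cancel ?sX_neq0 // -konstM ui konst1 subrr.
exact/(@prod_mul0l _ _ _ i)/frac0r.
Qed.

(** The value of D f at mu is a combination of the values of f at the partitions obtained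
    from mu by removing a vertical strip; a summand also disappears when its signs contain
    a + at an index i such that u q^(mu_i) t^(n-i) = 1. *)
Lemma eval_D mu u f g : D u (lp f) = lp g ->
  (forall sg nu, vstrip mu sg nu -> vanish (point r t nu) f \/
     exists i, ~~ sg i /\ u * point r t mu i = 1) ->
  vanish (point r t mu) g.
Proof.
move=> E h; apply: value_vanish; apply: (@frac_at_uniq _ _ (ev r t mu) (lp g)).
  exact: ev_lp.
rewrite -E DsopE //.
have -> : 0 = \sum_sg Dcoef_value r t mu u sg * value s (point r t mu) (twist r sg f).
  rewrite big1 // => sg _; case: (vstripP mu sg).
  - move=> [nu hnu]; case: (h sg nu hnu) => [hv|hr]; last by rewrite Dcoef_value_root ?mul0r.
    rewrite twist_vanish ?mulr0 //; apply: eq_vanish hv => i.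
    rewrite /point -(hnu i) mulrAC; congr (_ * _).
    case: (sg i); rewrite /sgb ?expr1 ?expr0 /= ?subrr ?expr0z ?mulr1 ?addn0 //.
    rewrite addn1 (exprS (r ^+ 2)) -[-1 - 1 : int]/(- 2%:Z) -exprnN [RHS]mulrC mulKf ?expf_neq0 //.
  - by move=> hs; rewrite Dcoef_value_strip ?mul0r.
  - by move=> hs; rewrite Dcoef_value_pair ?mul0r.
apply: frac_at_sum => sg _; apply: frac_atM; last exact: ev_lp.
exact: ev_Dcoef.
Qed.

End EvalOp.

(** * Multiplication by powers of s *)

Lemma mulr_shuffle (R : comPzRingType) (a x y w : R) :
  a * (y * w * x) = y * (w * (a * x)).
Proof. by ring. Qed.

Section SPow.
Variables (K : fieldType) (n : nat).
Local Notation L := (ratfun K n).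
Local Notation lp := (@to_ratfun K K n id).
Implicit Types (f : laurent K n) (m : expo n) (k : int).

Lemma lp_mul_spow k f : lp (mul_spow k f) = mon K (k, 0) * lp f.
Proof.
rewrite [lp f]lpE mulr_sumr /mul_spow (raddf_sum lp); apply: eq_bigr => m _ /=.
rewrite lpU [RHS]mulrCA -monD; congr (_ * mon K _).
by case: m => l e; congr pair; rewrite /= add0r.
Qed.

Lemma mul_spowD k f g : mul_spow k (f + g) = mul_spow k f + mul_spow k g.
Proof.
apply: lp_inj; apply: etrans (lp_mul_spow k (f + g)) _.
apply: etrans (congr1 _ (lpD f g)) _; apply: etrans (mulrDr _ _ _) _.
apply: esym; apply: etrans (lpD _ _) _.
exact: congr2 (lp_mul_spow k f) (lp_mul_spow k g).
Qed.

Lemma mul_spowZ k c f : mul_spow k (c *: f) = c *: mul_spow k f.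
Proof.
apply: lp_inj; apply: etrans (lp_mul_spow k (c *: f)) _.
apply: etrans (congr1 _ (lpZ c f)) _; apply: etrans (mulrCA _ _ _) _.
apply: esym; apply: etrans (lpZ _ _) _.
exact: congr1 (lp_mul_spow k f).
Qed.

Lemma mul_spowB k f g : mul_spow k (f - g) = mul_spow k f - mul_spow k g.
Proof. by rewrite mul_spowD -scaleN1r mul_spowZ scaleN1r. Qed.

Lemma mul_spow0 k : mul_spow k (0 : laurent K n) = 0.
Proof. by apply: lp_inj; rewrite lp_mul_spow lp0 mulr0. Qed.

Lemma mul_spow_smon k b : mul_spow k (smon K b) = smon K (n := n) (k + b.1, b.2).
Proof.
apply: lp_inj; rewrite lp_mul_spow /smon !(raddf_sum lp) mulr_sumr; apply: eq_bigr => e _ /=.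
rewrite !lpU [LHS]mulrCA -monD; congr (_ * mon K _); congr pair; by rewrite /= add0r.
Qed.

Lemma span_mul_spow A B k f : (forall b, A b -> B (k + b.1, b.2)) ->
  smon_span A f -> smon_span B (mul_spow k f).
Proof.
move=> AB; move: f; apply: span_ind.
- by rewrite mul_spow0; apply: span0.
- by move=> f g hf hg; rewrite mul_spowD; apply: spanD hf hg.
- by move=> c f hf; rewrite mul_spowZ; apply: spanZ.
- by move=> b hb; rewrite mul_spow_smon; apply/span_smon/AB.
Qed.

Lemma smon_lt_shift k (a b : int * part n) :
  smon_lt b a -> smon_lt (k + b.1, b.2) (k + a.1, a.2).
Proof.
move=> h; have ne := smon_lt_neq h; case: h => -[h1 h2] _; split; last by case.
by split=> //=; lia.
Qed.

(** D rescales s by r. *)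
Lemma Dsop_spow r t u k (z : L) : r != 0 ->
  Dsop r t u (mon K (k, 0) * z) = rC n (r ^ k) * (mon K (k, 0) * Dsop r t u z).
Proof.
move=> r0.
have [p1 [E1 M1]] := @rescale_rmorphism K n r (fun=> 1) r0 (fun=> oner_neq0 K).
rewrite /Dsop /Dop !mulr_sumr; apply: eq_bigr => sg _ /=.
have rs (i : 'I_n) : r ^ sgb (sg i) != 0 by rewrite expfz_neq0.
have [p2 [E2 M2]] := @rescale_rmorphism K n 1 _ (oner_neq0 K) rs.
have s0 (x : K) (y : 'I_n -> K) : scale_fac x y (k, 0) = x ^ k.
  by rewrite /scale_fac /= big1 ?mulr1 // => i _; rewrite ffunE expr0z.
have C1 : p1 (mon K (k, 0)) = rC n (r ^ k) * mon K (k, 0).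
  by have := M1 (k, 0) 1; rewrite s0 rC1 !mul1r.
have C2 : p2 (rC n (r ^ k) * mon K (k, 0)) = rC n (r ^ k) * mon K (k, 0).
  by rewrite M2 s0 exp1rz mulr1.
rewrite -!E1 -!E2 rmorphM C1 rmorphM C2.
exact: mulr_shuffle.
Qed.

End SPow.

(** * Vanishing and non-vanishing of eigenfunctions *)

Section PartSize.
Variable n : nat.
Implicit Types mu nu lam : part n.

Lemma part_sub_size mu nu : part_sub nu mu -> (part_size nu <= part_size mu)%N.
Proof.
move=> h; rewrite -lez_nat !part_sizeE_sum; apply: ler_sum => i _.
by rewrite lez_nat.
Qed.

Lemma part_eqP mu nu : (forall i, part_nth mu i = part_nth nu i) -> mu = nu.
Proof. by move=> h; apply/val_inj/eq_from_tnth/h. Qed.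

Lemma part_sub_eq mu nu : part_sub nu mu -> part_size nu = part_size mu -> nu = mu.
Proof.
move=> h e; apply: part_eqP => i; have /eqP := congr1 Posz e.
rewrite !part_sizeE_sum eq_sym -subr_eq0 -sumrB psumr_eq0 => [/allP/(_ i)|j _].
  by move/(_ (mem_index_enum _)); rewrite /= subr_eq0 eqz_nat => /eqP.
by rewrite subr_ge0 lez_nat.
Qed.

Lemma vstrip_sub mu sg nu : vstrip mu sg nu -> part_sub nu mu.
Proof. by move=> h i; rewrite -(h i) leq_addr. Qed.

Lemma vstrip_size mu sg nu i : vstrip mu sg nu -> sg i -> (part_size nu < part_size mu)%N.
Proof.
move=> h si; rewrite ltn_neqAle part_sub_size ?andbT; last exact: vstrip_sub h.
apply/eqP => e; have E := part_sub_eq (vstrip_sub h) e.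
by have := h i; rewrite E si; lia.
Qed.

Lemma vstrip_lt mu sg nu : vstrip mu sg nu -> nu <> mu -> (part_size nu < part_size mu)%N.
Proof.
move=> h ne; have := part_sub_size (vstrip_sub h); rewrite leq_eqVlt => /orP[/eqP e|//].
by case: ne; apply: part_sub_eq e; apply: vstrip_sub h.
Qed.

Lemma part_enum d : exists l : seq (part n), uniq l /\
  forall mu, (part_size mu <= d)%N -> mu \in l.
Proof.
pose f (t : n.-tuple 'I_d.+1) : option (part n) :=
   insub [tuple (tnth t i : nat) | i < n].
exists (undup (pmap f (enum {: n.-tuple 'I_d.+1}))); split; first exact: undup_uniq.
move=> mu hmu; rewrite mem_undup mem_pmap; apply/mapP.
have bnd (i : 'I_n) : (part_nth mu i < d.+1)%N.
  rewrite ltnS; apply: leq_trans hmu; rewrite -lez_nat part_sizeE_sum (bigD1 i) //=.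
  by rewrite lerDl sumr_ge0.
exists [tuple inord (part_nth mu i) | i < n]; first by rewrite mem_enum.
rewrite /f; have -> : [tuple (tnth [tuple inord (part_nth mu i) : 'I_d.+1 | i < n] i : nat) | i < n]
  = val mu.
  by apply: eq_from_tnth => i; rewrite !tnth_mktuple inordK.
by rewrite valK.
Qed.

Lemma part_neqP mu nu : mu <> nu -> exists i, part_nth mu i <> part_nth nu i.
Proof.
move=> ne; case: (boolP [exists i, part_nth mu i != part_nth nu i]) => [/existsP[i /eqP h]|].
  by exists i.
rewrite negb_exists => /forallP h; case: ne; apply: part_eqP => i.
by have := h i; rewrite negbK => /eqP.
Qed.

End PartSize.

Section Interp.
Variables (K : fieldType) (n : nat) (r t : K).
Local Notation L := (ratfun K n).
Local Notation lp := (@to_ratfun K K n id).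
Local Notation D := (Dsop (n := n) r t).
Local Notation pnt := (point r t).
Implicit Types (f P : laurent K n) (m : expo n) (mu nu lam : part n) (a b : int * part n).
Hypothesis r0 : r != 0.
Hypothesis t0 : t != 0.
Hypothesis indep : forall a b : int, r ^ a * t ^ b = 1 -> a = 0 /\ b = 0.

Lemma eigval_factor k lam u : eigval r t (k, lam) u =
  r ^ k * \prod_(i < n) (r ^ (- (part_nth lam i)%:Z) * (1 - u * pnt lam i)).
Proof.
rewrite /eigval /=; congr (_ * _); apply: eq_bigr => i _; rewrite mulrBr mulr1.
congr (_ - _); rewrite /point -exprM mul2n -addnn exprD -exprnN.
rewrite -[r ^ (part_nth lam i)%:Z]exprnP.
have := expf_neq0 (part_nth lam i) r0; move: (r ^+ _) (t ^+ _) => x y x0.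
by field.
Qed.

(** At u = 1/(q^(mu_i) t^(n-i)) a factor of the eigenvalue at mu vanishes. None of the
    factors at lam does, because q and t are multiplicatively independent. *)
Lemma eigval_point_neq0 k lam mu i : part_nth mu i <> part_nth lam i ->
  eigval r t (k, lam) (pnt mu i)^-1 != 0.
Proof.
move=> ne; rewrite eigval_factor mulf_neq0 ?expfz_neq0 //; apply/prodf_neq0 => j _.
rewrite mulf_neq0 ?expfz_neq0 // subr_eq0 eq_sym; apply/eqP => E.
have : pnt mu i = pnt lam j by rewrite -[LHS]mulr1 -E mulVKf // point_neq0.
by case/(point_inj r0 t0 indep) => e1 e2; apply: ne; rewrite e2 e1.
Qed.

Definition eigenfunction a P := smon_span (fun b => smon_lt b a) (P - smon K a) /\
  forall u, D u (lp P) = rC n (eigval r t a u) * lp P.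

(** Take u such that the diagonal coefficient of the operator at mu vanishes but the
    eigenvalue does not: only the values at smaller partitions remain. *)
Lemma eigen_vanish_step lam mu P : (forall u, D u (lp P) = rC n (eigval r t (0, lam) u) * lp P) ->
  mu <> lam -> (forall nu, part_sub nu mu -> (part_size nu < part_size mu)%N ->
    vanish (pnt nu) P) -> vanish (pnt mu) P.
Proof.
move=> hE /part_neqP [i ne] hsm; pose u := (pnt mu i)^-1.
have E0 : eigval r t (0, lam) u != 0 by apply: eigval_point_neq0.
have : vanish (pnt mu) (eigval r t (0, lam) u *: P).
  apply: (@eval_D _ _ r t r0 t0 indep mu u P); first by rewrite hE lpZ.
  move=> sg nu hnu; case si : (sg i); last first.
    by right; exists i; rewrite si mulVf // point_neq0.
  by left; apply: hsm; [exact: vstrip_sub hnu | exact: vstrip_size hnu si].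
move=> h d; have := h d; rewrite hom_coefZ => /eqP; rewrite mulf_eq0 (negPf E0).
by move/eqP.
Qed.

Lemma part_sub_refl mu : part_sub mu mu. Proof. by move=> i. Qed.

Lemma part_sub_trans mu nu lam : part_sub mu nu -> part_sub nu lam -> part_sub mu lam.
Proof. by move=> h h' i; apply: leq_trans (h i) (h' i). Qed.

Lemma eigen_vanish lam mu P : eigenfunction (0, lam) P -> ~ part_sub lam mu -> vanish (pnt mu) P.
Proof.
move=> [_ hE]; move: {2}(part_size mu) (leqnn (part_size mu)) => d.
elim: d mu => [|d IH] mu hd hs.
  apply: (eigen_vanish_step hE) => [e|nu _]; last by lia.
  by apply: hs; rewrite e; apply: part_sub_refl.
apply: (eigen_vanish_step hE) => [e|nu sub lt].
  by apply: hs; rewrite e; apply: part_sub_refl.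
apply: IH; first lia.
by move=> h; apply: hs; apply: part_sub_trans sub.
Qed.

Lemma span_lt_lead a P : smon_span (fun b => smon_lt b a) (P - smon K a) ->
  lead (wrho n) (a.1, pexpo a.2) 1 (lp P).
Proof.
move=> h; have -> : lp P = lp (smon K a) + lp (P - smon K a).
  by rewrite lpB addrC subrK.
apply: lead_add; first exact: lead_smon.
move: (P - _) h; apply: span_ind.
- by rewrite lp0; apply: supported0.
- by move=> f g hf hg; rewrite lpD; apply: supportedD.
- by move=> c f hf; rewrite lpZ; apply: supportedZ.
move=> b hb; apply: supported_sub (lead_degle (lead_smon K b)) => m h.
exact: le_lt_trans h (smon_lt_wrho hb).
Qed.

Lemma rhoM_sorted M : sorted geq [tuple (M * (n - i))%N | i < n].
Proof.
apply/(sortedP 0%N) => i; rewrite size_tuple => iN.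
have i'N : (i < n)%N by apply: ltnW.
rewrite -[i]/(val (Ordinal i'N)) -[_.+1]/(val (Ordinal iN)) -!tnth_nth !tnth_mktuple /=.
by rewrite leq_mul2l; lia.
Qed.

Definition rhoM M : part n := exist _ [tuple (M * (n - i))%N | i < n] (rhoM_sorted M).

Lemma pval_rhoM M m : pval (pnt (rhoM M)) m =
  (\prod_(i < n) (t ^+ (n - i.+1)) ^ m.2 i) * (r ^+ 2) ^ (M%:Z * dot (wrho n) m).
Proof.
have q0 : r ^+ 2 != 0 by rewrite expf_neq0.
have -> : (r ^+ 2) ^ (M%:Z * dot (wrho n) m) = \prod_(i < n) (r ^+ 2) ^ (M%:Z * ((n - i)%:Z * m.2 i)).
  rewrite /dot mul0r add0r mulr_sumr.
  rewrite (big_morph (fun k => (r ^+ 2) ^ k) (fun x y : int => expfzDr x y q0) (expr0z _)).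
  by apply: eq_bigr => i _; rewrite ffunE.
rewrite /pval -big_split; apply: eq_bigr => i _ /=.
rewrite /point /part_nth tnth_mktuple expfzMl mulrC; congr (_ * _).
by rewrite exprnP exprz_exp PoszM mulrA.
Qed.

Lemma qpow_inj (a b : int) : (r ^+ 2) ^ a = (r ^+ 2) ^ b -> a = b.
Proof.
move=> E; have : r ^ (2 * a - 2 * b) * t ^ 0 = 1.
  have E2 (c : int) : r ^ (2 * c) = (r ^+ 2) ^ c by rewrite -exprz_exp.
  by rewrite expr0z mulr1 expfzDr // -invr_expz !E2 E divff // expfz_neq0 ?expf_neq0.
by case/indep; lia.
Qed.

(** At M rho the monomial x^e takes a value proportional to the M-th power of q^<rho, e>.
    Vanishing for all M says that a polynomial in one variable has the infinitely many roots
    q^M; its leading coefficient comes from x^lam alone. *)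
Lemma not_all_vanish lam P : smon_span (fun b => smon_lt b (0, lam)) (P - smon K (0, lam)) ->
  ~ (forall mu, vanish (pnt mu) P).
Proof.
move=> hP hv; have hl := span_lt_lead hP; have c1 := lead_cf hl.
have hlt m : cf m P != 0 -> m <> (0, pexpo lam) -> dot (wrho n) m < dot (wrho n) (0, pexpo lam).
  move: hl; rewrite /lead -lpU -lpB => /supported_lp h mP /eqP ne; apply: h.
  rewrite monalg.mcoeffB monalg.mcoeffU; rewrite eq_sym in ne.
  by rewrite (negPf ne) mulr0n subr0.
pose d := sdeg (0, pexpo lam) : int.
pose tau m : K := \prod_(i < n) (t ^+ (n - i.+1)) ^ m.2 i.
(* The shift by B makes all exponents of the one-variable polynomial nonnegative. *)
pose B := (\sum_(m <- lsupp P) absz (dot (wrho n) m))%N.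
have hB m : m \in lsupp P -> (absz (dot (wrho n) m) <= B)%N.
  by move=> mf; rewrite /B (big_rem m) //= leq_addr.
pose c m := cf m P * (if sdeg m == d then tau m else 0).
pose Q : {poly K} := \sum_(m <- lsupp P) c m *: 'X^(absz (dot (wrho n) m + B%:Z)).
have lamP : (0, pexpo lam) \in lsupp P by rewrite -monalg.mcoeff_neq0 c1 oner_neq0.
have Q0 : Q != 0.
  apply/eqP => /(congr1 (fun q : {poly K} => q`_(absz (dot (wrho n) (0, pexpo lam) + B%:Z)))).
  rewrite coef0 coef_sum (big_rem (0, pexpo lam)) //= coefZ coefXn eqxx mulr1 big_seq big1.
    rewrite addr0 /c c1 mul1r eqxx => /eqP; apply/negP/prodf_neq0 => i _.
    by rewrite expfz_neq0 // expf_neq0.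
  move=> m; rewrite mem_rem_uniq ?finmap.fset_uniq // inE => /andP[/eqP ne mP].
  rewrite coefZ coefXn; have := hlt m; rewrite monalg.mcoeff_neq0 => /(_ mP ne).
  have := hB m mP; have := hB _ lamP => h1 h2 h3.
  by have -> : (absz (dot (wrho n) (0, pexpo lam) + B%:Z)%R == absz (dot (wrho n) m + B%:Z)%R) = false;
    [lia | rewrite mulr0].
have Qroot M : root Q ((r ^+ 2) ^+ M).
  rewrite /root /Q horner_sum; apply/eqP.
  have q0 : r ^+ 2 != 0 by rewrite expf_neq0.
  transitivity ((r ^+ 2) ^ (M%:Z * B%:Z) * hom_coef d (pnt (rhoM M)) P); last by rewrite hv mulr0.
  rewrite hom_coefE mulr_sumr big_seq [RHS]big_seq; apply: eq_bigr => m mP.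
  rewrite hornerZ hornerXn /c -mulrA [RHS]mulrCA; congr (_ * _).
  case: eqP => _; last by rewrite mul0r mulr0.
  rewrite pval_rhoM [RHS]mulrCA; congr (_ * _).
  rewrite -expfzDr // -(exprM (r ^+ 2)) (exprnP (r ^+ 2)) PoszM; congr (_ ^ _).
  by have := hB m mP; lia.
have := @max_poly_roots _ Q [seq (r ^+ 2) ^+ M | M <- iota 0 (size Q)] Q0.
rewrite size_map size_iota ltnn => h; suff : false by [].
apply: h; first by apply/allP => _ /mapP [M _ ->].
rewrite map_inj_uniq ?iota_uniq // => M M'.
by rewrite !exprnP => /qpow_inj [].
Qed.

Lemma eigen_nonvanish lam P : eigenfunction (0, lam) P -> ~ vanish (pnt lam) P.
Proof.
move=> [hP hE] hv; apply: (not_all_vanish hP) => mu.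
move: {2}(part_size mu) (leqnn (part_size mu)) => d; elim: d mu => [|d IH] mu hd.
  have [-> //|/eqP ne] := eqVneq mu lam.
  by apply: (eigen_vanish_step hE) => // nu _; lia.
have [-> //|/eqP ne] := eqVneq mu lam.
by apply: (eigen_vanish_step hE) => // nu _ lt; apply: IH; lia.
Qed.

End Interp.

(** * Existence of eigenfunctions and commutation *)

Lemma span_scale_sub (R : nzRingType) n A (c d : R) (f g : laurent R n) :
  smon_span A (f - d *: g) -> smon_span A (c *: f - (c * d) *: g).
Proof. by move=> h; rewrite -scalerA -scalerBr; apply: spanZ. Qed.

Lemma span_sub_add (R : nzRingType) n A (f g h : laurent R n) :
  smon_span A (f - g) -> smon_span A (g - h) -> smon_span A (f - h).
Proof. by move=> h1 h2; rewrite -(subrK g f) -addrA; apply: spanD. Qed.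

Lemma mulr_shuffle4 (R : comPzRingType) (x w y z : R) :
  x * (w * (y * z)) = x * y * (w * z).
Proof. by ring. Qed.

Section Commute.
Variables (K : fieldType) (n : nat) (A : int * part n -> Prop).
Local Notation L := (ratfun K n).
Local Notation lp := (@to_ratfun K K n id).
Variables T U : L -> L.
Hypothesis TD : forall x y, T (x + y) = T x + T y.
Hypothesis TZ : forall c x, T (rC n c * x) = rC n c * T x.
Hypothesis UD : forall x y, U (x + y) = U x + U y.
Hypothesis UZ : forall c x, U (rC n c * x) = rC n c * U x.

Lemma commute_span : (forall b, A b -> T (U (lp (smon K b))) = U (T (lp (smon K b)))) ->
  forall f, smon_span A f -> T (U (lp f)) = U (T (lp f)).
Proof.
have E0 V : (forall c x, V (rC n c * x) = rC n c * V x) -> V (0 : L) = 0.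
  by move=> VZ; have := VZ 0 0; rewrite (rC0 K n) !mul0r.
move=> h; apply: span_ind => //.
- by rewrite lp0 (E0 U) // (E0 T) // (E0 U).
- by move=> f g hf hg; rewrite lpD UD TD hf hg TD UD.
- by move=> c f hf; rewrite lpZ UZ TZ hf TZ UZ.
Qed.

(** Commutation passes from y to x + c y when x is an eigenvector of both operators. *)
Lemma commute_eigen x y a b c : T x = rC n a * x -> U x = rC n b * x ->
  T (U y) = U (T y) -> T (U (x + rC n c * y)) = U (T (x + rC n c * y)).
Proof.
move=> Tx Ux hy; rewrite UD UZ TD TZ hy Ux TZ Tx TD TZ Tx UD UZ Ux UZ.
by congr (_ + _); exact: mulrCA.
Qed.

End Commute.

Section Existence.
Variables (K : fieldType) (n : nat) (r t : K).
Local Notation L := (ratfun K n).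
Local Notation lp := (@to_ratfun K K n id).
Local Notation D := (Dsop (n := n) r t).
Local Notation pnt := (point r t).
Local Notation s := (sX K).
Implicit Types (f P : laurent K n) (m : expo n) (mu nu lam : part n) (a b : int * part n).
Hypothesis r0 : r != 0.
Hypothesis t0 : t != 0.
Hypothesis indep : forall a b : int, r ^ a * t ^ b = 1 -> a = 0 /\ b = 0.
Hypothesis two_neq0 : (2 : K) != 0.

Section Expansion.
Variables (lam : part n) (l : seq (part n)) (F : part n -> laurent K n).
Hypothesis l_uniq : uniq l.
Hypothesis hF : forall nu, nu \in l -> eigenfunction r t (0, nu) (F nu).

(** The coefficients e nu are Laurent polynomials in s alone. *)
Definition expands f := exists e : part n -> laurent K n,
  (forall nu m, cf m (e nu) != 0 -> m.2 = 0) /\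
  lp f = \sum_(nu <- l) lp (e nu) * lp (F nu).

Lemma expandsD f g : expands f -> expands g -> expands (f + g).
Proof.
move=> [e [he Ef]] [e' [he' Eg]]; exists (fun nu => e nu + e' nu); split=> [nu m|].
  rewrite monalg.mcoeffD; have [->|/he //] := eqVneq (cf m (e nu)) 0.
  by rewrite add0r => /he'.
apply: etrans (lpD f g) _; rewrite Ef Eg -big_split; apply: eq_bigr => nu _ /=.
by rewrite -mulrDl; congr (_ * _); apply: esym; apply: lpD.
Qed.

Lemma expandsZ c f : expands f -> expands (c *: f).
Proof.
move=> [e [he Ef]]; exists (fun nu => c *: e nu); split=> [nu m|].
  by rewrite monalg.mcoeffZ mulf_eq0 negb_or => /andP[_ /he].
apply: etrans (lpZ c f) _; rewrite Ef mulr_sumr; apply: eq_bigr => nu _ /=.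
by apply: etrans (mulrA _ _ _) _; congr (_ * _); apply: esym; apply: lpZ.
Qed.

Lemma expands0 : expands 0.
Proof.
exists (fun=> 0); split=> [nu m|]; first by rewrite monalg.mcoeff0 eqxx.
rewrite lp0 big1 // => nu _; exact: mul0r.
Qed.

Lemma expands_F k nu : nu \in l -> expands (mul_spow k (F nu)).
Proof.
move=> nul; exists (fun nu' => if nu' == nu then lmon (k, 0) 1 else 0); split=> [nu' m|].
  case: (nu' == nu); last by rewrite monalg.mcoeff0 eqxx.
  rewrite monalg.mcoeffU; case: (eqVneq (k, 0) m) => [<- //|_].
  by rewrite mulr0n eqxx.
apply: etrans (lp_mul_spow k (F nu)) _.
rewrite (big_rem nu) //= eqxx big_seq big1 => [|nu'].
  rewrite addr0; congr (_ * _); apply: esym; apply: etrans (lpU _ _) _.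
  by rewrite rC1 mul1r.
rewrite mem_rem_uniq // inE => /andP[/negPf -> _]; rewrite lp0; exact: mul0r.
Qed.

(** s^k m_nu is s^k F_nu minus lower terms. *)
Lemma expands_smon (d : nat) b : smon_lt b (0, lam) ->
  (forall c, smon_lt c (0, lam) -> c.2 \in l) ->
  dot (wrho n) (b.1, pexpo b.2) < d%:Z -> expands (smon K b).
Proof.
move=> hb hl; elim: d b hb => [|d IH] b hb.
  rewrite ltNge; move/negP; case; rewrite /dot mul0r add0r.
  by apply: sumr_ge0 => i _; rewrite !ffunE.
case: b hb => k nu hb hd; have nul := hl _ hb.
have [hg _] := hF nul.
have -> : smon K (k, nu) = mul_spow k (F nu) + (-1) *: mul_spow k (F nu - smon K (0, nu)).
  rewrite mul_spowB scaleN1r opprB addrC subrK mul_spow_smon; congr (smon _ (_, _)).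
  by rewrite /= addr0.
apply: expandsD; first exact: expands_F.
apply: expandsZ; have : smon_span (fun c => smon_lt c (k, nu)) (mul_spow k (F nu - smon K (0, nu))).
  apply: span_mul_spow hg => c /(smon_lt_shift k) /=.
  by rewrite addr0.
move: (mul_spow _ _); apply: span_ind.
- exact: expands0.
- exact: expandsD.
- exact: expandsZ.
move=> c lt_c; apply: IH; last by have := smon_lt_wrho lt_c; rewrite /= in hd *; lia.
by apply: smon_lt_le_trans lt_c _; case: hb.
Qed.

(** Evaluate at mu, by induction on the size of mu: F_nu vanishes there when nu <> mu
    has at least the size of mu, and F_mu does not vanish at mu, so its coefficient is zero. *)
Lemma expands_uniq f : expands f -> (forall mu, mu \in l -> vanish (pnt mu) f) -> f = 0.
Proof.
move=> [e [he Ef]] hv.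
suff e0 mu : mu \in l -> e mu = 0.
  apply: lp_inj; rewrite Ef lp0 big_seq big1 // => nu nul.
  by rewrite e0 // lp0; exact: mul0r.
move: {2}(part_size mu).+1 (ltnSn (part_size mu)) => d; elim: d mu => // d IH mu hd mul.
have h1 : frac_at (ev r t mu) (lp f) (\sum_(nu <- l) value s (pnt mu) (e nu) * value s (pnt mu) (F nu)).
  by rewrite Ef; apply: frac_at_sum => nu _; apply: frac_atM; apply: ev_lp.
have := frac_at_uniq h1 (ev_lp r0 t0 mu f).
rewrite (vanish_value (sX_neq0 K) (hv mu mul)) (big_rem mu) //= big_seq big1 ?addr0; last first.
  move=> nu; rewrite mem_rem_uniq // inE => /andP[/eqP ne nul].
  have [lt|ge] := ltnP (part_size nu) (part_size mu).
    by rewrite (IH nu) ?value0 ?mul0r //; apply: leq_trans lt _.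
  rewrite [X in _ * X](vanish_value (sX_neq0 K)) ?mulr0 //.
  refine (eigen_vanish r0 t0 indep (hF nul) _) => sub.
  have sz := part_sub_size sub; apply: ne; apply: part_sub_eq sub _.
  by apply/eqP; rewrite eqn_leq sz ge.
move/eqP; rewrite mulf_eq0 => /orP[/eqP ev0|/eqP/value_vanish h]; last first.
  by case: (eigen_nonvanish r0 t0 indep (hF mul)).
(* e mu involves s alone, so that it is determined by its value. *)
apply/monalg.malgP => -[j x]; rewrite monalg.mcoeff0.
have [->//|nz] := eqVneq (cf (j, x) (e mu)) 0.
have x0 := he _ _ nz; rewrite /= in x0; subst x.
have := value_vanish ev0 j; rewrite hom_coefE => E.
rewrite -E; have jm : (j, 0) \in lsupp (e mu) by rewrite -monalg.mcoeff_neq0.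
have pv (m : expo n) : m.2 = 0 -> pval (pnt mu) m = 1.
  by move=> h; rewrite /pval big1 // => i _; rewrite h ffunE expr0z.
have sd (m : expo n) : m.2 = 0 -> sdeg m = m.1.
  by move=> h; rewrite /sdeg big1 ?addr0 // => i _; rewrite h ffunE.
rewrite (big_rem _ jm) /= big_seq big1 ?addr0.
  by rewrite sd // eqxx pv // mulr1.
move=> [j' x']; rewrite mem_rem_uniq ?finmap.fset_uniq // inE -monalg.mcoeff_neq0.
case/andP => ne /he /= x'0; rewrite x'0 in ne *; rewrite sd //=.
by move: ne; rewrite xpair_eqE eqxx andbT => /negPf ->; rewrite mulr0.
Qed.

End Expansion.

(** A stage in the construction of the eigenfunction: X is the set of partitions at which the
    values have been killed. *)
Definition good lam (X : part n -> Prop) f := exists c,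
  [/\ c != 0, smon_span (fun b => smon_lt b (0, lam)) (f - c *: smon K (0, lam)) &
      forall mu, X mu -> vanish (pnt mu) f].

Lemma span_lt_le a f c : smon_span (fun b => smon_lt b a) (f - c *: smon K a) ->
  smon_span (fun b => smon_le b a) f.
Proof.
move=> h; rewrite -[f](subrK (c *: smon K a)); apply: spanD.
  by apply: span_sub h => b [].
exact/spanZ/span_smon/smon_le_refl.
Qed.

(** Apply the operator with u = 1/(q^(mu_i) t^(n-i)), where i is an index at which mu and
    lam differ. *)
Lemma good_step lam mu X f : mu <> lam ->
  (forall nu sg nu', X nu -> vstrip nu sg nu' -> X nu') ->
  (forall sg nu, vstrip mu sg nu -> nu <> mu -> X nu) ->
  good lam X f -> exists g, good lam (fun nu => X nu \/ nu = mu) g.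
Proof.
move=> /part_neqP [i ne] hX hmu [c [c0 hf hv]]; pose u := (pnt mu i)^-1.
have E0 : eigval r t (0, lam) u != 0 by apply: eigval_point_neq0.
have [g Eg hg] := D_le t r0 two_neq0 u (span_lt_le hf).
exists g, (eigval r t (0, lam) u * c); split; first by rewrite mulf_neq0.
  exact: span_sub_add hg (span_scale_sub _ hf).
move=> nu [hnu|->]; apply: (eval_D r0 t0 indep Eg) => sg nu' hnu'.
  by left; apply/hv/hX/hnu'.
have [si|si] := boolP (sg i); last by right; exists i; rewrite mulVf ?point_neq0.
left; apply/hv/(hmu sg) => // e; have := vstrip_size hnu' si.
by rewrite e ltnn.
Qed.

Lemma good_exists lam (d : nat) : (d <= (part_size lam).+1)%N ->
  exists f, good lam (fun mu => (part_size mu < d)%N /\ mu <> lam) f.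
Proof.
elim: d => [|d IH] hd.
  exists (smon K (0, lam)), 1; rewrite oner_neq0 scale1r subrr; split=> //; first exact: span0.
  by move=> mu [].
have [f hf] := IH (ltnW hd).
have [l [_ hl]] := part_enum n d.
suff [g [c [c0 hg hv]]] : exists g, good lam (fun mu =>
    ((part_size mu < d)%N /\ mu <> lam) \/
    (mu \in [seq nu <- l | (part_size nu == d) && (nu != lam)])) g.
  exists g, c; split=> // mu [hmu ne]; apply: hv; move: hmu; rewrite ltnS leq_eqVlt.
  case/orP => [/eqP e|lt]; [right|by left].
  by rewrite mem_filter e eqxx hl ?e // andbT /=; apply/eqP.
(* The partitions of size d are treated one by one. *)
elim: l {hl} => [|mu l [g hg]] /=.
  by exists f; case: hf => c [c0 h hv]; exists c; split=> // mu [/hv|].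
case: ifP => [/andP[/eqP hmu /eqP ne]|_]; last by exists g.
have [||h [c [c0 hh hv]]] := good_step ne _ _ hg.
- move=> nu sg nu' hnu hs; have [->//|/eqP ne'] := eqVneq nu' nu.
  have lt := vstrip_lt hs ne'; left; split.
    case: hnu => [[h _]|]; first by apply: ltn_trans h.
    by rewrite mem_filter => /andP[/andP[/eqP <-]].
  move=> e; case: hnu => [[h _]|]; first by rewrite e in lt; lia.
  by rewrite mem_filter => /andP[/andP[/eqP h _] _]; rewrite e in lt; lia.
- move=> sg nu hs ne'; have lt := vstrip_lt hs ne'; left; split; first by rewrite -hmu.
  by move=> e; rewrite e in lt; lia.
exists h, c; split=> // nu hnu; apply: hv; case: hnu => [h'|]; first by left; left.
by rewrite inE => /orP[/eqP ->|h']; [right|left; right].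
Qed.

Lemma choose_on (T : eqType) U (Q : T -> U -> Prop) (u0 : U) (l : seq T) :
  (forall x, x \in l -> exists y, Q x y) -> exists F, forall x, x \in l -> Q x (F x).
Proof.
elim: l => [|x l IH] h; first by exists (fun=> u0).
have [F hF] := IH (fun y yl => h y (mem_behead (s := x :: l) yl)).
have [y hy] := h x (mem_head _ _).
exists (fun z => if z == x then y else F z) => z; rewrite inE.
by case: eqP => [-> //|_] /hF.
Qed.

(** Conditions linear in P, which mention neither the operators nor sqrt q, and yet determine
    the common eigenfunction. *)
Definition interp lam P := smon_span (fun b => smon_lt b (0, lam)) (P - smon K (0, lam)) /\
  forall mu, (part_size mu <= part_size lam)%N -> mu <> lam -> vanish (pnt mu) P.

Lemma interp_exists lam : exists P, interp lam P.
Proof.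
have [f [c [c0 hf hv]]] := good_exists (leqnn (part_size lam).+1).
exists (c^-1 *: f); split=> [|mu h ne]; last by apply/vanishZ/hv.
by have := span_scale_sub c^-1 hf; rewrite mulVf // scale1r.
Qed.

(** The list l contains all partitions nu such that some s^k m_nu is strictly dominated
    by m_lam. *)
Lemma lt_expands lam : (forall nu, dot (wrho n) (0, pexpo nu) < dot (wrho n) (0, pexpo lam) ->
    exists P, eigenfunction r t (0, nu) P) ->
  exists l F, [/\ uniq l, forall nu, nu \in l -> eigenfunction r t (0, nu) (F nu),
    forall nu, nu \in l -> (part_size nu <= part_size lam)%N /\ nu <> lam &
    forall f, smon_span (fun b => smon_lt b (0, lam)) f -> expands l F f].
Proof.
move=> IH; have [l0 [u0 hl0]] := part_enum n (part_size lam).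
pose l := [seq nu <- l0 | (part_size nu <= part_size lam)%N &&
    (dot (wrho n) (0, pexpo nu) < dot (wrho n) (0, pexpo lam))].
have [F hF] : exists F, forall nu, nu \in l -> eigenfunction r t (0, nu) (F nu).
  apply: (@choose_on _ _ (fun nu P => eigenfunction r t (0, nu) P) 0 l) => nu.
  by rewrite mem_filter => /andP[/andP[_ /IH]].
exists l, F; split=> //; first exact: filter_uniq.
  move=> nu; rewrite mem_filter => /andP[/andP[h1 h2] _]; split=> // e.
  by rewrite e ltxx in h2.
have ul : uniq l by apply: filter_uniq.
have hl b : smon_lt b (0, lam) -> b.2 \in l.
  move=> hb; have sz := smon_le_size hb.1; rewrite mem_filter hl0 // sz /= andbT.
  have := smon_lt_wrho hb; rewrite /dot /=; lia.
apply: span_ind.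
- exact: expands0.
- exact: expandsD.
- exact: expandsZ.
move=> b hb; apply: (expands_smon ul hF (d := (absz (dot (wrho n) (b.1, pexpo b.2))).+1) hb hl).
lia.
Qed.

(** D_u P minus its expected multiple of P is a combination of lower terms which
    vanishes at all partitions in the list of [lt_expands], hence is zero. *)
Lemma interp_eigen_rec lam P : (forall nu, dot (wrho n) (0, pexpo nu) < dot (wrho n) (0, pexpo lam) ->
    exists P, eigenfunction r t (0, nu) P) -> interp lam P -> eigenfunction r t (0, lam) P.
Proof.
move=> IH [hP hv]; split=> // u.
have [l [F [ul hF hl hx]]] := lt_expands IH.
have hP' : smon_span (fun b => smon_lt b (0, lam)) (P - 1 *: smon K (0, lam)).
  by rewrite scale1r.
have [g Eg hg] := D_le t r0 two_neq0 u (span_lt_le hP').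
have : g - eigval r t (0, lam) u *: P = 0.
  apply: (expands_uniq ul hF (hx _ hg)) => mu /hl [h1 h2].
  apply: vanishB; last exact/vanishZ/hv.
  apply: (eval_D r0 t0 indep Eg) => sg nu hnu; left.
  have sz := part_sub_size (vstrip_sub hnu); apply: hv; first exact: leq_trans h1.
  move=> e; rewrite e in hnu sz; have := part_sub_eq (vstrip_sub hnu).
  by move=> /(_ ltac:(lia)) => e'; apply: h2.
by move/eqP; rewrite subr_eq0 => /eqP E; rewrite Eg E lpZ.
Qed.

Lemma eigen_exists lam : exists P, eigenfunction r t (0, lam) P.
Proof.
move: {2}(absz (dot (wrho n) (0, pexpo lam))).+1 (ltnSn (absz (dot (wrho n) (0, pexpo lam)))) => d.
elim: d lam => // d IH lam hd; have [P hP] := interp_exists lam.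
exists P; apply: interp_eigen_rec hP => nu lt; apply: IH.
have : 0 <= dot (wrho n) (0, pexpo nu).
  by rewrite /dot mul0r add0r; apply: sumr_ge0 => i _; rewrite !ffunE.
by move: hd lt; lia.
Qed.

Lemma interp_eigen lam P : interp lam P -> eigenfunction r t (0, lam) P.
Proof. by apply: interp_eigen_rec => nu _; apply: eigen_exists. Qed.

Lemma eigen_spow k lam P : eigenfunction r t (0, lam) P -> eigenfunction r t (k, lam) (mul_spow k P).
Proof.
move=> [hP hE]; split=> [|u].
  have := span_mul_spow (B := fun b => smon_lt b (k, lam)) (k := k) _ hP.
  rewrite mul_spowB mul_spow_smon /= addr0; apply=> b /(smon_lt_shift k) /=.
  by rewrite addr0.
have E := lp_mul_spow k P; rewrite E Dsop_spow // hE.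
have -> : eigval r t (k, lam) u = r ^ k * eigval r t (0, lam) u.
  by rewrite /eigval /= expr0z mul1r.
by rewrite (rCM n (r ^ k)); exact: mulr_shuffle4.
Qed.

(** By induction along dominance, every s^k m_nu is a common eigenfunction plus lower terms. *)
Lemma D_commute lam u v f : smon_span (fun b => smon_le b (0, lam)) f ->
  D u (D v (lp f)) = D v (D u (lp f)).
Proof.
have comm A := @commute_span _ _ A _ _ (DsopD t r0 u) (DsopZ t r0 u) (DsopD t r0 v) (DsopZ t r0 v).
suff key (d : nat) b : dot (wrho n) (b.1, pexpo b.2) < d%:Z ->
   D u (D v (lp (smon K b))) = D v (D u (lp (smon K b))).
  apply: comm => b _; apply: (key (absz (dot (wrho n) (b.1, pexpo b.2))).+1); lia.
elim: d b => [|d IH] b hd.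
  move: hd; rewrite ltNge; move/negP; case; rewrite /dot mul0r add0r.
  by apply: sumr_ge0 => i _; rewrite !ffunE.
case: b hd => k nu hd; have [P0 /(eigen_spow k)] := eigen_exists nu.
move: (mul_spow k P0) => P [hP hE].
have -> : lp (smon K (k, nu)) = lp P + rC n (-1) * lp (P - smon K (k, nu)).
  by rewrite (rmorphN (@rC K n)) /= rC1 mulN1r -lpB opprB addrC subrK.
apply: (commute_eigen (DsopD t r0 u) (DsopZ t r0 u) (DsopD t r0 v) (DsopZ t r0 v)
  (-1) (hE u) (hE v)).
by apply: comm hP => c lt_c; apply: IH; have := smon_lt_wrho lt_c; lia.
Qed.

End Existence.

(** * Change of coefficients and the square root of q *)

Section CoefMap.
Variables (R : nzRingType) (n : nat).
Implicit Types (m : expo n).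

Lemma cf_mul_spow k (f : laurent R n) m : cf m (mul_spow k f) = cf (m.1 - k, m.2) f.
Proof.
have h_inj : injective (fun m : expo n => (k + m.1, m.2)).
  by move=> [j e] [j' e'] [/addrI -> ->].
case: m => j e /=; have E : j = k + (j - k) by rewrite addrC subrK.
rewrite {1}E; apply: (@cf_sum_lmon _ _ _ (fun m => (k + m.1, m.2)) _ (j - k, e)) => //.
  exact: finmap.fset_uniq.
exact: monalg.mcoeff_outdom.
Qed.

Variables (S : nzRingType) (phi : R -> S).

Definition mapl (f : laurent R n) : laurent S n := \sum_(m <- lsupp f) lmon m (phi (cf m f)).

Hypothesis phi0 : phi 0 = 0.

Lemma cf_mapl f m : cf m (mapl f) = phi (cf m f).
Proof.
apply: (@cf_sum_lmon _ _ _ id _ m); [exact: finmap.fset_uniq|by []|].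
by move/monalg.mcoeff_outdom ->.
Qed.

Hypothesis phiD : forall x y, phi (x + y) = phi x + phi y.
Hypothesis phi1 : phi 1 = 1.

Lemma mapl_leading a f : has_leading a f -> has_leading a (mapl f).
Proof.
move=> [U [c [hU E]]]; exists U, (fun b => phi (c b)); split=> //.
have {E} -> : f = \sum_(b <- U) c b *: smon R b + smon R a by rewrite -E subrK.
have phis (x : R) b m : phi (x * cf m (smon R b)) = phi x * cf m (smon S b).
  by rewrite !cf_smon; case: (_ && _); rewrite ?mulr1 ?mulr0.
apply/monalg.malgP => m; rewrite monalg.mcoeffB cf_mapl monalg.mcoeffD phiD.
rewrite -[cf m (smon R a)]mul1r phis phi1 mul1r addrK.
rewrite [in LHS](big_morph (monalg.mcoeff m) (monalg.mcoeffD m) (monalg.mcoeff0 m)).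
rewrite [in RHS](big_morph (monalg.mcoeff m) (monalg.mcoeffD m) (monalg.mcoeff0 m)).
rewrite (big_morph phi phiD phi0); apply: eq_bigr => b _.
by rewrite 2!monalg.mcoeffZ phis.
Qed.

End CoefMap.

Section BaseChange.
Variables (R : nzRingType) (n : nat) (K : fieldType) (phi : {rmorphism R -> K}).

Lemma to_ratfun_mapl (f : laurent R n) :
  to_ratfun phi f = to_ratfun (n := n) (@id K) (mapl phi f).
Proof.
rewrite /mapl (raddf_sum (@to_ratfun K K n id)); apply: eq_bigr => m _ /=.
by rewrite lpU.
Qed.

Lemma mapl_spow k (f : laurent R n) : mapl phi (mul_spow k f) = mul_spow k (mapl phi f).
Proof.
have p0 := rmorph0 phi; apply/monalg.malgP => m; rewrite cf_mapl // 2!cf_mul_spow.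
by rewrite cf_mapl.
Qed.

End BaseChange.

Section HC.
Variables (F K : fieldType) (n : nat) (phi : F -> K) (p : 'I_n -> F) (p' : 'I_n -> K).
Hypothesis phi0 : phi 0 = 0.
Hypothesis phiD : forall x y, phi (x + y) = phi x + phi y.
Hypothesis phip : forall c m, phi (c * pval p m) = phi c * pval p' m.

Lemma hom_coef_mapl d f : hom_coef d p' (mapl phi f) = phi (hom_coef d p f).
Proof.
rewrite [hom_coef d p f]hom_coefE (big_morph phi phiD phi0) /mapl.
rewrite (big_morph (hom_coef d p') (hom_coefD d p') (hom_coef0 d p')); apply: eq_bigr => m _.
apply: etrans (monalg.mmapU (f := @idfun K) _ _) _.
by case: eqP => _; rewrite ?phip // !mulr0 phi0.
Qed.
End HC.

(** In N^2 = q D^2 the leading exponents have different parities in q. *)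
Lemma Fq_nonsquare (y : Fqt) : y ^+ 2 <> Fq.
Proof.
move=> E; have h := frac_repr y; set N := \n_(repr y) in h; set D := \d_(repr y) in h.
have D0 : D != 0 by apply: denom_ratioP.
have Q0 : ('X_ord0 : {mpoly rat[2]}) != 0 by apply: mpolyX_neq0.
have E2 : N ^+ 2 = 'X_ord0 * D ^+ 2.
  apply/eqP; rewrite -tofrac_eq tofracXn -h tofracM tofracXn exprMn E.
  by [].
have N0 : N != 0.
  by apply/eqP => n0; move/eqP: E2; rewrite n0 expr0n eq_sym mulf_eq0 expf_eq0 (negPf Q0) (negPf D0).
have := congr1 (fun p => mlead p ord0) E2; rewrite mleadX // mleadM ?expf_neq0 //.
rewrite mleadX // mleadXm mulmnE mnmDE mnm1E eqxx mulmnE /=; lia.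
Qed.

(** The field Q(q,t)(sqrt q), with a Q(q,t)-linear projection onto Q(q,t). *)
Lemma Fqt_sqrt : exists (K : fieldType) (iota : {rmorphism Fqt -> K}) (r : K) (pi : K -> Fqt),
  [/\ r ^+ 2 = iota Fq, pi 0 = 0, pi 1 = 1, forall x y, pi (x + y) = pi x + pi y &
      forall c x, pi (x * iota c) = pi x * c].
Proof.
have irr : irreducible_poly ('X^2 - Fq%:P : {poly Fqt}).
  have sz : size ('X^2 - Fq%:P : {poly Fqt}) = 3 by rewrite size_XnsubC.
  apply: cubic_irreducible; first by rewrite sz.
  move=> y; rewrite /root !hornerE subr_eq0; apply/eqP; exact: Fq_nonsquare.
have [L _ [z rz _]] := irredp_FAdjoin irr.
(* The coordinate along the free family (1) is defined on all of L. *)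
have free1 : free [tuple (1 : L)] by rewrite seq1_free oner_neq0.
exists L, (GRing.in_alg L), z, (coord [tuple (1 : L)] ord0); split.
- by move: rz; rewrite rmorphB /= map_polyXn map_polyC /root !hornerE subr_eq0 => /eqP.
- exact: raddf0.
- by have := coord_free ord0 ord0 free1.
- exact: raddfD.
- by move=> c x; rewrite -[x * _]/(x * (c *: 1)) -scalerAr mulr1 linearZ /= mulrC.
Qed.

(** * The theorem *)

Section Generators.
Variables (K : fieldType) (iota : {rmorphism Fqt -> K}) (r : K).
Hypothesis hr : r ^+ 2 = iota Fq.
Local Notation t := (iota Ft).

(** Q(q,t) is the field of rational functions in s and one x over the rationals, so that
    the independence of Laurent monomials applies to q and t. *)
Lemma FqE : Fq = rS rat 1.
Proof. by []. Qed.

Lemma FtE : Ft = rX rat (ord0 : 'I_1).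
Proof. by rewrite /Ft /rX; congr ((mpolyX _ U_(_))%:F); apply/val_inj. Qed.

Lemma gen_r0 : r != 0.
Proof.
apply/eqP => e; move: hr; rewrite e expr0n /= => /esym/eqP.
by rewrite fmorph_eq0 FqE (negPf (rS_neq0 _ _)).
Qed.

Lemma gen_t0 : t != 0.
Proof. by rewrite fmorph_eq0 FtE rX_neq0. Qed.

Lemma gen_indep (a b : int) : r ^ a * t ^ b = 1 -> a = 0 /\ b = 0.
Proof.
move=> E; have : (r ^ a * t ^ b) ^ (2 : int) = 1 by rewrite E exp1rz.
have e2 : r ^ (2 : int) = iota Fq by rewrite -hr.
rewrite expfzMl !exprz_exp [a * 2]mulrC -(exprz_exp r) e2.
rewrite -!fmorphXz -rmorphM -(rmorph1 iota) => /fmorph_inj.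
rewrite FqE FtE; have -> : rX rat (ord0 : 'I_1) ^ (b * 2) = \prod_(i < 1) rX rat i ^ [ffun=> b * 2] i.
  by rewrite big_ord1 ffunE.
move=> /eqP; rewrite -[_ * _]/(mon rat (a, [ffun=> b * 2])) mon_eq1 => /eqP [-> /ffunP/(_ ord0)].
by rewrite !ffunE; lia.
Qed.

Lemma gen_two : (2 : K) != 0.
Proof.
rewrite -(rmorph_nat iota) fmorph_eq0 -(rmorph_nat (@FracField.tofrac {mpoly rat[2]})).
by rewrite tofrac_eq0 -(rmorph_nat (@mpolyC 2 rat)) mpolyC_eq0.
Qed.

End Generators.

Section Assembly.
Variable n : nat.
Implicit Types (lam mu : part n) (P : laurent Fqt n).

Definition pointF mu (i : 'I_n) : Fqt := Fq ^+ part_nth mu i * Ft ^+ (n - i.+1).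

Definition interpF lam P := has_leading (0, lam) P /\
  forall mu, (part_size mu <= part_size lam)%N -> mu <> lam -> vanish (pointF mu) P.

Section OverK.
Variables (K : fieldType) (iota : {rmorphism Fqt -> K}) (r : K).
Hypothesis hr : r ^+ 2 = iota Fq.
Local Notation t := (iota Ft).

Lemma iota_pval mu m : iota (pval (pointF mu) m) = pval (point r t mu) m.
Proof.
rewrite /pval rmorph_prod; apply: eq_bigr => i _; rewrite fmorphXz; congr (_ ^ _).
by rewrite /pointF rmorphM !rmorphXn /= -hr.
Qed.

Lemma hom_coef_iota d mu P : hom_coef d (point r t mu) (mapl iota P) = iota (hom_coef d (pointF mu) P).
Proof.
apply: hom_coef_mapl; [exact: rmorph0 | exact: rmorphD |].
by move=> c m; rewrite rmorphM /= iota_pval.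
Qed.

Lemma vanish_iota mu P : vanish (point r t mu) (mapl iota P) <-> vanish (pointF mu) P.
Proof.
split=> h d; last by rewrite hom_coef_iota h rmorph0.
by have := h d; rewrite hom_coef_iota -(rmorph0 iota) => /fmorph_inj.
Qed.

Lemma mapl_iota_leading a P : has_leading a P -> has_leading a (mapl iota P).
Proof. by apply: mapl_leading; [exact: rmorph0|exact: rmorphD|exact: rmorph1]. Qed.

Lemma interpF_eigen lam P : interpF lam P -> eigenfunction r t (0, lam) (mapl iota P).
Proof.
move=> [hP hv]; apply: (interp_eigen (gen_r0 hr) (gen_t0 iota) (gen_indep hr) (gen_two iota)).
split; first exact: mapl_iota_leading.
by move=> mu h ne; apply/vanish_iota/hv.
Qed.

(** Strictly dominated monomials do not contain the leading exponent. *)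
Lemma span_lt_cf (a : int * part n) (f : laurent K n) :
  smon_span (fun b => smon_lt b a) f -> cf (a.1, pexpo a.2) f = 0.
Proof.
move=> h; have := span_lt_lead (a := a) (P := f + smon K a); rewrite addrK => /(_ h).
move=> /lead_cf; rewrite monalg.mcoeffD cf_smon /= eqxx pexpo_orbit /=.
by move=> /eqP; rewrite -subr_eq0 addrK => /eqP.
Qed.

(** The eigenvalue, about which [common_eigenfunction] says nothing, is read off
    the leading coefficient. *)
Lemma common_eigen_over a P : common_eigenfunction a P -> eigenfunction r t a (mapl iota P).
Proof.
move=> [/mapl_iota_leading hP hE]; split=> // u; have [e] := hE K iota r u hr.
rewrite to_ratfun_mapl; move: (mapl iota P) hP => Q hQ E.
have hQ' : smon_span (fun b => smon_lt b a) (Q - 1 *: smon K a) by rewrite scale1r.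
have [g Eg hg] := D_le t (gen_r0 hr) (gen_two iota) u (span_lt_le hQ').
have geQ : g = e *: Q.
  by apply: lp_inj; rewrite -Eg E; apply: esym; apply: lpZ.
have c1 := lead_cf (span_lt_lead hQ).
have := span_lt_cf hg; rewrite geQ monalg.mcoeffB 2!monalg.mcoeffZ c1 !mulr1.
by move/eqP; rewrite subr_eq0 => /eqP <-.
Qed.

Lemma eigen_over_common a P : eigenfunction r t a (mapl iota P) -> forall u, exists e : K,
  Dsop r t u (to_ratfun iota P) = rC n e * to_ratfun iota P.
Proof. by move=> [_ hE] u; exists (eigval r t a u); rewrite to_ratfun_mapl. Qed.

End OverK.

(** The vanishing conditions have coefficients in Q(q,t), so that they survive the projection
    of a solution over Q(q,t)(sqrt q). *)
Lemma interpF_exists lam : exists P, interpF lam P.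
Proof.
have [K [iota [r [pi [hr pi0 pi1 piD piZ]]]]] := Fqt_sqrt.
have [P [hP hv]] := interp_exists (gen_r0 hr) (gen_t0 iota) (gen_indep hr) (gen_two iota) lam.
exists (mapl pi P); split; first exact: mapl_leading hP.
move=> mu h ne d; rewrite (hom_coef_mapl (p := point r (iota Ft) mu)) ?hv //.
by move=> c m; rewrite -(iota_pval hr) piZ.
Qed.

Lemma eval_partE P mu : eval_part P mu = value (sX Fqt) (pointF mu) P.
Proof. by []. Qed.

End Assembly.

Theorem theorem3p2 (n : nat) (hn : (0 < n)%N) (lam : part n) :
  [/\
    forall (K : fieldType) (iota : {rmorphism Fqt -> K}) (r u v : K)
           (f : laurent K n),
      r ^+ 2 = iota Fq ->
      smon_span (fun b => smon_le b (0, lam)) f ->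
      Dsop r (iota Ft) u (Dsop r (iota Ft) v (to_ratfun id f)) =
      Dsop r (iota Ft) v (Dsop r (iota Ft) u (to_ratfun id f)),
    forall (k : int) (mu : part n),
      smon_le (k, mu) (0, lam) ->
      exists P : laurent Fqt n,
        is_Pbar mu P /\ common_eigenfunction (k, mu) (mul_spow k P),
    forall P : laurent Fqt n, is_Pbar lam P ->
      forall mu : part n, ~ part_sub lam mu -> eval_part P mu = 0
    & forall P : laurent Fqt n, is_Pbar lam P -> eval_part P lam != 0].
Proof.
have [K [iota [r [_ [hr _ _ _ _]]]]] := Fqt_sqrt.
have r0 := gen_r0 hr; have t0 := gen_t0 iota; have ind := gen_indep hr.
split.
- move=> K' iota' r' u v f hr' hf.
  exact: (D_commute (gen_r0 hr') (gen_t0 iota') (gen_indep hr') (gen_two iota') u v hf).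
- move=> k mu _; have [P hP] := interpF_exists mu; exists P; split.
    split; first by case: hP.
    by move=> K' iota' r' u hr'; apply: (eigen_over_common (interpF_eigen hr' hP)).
  split; last first.
    move=> K' iota' r' u hr'; apply: (@eigen_over_common _ _ _ _ (k, mu)).
    rewrite mapl_spow; apply: eigen_spow; first exact: gen_r0 hr'.
    exact: interpF_eigen.
  have := span_mul_spow (B := fun b => smon_lt b (k, mu)) (k := k) _ hP.1.
  rewrite mul_spowB mul_spow_smon /= addr0; apply=> b /(smon_lt_shift k) /=.
  by rewrite addr0.
- move=> P /(common_eigen_over hr) hP mu hmu; rewrite eval_partE; apply: vanish_value; first exact: sX_neq0.
  by apply/(vanish_iota hr); apply: eigen_vanish hP hmu.
- move=> P /(common_eigen_over hr) hP; apply/eqP; rewrite eval_partE => /value_vanish.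
  by move/(vanish_iota hr); apply: eigen_nonvanish hP.
Qed.
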